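(* Let $\lambda=(\lambda_1,\lambda_2,\lambda_3)$, $\mu=(\mu_1,\mu_2,\mu_3)$, $\nu=(\nu_1,\nu_2,\nu_3)$ be triples of nonzero complex numbers, each consisting of pairwise distinct entries, that are generic in the sense that the character variety $\mathcal{M}_{\operatorname{B}}$ defined in the context is a non-empty smooth affine algebraic surface. Then $\mathcal{M}_{\operatorname{B}}$ admits a smooth compactification by a curve of type $I_1$: there is a smooth complete complex algebraic surface $\overline{\mathcal{M}}_{\operatorname{B}}$ containing $\mathcal{M}_{\operatorname{B}}$ as a Zariski open subset whose complement is a curve of type $I_1$. In particular, the body of the nerve (dual) complex of the compactifying divisor is of the homotopy type of $S^1$.
   Context: $\mathcal{M}_{\operatorname{B}}$, the $\operatorname{GL}(3,\mathbb{C})$ character variety of the three-punctured sphere, is the space of irreducible representations $\rho\colon\pi_1(\mathbb{C}P^1\setminus\{0,1,\infty\})\cong\langle a,b\rangle\to\operatorname{GL}(3,\mathbb{C})$ (free group on two generators) such that the eigenvalues of $\rho(a),\rho(b),\rho(ab)$ are $\{\lambda_i\},\{\mu_i\},\{\nu_i\}$ respectively, up to simultaneous conjugation by $\operatorname{PGL}(3,\mathbb{C})$. A curve of type $I_1$ (fishtail, in Kodaira's list) is an irreducible rational curve whose only singularity is one ordinary node (equivalently, topologically a $\mathbb{C}P^1$ with two points identified). The nerve (dual) complex of a nodal divisor on a surface has one vertex for each irreducible component and one edge for each node, connecting the vertices of the components whose branches meet there (a loop edge if the node is a self-intersection of one component). *)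

(* Defs.v *)
From HB Require Import structures.
From mathcomp Require Import all_boot all_order all_algebra.
From mathcomp Require Import -(notations) mpoly.
From mathcomp Require Import boolp classical_sets functions reals topology normedtype.
From mathcomp Require Import complex.

Set Implicit Arguments.
Unset Strict Implicit.
Unset Printing Implicit Defensive.

Import Order.TTheory GRing.Theory Num.Theory numFieldNormedType.Exports.

Local Open Scope classical_set_scope.
Local Open Scope ring_scope.

(*  Varieties over an algebraically closed field are treated in the classical
    language of Serre: a set of closed points, its Zariski topology, and the
    sheaf of K-valued regular functions.  A section over an open set U is
    represented by a total function whose values outside U are irrelevant. *)

Record space_with_functions (K : fieldType) := SpaceWithFunctions {
  point :> Type;
  zopen : set (set point);
  regular : set point -> set (point -> K) }.

Section Varieties.
Variable K : fieldType.
Implicit Types X Y : space_with_functions K.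

Definition zclosed X (A : set X) := zopen (~` A).

(* The last clause is the sheaf condition: being regular on U is a local
   property on U which depends only on the values on U. *)
Definition space_axioms X :=
  [/\ zopen [set: X],
      (forall U V : set X, zopen U -> zopen V -> zopen (U `&` V)),
      (forall F : set (set X), F `<=` zopen (s := X) ->
         zopen (\bigcup_(U in F) U))
    & (forall (U : set X) (f : X -> K), zopen U ->
         (regular U f <->
          forall x, U x -> exists V g,
            [/\ zopen V, V x, regular V g & {in U `&` V, f =1 g}]))].

Definition morphism X Y (phi : X -> Y) := forall V : set Y, zopen V ->
  zopen (phi @^-1` V) /\
  forall f, regular V f -> regular (phi @^-1` V) (f \o phi).

Definition isomorphism X Y (phi : X -> Y) := morphism phi /\
  exists psi : Y -> X, [/\ morphism psi, cancel phi psi & cancel psi phi].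

Definition isomorphic X Y := exists phi : X -> Y, isomorphism phi.

(* The induced structure; it is the usual one on a locally closed subset
   (in particular the reduced structure on a closed subset). *)
Definition subspace_wf X (A : set X) : space_with_functions K :=
  {| point := set_type A;
     zopen := [set W | exists U : set X, zopen U /\ W = set_val @^-1` U];
     regular := fun W f => forall x, W x -> exists (U : set X) g,
       [/\ zopen U, U (set_val x), regular U g &
           {in W `&` set_val @^-1` U, forall y, f y = g (set_val y)}] |}.

(* The points of the quotient are the classes of [E], an equivalence relation;
   open sets and regular functions are those of X that are saturated, resp.
   constant on the classes (the structure of a geometric quotient). *)
Definition quotient_class X (E : X -> X -> Prop) :=
  {C : set X | exists x, C = E x}.

Definition quotient_proj X (E : X -> X -> Prop) (x : X) : quotient_class E :=
  exist _ (E x) (ex_intro _ x erefl).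

Definition quotient_wf X (E : X -> X -> Prop) : space_with_functions K :=
  {| point := quotient_class E;
     zopen := [set W | zopen (quotient_proj E @^-1` W)];
     regular := fun W f =>
       regular (quotient_proj E @^-1` W) (f \o quotient_proj E) |}.

Definition peval n (p : mpoly n K) (v : 'rV[K]_n) : K := meval (v 0) p.

Definition zero_set n (S : set (mpoly n K)) : set 'rV[K]_n :=
  [set v | forall p, S p -> peval p v = 0].

Definition affine_space n : space_with_functions K :=
  {| point := 'rV[K]_n;
     zopen := [set U | exists S, U = ~` zero_set S];
     regular := fun U f => forall v, U v -> exists S p q,
       (~` zero_set S) v /\
       {in U `&` ~` zero_set S,
          forall w, peval q w != 0 /\ f w = peval p w / peval q w} |}.

Definition affine_variety X := exists n S,
  isomorphic X (@subspace_wf (affine_space n) (zero_set S)).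

Definition prevariety X := space_axioms X /\
  exists n (U : 'I_n -> set X),
    [/\ (forall i, zopen (U i)),
        (forall i, affine_variety (subspace_wf (U i)))
      & \bigcup_i U i = setT].

(* The Zariski topology of the product variety X x Y, which is finer than the
   product topology: a basis is given by the loci
   {(x, y) in U x V | \sum_i f_i(x) g_i(y) != 0}
   with f_i regular on U and g_i regular on V. *)
Definition prod_zopen X Y (W : set (X * Y)) := forall z, W z ->
  exists (U : set X) (V : set Y) n (f : 'I_n -> X -> K) (g : 'I_n -> Y -> K),
    [/\ zopen U /\ zopen V,
        (forall i, regular U (f i) /\ regular V (g i)),
        U z.1 /\ V z.2,
        \sum_i f i z.1 * g i z.2 != 0
      & forall x y, U x -> V y -> \sum_i f i x * g i y != 0 -> W (x, y)].

Definition prod_zclosed X Y (Z : set (X * Y)) := prod_zopen (~` Z).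

Definition variety X := prevariety X /\
  @prod_zclosed X X [set z | z.1 = z.2].

Definition complete X := forall Y, variety Y ->
  forall Z : set (X * Y), prod_zclosed Z -> zclosed (snd @` Z).

Definition irreducible_set X (A : set X) := A !=set0 /\
  forall F G : set X, zclosed F -> zclosed G ->
    A `<=` F `|` G -> A `<=` F \/ A `<=` G.

Definition irreducible_space X := irreducible_set [set: X].

Definition irreducible_component X (C : set X) := irreducible_set C /\
  forall C' : set X, irreducible_set C' -> C `<=` C' -> C' = C.

(* Some open neighbourhood of x in X is isomorphic to an open neighbourhood of
   z in the subset Z of affine space, in such a way that x goes to z. *)
Definition local_model X (x : X) m (Z : set 'rV[K]_m) (z : 'rV[K]_m) :=
  exists (U : set X) (O : set (affine_space m)),
    [/\ zopen U, zopen O, U x &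
        exists phi : subspace_wf U ->
                     @subspace_wf (affine_space m) (Z `&` O),
          isomorphism phi /\
          forall u, set_val u = x -> set_val (phi u) = z].

Definition jacobian n m (f : 'I_n -> mpoly m K) (z : 'rV[K]_m) :
  'M[K]_(n, m) := \matrix_(i, j) peval (mderiv j (f i)) z.

Definition hessian m (f : mpoly m K) (z : 'rV[K]_m) : 'M[K]_m :=
  \matrix_(i, j) peval (mderiv i (mderiv j f)) z.

(* X is smooth of dimension d at x: near x it is cut out of an affine space of
   dimension n + d by n equations with independent differentials. *)
Definition smooth_at d X (x : X) := exists n (f : 'I_n -> mpoly (n + d) K) z,
  local_model x (zero_set (range f)) z /\ \rank (jacobian f z) = n.

Definition smooth d X := forall x : X, smooth_at d x.

(* X has an ordinary node at x: near x it is a plane curve f = 0 having at x a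
   double point with two distinct tangents, i.e. f and df vanish and the
   quadratic part of f is nondegenerate.  Nondegeneracy forces f to be reduced
   near that point, so that the zero set carries the same information. *)
Definition node_at X (x : X) := exists (f : mpoly 2 K) z,
  [/\ local_model x (zero_set [set f]) z,
      (forall j, peval (mderiv j f) z = 0)
    & \det (hessian f z) != 0].

(* Birational to the affine, equivalently to the projective, line *)
Definition rational_curve X := exists (U : set X) (V : set (affine_space 1)),
  [/\ zopen U /\ U !=set0, zopen V /\ V !=set0
    & isomorphic (subspace_wf U) (subspace_wf V)].

Definition type_I1 X :=
  [/\ irreducible_space X, rational_curve X
    & exists p : X, node_at p /\ forall x : X, x <> p -> smooth_at 1 x].

(* A representation of the free group on a and b is a pair of invertible
   matrices (A, B), acting on column vectors; the pair is encoded as a point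
   of the affine space of 3 x (3 + 3) matrices. *)
Definition rep_a (v : 'rV[K]_(3 * (3 + 3))) : 'M[K]_3 :=
  lsubmx (vec_mx v : 'M[K]_(3, 3 + 3)).
Definition rep_b (v : 'rV[K]_(3 * (3 + 3))) : 'M[K]_3 :=
  rsubmx (vec_mx v : 'M[K]_(3, 3 + 3)).

(* The row space of U is the space of transposes of a subspace of columns,
   whence the transposed matrices. *)
Definition irreducible_rep (A B : 'M[K]_3) := forall U : 'M[K]_3,
  stablemx U A^T -> stablemx U B^T -> U = 0 \/ row_full U.

Definition has_eigenvalues (A : 'M[K]_3) (lambda : 'I_3 -> K) :=
  char_poly A = \prod_i ('X - (lambda i)%:P).

Definition rep_set (lambda mu nu : 'I_3 -> K) : set 'rV[K]_(3 * (3 + 3)) :=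
  [set v | let A := rep_a v in let B := rep_b v in
    [/\ A \in unitmx /\ B \in unitmx,
        irreducible_rep A B,
        has_eigenvalues A lambda,
        has_eigenvalues B mu
      & has_eigenvalues (A *m B) nu]].

Definition rep_space (lambda mu nu : 'I_3 -> K) : space_with_functions K :=
  @subspace_wf (affine_space (3 * (3 + 3))) (rep_set lambda mu nu).

(* Scalar matrices act trivially, so the classes are the PGL(3)-orbits. *)
Definition conjugate (lambda mu nu : 'I_3 -> K)
    (v w : rep_space lambda mu nu) :=
  exists2 g : 'M[K]_3, g \in unitmx &
    rep_a (set_val w) = g *m rep_a (set_val v) *m invmx g /\
    rep_b (set_val w) = g *m rep_b (set_val v) *m invmx g.

Definition character_variety (lambda mu nu : 'I_3 -> K) :=
  quotient_wf (@conjugate lambda mu nu).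

Definition component X := {C : set X | irreducible_component C}.
Definition node X := {p : X | node_at p}.

(* [e p] lists the ends of the edge p, in either order: the components of the
   two branches at the node p are exactly the components passing through p,
   and there is only one of them when p is a self-intersection. *)
Definition nerve_edges X (e : node X -> component X * component X) :=
  forall (p : node X) (C : component X),
    sval C (sval p) <-> C = (e p).1 \/ C = (e p).2.

End Varieties.

Definition unit_interval (R : realType) : topologicalType :=
  set_type [set t : R | 0 <= t <= 1].

Inductive graph_cell (R : realType) (V E : Type) :=
| VertexCell of V
| EdgeCell of E & {t : R | 0 < t < 1}.

(* The body of the one-dimensional complex with vertices V, edges E and
   attaching maps e. *)
Definition graph_body (R : realType) (V E : Type) (e : E -> V * V) : Type :=
  graph_cell R V E.

Section GraphBody.
Variables (R : realType) (V E : Type) (e : E -> V * V).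

Definition edge_map (a : E) (t : unit_interval R) : graph_body R e :=
  match pselect (0 < set_val t < 1) with
  | left H => EdgeCell V a (exist _ (set_val t) H)
  | right _ => VertexCell R E (if set_val t == 0 then (e a).1 else (e a).2)
  end.

(* The weak (CW) topology, final for the characteristic maps of the edges *)
Definition graph_open : set (set (graph_body R e)) :=
  [set W | forall a, open (edge_map a @^-1` W)].

Lemma graph_openT : graph_open [set: graph_body R e].
Proof. by move=> a; rewrite preimage_setT; exact: openT. Qed.

Lemma graph_openI (A B : set (graph_body R e)) :
  graph_open A -> graph_open B -> graph_open (A `&` B).
Proof. by move=> oA oB a; rewrite preimage_setI; exact: openI. Qed.

Lemma graph_open_bigU (I : Type) (f : I -> set (graph_body R e)) :
  (forall i, graph_open (f i)) -> graph_open (\bigcup_i f i).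
Proof.
by move=> of_ a; rewrite preimage_bigcup; apply: bigcup_open => i _; exact: of_.
Qed.

HB.instance Definition _ := gen_eqMixin (graph_body R e).
HB.instance Definition _ := gen_choiceMixin (graph_body R e).
HB.instance Definition _ := isOpenTopological.Build (graph_body R e)
  graph_openT graph_openI graph_open_bigU.
End GraphBody.

Definition homotopic (R : realType) (S T : topologicalType) (f g : S -> T) :=
  exists2 H : S * unit_interval R -> T, continuous H &
    forall x (t : unit_interval R),
      (set_val t = 0 -> H (x, t) = f x) /\ (set_val t = 1 -> H (x, t) = g x).

Definition homotopy_equivalent (R : realType) (S T : topologicalType) :=
  exists (f : S -> T) (g : T -> S),
    [/\ continuous f, continuous g,
        homotopic R (g \o f) id & homotopic R (f \o g) id].

Definition circle (R : realType) : topologicalType :=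
  set_type [set x : R * R | x.1 ^+ 2 + x.2 ^+ 2 = 1].

(* Main.v *)
Require Import Defs.
From mathcomp Require Import all_boot all_order all_algebra.
From mathcomp Require Import -(notations) mpoly.
From mathcomp Require Import boolp classical_sets functions reals topology normedtype.
From mathcomp Require Import complex ring lra.

(** For a pair (A, B) put x = tr (adj A B), y = tr (A adj B) and
    z = tr (A B adj A adj B). When the eigenvalues of A, B and A B are given, these
    invariants of conjugation satisfy one equation
    z^2 - (x y + ...) z + (c x^3 + a y^3 + ...) = 0, where a = det A, c = det B and
    the dots have lower degree ([fricke], [fricke_identity]). The compactification
    is the closure of this affine cubic surface in projective 3-space. Its section
    by the plane at infinity is the cubic curve x y z = c x^3 + a y^3, which is
    irreducible with one node since a and c are nonzero ([infinity_type_I1]), and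
    the surface is smooth along it ([cubic_smooth_at_infinity]).

    The character variety is at first only an open subset of the affine cubic.
    After diagonalisation of A, conjugation reduces to that by the diagonal torus,
    and x, y, z determine the torus invariants of B: its diagonal, the products of
    opposite entries and the two 3-cycles. The pair is irreducible if and only if
    the graph of the nonzero entries of B is strongly connected; B then has one of
    five normal forms, which are regular local sections of the quotient
    ([character_iso]). The missing points, the invariants of reducible pairs, are
    finite in number ([nongeneric_finite]). Regular functions extend over a finite
    set, by the theorem of Hartogs in the (x, y)-plane ([plane_hartogs]) applied to
    their coefficients with respect to 1 and z, so a proper open subset with finite
    complement is not affine ([cofinite_affine]). As the character variety is
    affine, it is the whole affine cubic, and the surface is smooth at finite
    distance because the character variety is.

    Completeness is the valuative criterion, where the valuation ring is replaced
    by a place of an ultraproduct of copies of the ground field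
    ([place_total], [proj_cubic_complete]). The curve at infinity is irreducible,
    and its other points are not nodes, since they have a neighbourhood isomorphic
    to an open subset of the line ([node_not_line]). The nerve is thus one vertex
    with one loop, which is homeomorphic to the circle ([loop_graph_circle]). *)

Set Implicit Arguments.
Unset Strict Implicit.
Unset Printing Implicit Defensive.

Import Order.TTheory GRing.Theory Num.Theory numFieldNormedType.Exports.

Local Open Scope classical_set_scope.
Local Open Scope ring_scope.

(** * Spaces with functions *)

(** The ring structure that every space built here has on its regular
    functions, in the form in which it passes to subspaces and quotients. *)
Record ringed (K : fieldType) (X : space_with_functions K) : Prop := Ringed {
  ringed_axioms : space_axioms X;
  ringed_cst : forall (U : set X) c, zopen U -> regular U (fun=> c);
  ringedD : forall (U : set X) f g, zopen U -> regular U f -> regular U g ->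
    regular U (fun x => f x + g x);
  ringedM : forall (U : set X) f g, zopen U -> regular U f -> regular U g ->
    regular U (fun x => f x * g x);
  ringedV : forall (U : set X) f, zopen U -> regular U f ->
    let V := [set x | U x /\ f x != 0] in
    zopen V /\ regular V (fun x => (f x)^-1) }.

Section Local.
Variables (K : fieldType) (X : space_with_functions K).
Hypothesis aX : space_axioms X.
Implicit Types (U V : set X) (f g : X -> K).

Lemma zopenT : zopen [set: X]. Proof. by case: aX. Qed.

Lemma zopenI U V : zopen U -> zopen V -> zopen (U `&` V).
Proof. by case: aX => _ + _ _; apply. Qed.

Lemma zopen_local U :
  (forall x, U x -> exists V, [/\ zopen V, V x & V `<=` U]) -> zopen U.
Proof.
move=> h; case: aX => _ _ hU _.
have -> : U = \bigcup_(V in [set V | zopen V /\ V `<=` U]) V.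
  apply/seteqP; split=> [x Ux|x [V [_ VU] Vx]]; last exact: VU.
  by have [V [oV Vx VU]] := h x Ux; exists V.
by apply: hU => V [].
Qed.

Lemma regular_local U f : zopen U ->
  (forall x, U x -> exists V g,
    [/\ zopen V, V x, regular V g & forall y, U y -> V y -> f y = g y]) ->
  regular U f.
Proof.
move=> oU h; case: aX => _ _ _ hs; apply/(hs U f oU) => x Ux.
have [V [g [oV Vx rg fg]]] := h x Ux; exists V, g; split=> // y.
by rewrite inE => -[]; apply: fg.
Qed.

Lemma regular_eq U f g : zopen U -> regular U f ->
  (forall x, U x -> f x = g x) -> regular U g.
Proof.
move=> oU rf fg; apply: regular_local => // x Ux.
by exists U, f; split=> // y Uy _; rewrite fg.
Qed.

Lemma regularS U V f : zopen U -> zopen V -> V `<=` U ->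
  regular U f -> regular V f.
Proof.
move=> oU oV VU rf; apply: regular_local => // x Vx.
by exists U, f; split=> //; apply: VU.
Qed.

End Local.

Section Polynomials.
Variable K : fieldType.

Lemma mpoly_ring_ind n (P : mpoly n K -> Prop) :
  (forall c, P (mpolyC n c)) -> (forall i, P (@mpolyX n K (mnm1 i))) ->
  (forall p q, P p -> P q -> P (p + q)) ->
  (forall p q, P p -> P q -> P (p * q)) -> forall p, P p.
Proof.
move=> hC hX hD hM; apply: mpolyind; first by rewrite -[0](mpolyC0 n); exact: hC.
move=> c m p _ _ hp; apply: hD => //; rewrite -mul_mpolyC; apply: (hM) => //.
rewrite mpolyXE_id; apply: big_ind => [|? ?|i _]; [exact: hC|exact: (hM)|].
elim: (m i) => [|k IH]; first by rewrite expr0; exact: hC.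
by rewrite exprS; apply: hM.
Qed.

Lemma pevalC n c (v : 'rV[K]_n) : peval (mpolyC n c) v = c.
Proof. exact: mevalC. Qed.
Lemma pevalX n i (v : 'rV[K]_n) : peval (@mpolyX n K (mnm1 i)) v = v 0 i.
Proof. exact: mevalXU. Qed.
Lemma pevalD n p q (v : 'rV[K]_n) : peval (p + q) v = peval p v + peval q v.
Proof. exact: mevalD. Qed.
Lemma pevalN n p (v : 'rV[K]_n) : peval (- p) v = - peval p v.
Proof. exact: mevalN. Qed.
Lemma pevalB n p q (v : 'rV[K]_n) : peval (p - q) v = peval p v - peval q v.
Proof. exact: mevalB. Qed.
Lemma pevalM n p q (v : 'rV[K]_n) : peval (p * q) v = peval p v * peval q v.
Proof. exact: mevalM. Qed.
Lemma peval1 n (v : 'rV[K]_n) : peval 1 v = 1.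
Proof. exact: meval1. Qed.
Lemma pevalXn n p k (v : 'rV[K]_n) : peval (p ^+ k) v = peval p v ^+ k.
Proof. by elim: k => [|k IH]; rewrite ?peval1 // !exprS pevalM IH. Qed.

Definition pevalE :=
  (pevalC, pevalX, pevalD, pevalN, pevalM, pevalXn, peval1).

End Polynomials.

Section Affine.
Variables (K : fieldType) (n : nat).
Local Notation A := (@affine_space K n).
Implicit Types (U : set A) (f : A -> K).

Lemma zopen_affineP U : zopen U <-> forall v, U v ->
  exists2 s, peval s v != 0 & forall w, peval s w != 0 -> U w.
Proof.
split=> [[S ->] v /existsNP[s /not_implyP[Ss /eqP sv]]|h].
  by exists s => // w sw /(_ s Ss) /eqP; rewrite (negPf sw).
exists [set s | forall w, peval s w != 0 -> U w]; apply/seteqP.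
split=> v => [Uv|/existsNP[s /not_implyP[Ss /eqP sv]]]; last exact: Ss.
by have [s sv hs] := h v Uv => /(_ s hs) /eqP; rewrite (negPf sv).
Qed.

Lemma regular_affineP U f : regular U f <-> forall v, U v -> exists p q,
  peval q v != 0 /\ forall w, U w -> peval q w != 0 -> f w = peval p w / peval q w.
Proof.
split=> h v Uv.
  have [S [p [q [/existsNP[s /not_implyP[Ss /eqP sv]] hpq]]]] := h v Uv.
  have hS w : U w -> peval s w != 0 -> w \in U `&` ~` zero_set S.
    by move=> Uw sw; rewrite inE; split=> // /(_ s Ss) /eqP; rewrite (negPf sw).
  exists (p * s), (q * s); rewrite pevalM mulf_neq0 ?(hpq v _).1 ?hS //; split=> // w Uw.
  rewrite !pevalM mulf_eq0 negb_or => /andP[qw sw].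
  by rewrite (hpq w _).2 ?hS // -mulf_div divff // mulr1.
have [p [q [qv hpq]]] := h v Uv.
exists [set q], p, q; split=> [/(_ q erefl) /eqP|w]; first by rewrite (negPf qv).
rewrite inE => -[Uw /existsNP[_ /not_implyP[-> /eqP qw]]].
by split=> //; exact: hpq.
Qed.

Lemma zopen_nonzero s : @zopen K A [set v | peval s v != 0].
Proof. by apply/zopen_affineP => v sv; exists s. Qed.

Lemma affine_axioms : space_axioms A.
Proof.
have hT : @zopen K A setT.
  by apply/zopen_affineP => v _; exists 1 => //; rewrite peval1 oner_eq0.
have hI (U V : set A) : zopen U -> zopen V -> zopen (U `&` V).
  move=> /zopen_affineP hU /zopen_affineP hV; apply/zopen_affineP => v [Uv Vv].
  have [s sv hs] := hU v Uv; have [t tv ht] := hV v Vv.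
  exists (s * t) => [|w]; rewrite pevalM mulf_eq0 negb_or ?sv //.
  by case/andP => sw tw; split; [apply: hs|apply: ht].
split=> //.
  move=> F oF; apply/zopen_affineP => v [U FU Uv].
  have [s sv hs] := (zopen_affineP U).1 (oF U FU) v Uv.
  by exists s => // w sw; exists U => //; exact: hs.
move=> U f oU; split=> [rf x Ux|h].
  by exists U, f; split=> // w; rewrite inE.
apply/regular_affineP => v Uv; have [V [g [oV Vv rg fg]]] := h v Uv.
have [s sv hs] := (zopen_affineP V).1 oV v Vv.
have [p [q [qv hpq]]] := (regular_affineP V g).1 rg v Vv.
exists (p * s), (q * s); rewrite pevalM mulf_neq0 //; split=> // w Uw.
rewrite !pevalM mulf_eq0 negb_or => /andP[qw sw]; have Vw := hs w sw.
by rewrite fg ?inE // hpq // -mulf_div divff // mulr1.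
Qed.

Lemma affine_ringed : ringed A.
Proof.
split; first exact: affine_axioms.
- move=> U c _; apply/regular_affineP => v _; exists (mpolyC n c), 1.
  by split=> [|w _ _]; rewrite !pevalE ?oner_eq0 // divr1.
- move=> U f g _ /regular_affineP hf /regular_affineP hg.
  apply/regular_affineP => v Uv.
  have [p [q [qv hpq]]] := hf v Uv; have [r [s [sv hrs]]] := hg v Uv.
  exists (p * s + r * q), (q * s); split=> [|w Uw].
    by rewrite pevalM mulf_neq0.
  rewrite !pevalE mulf_eq0 negb_or => /andP[qw sw].
  by rewrite hpq // hrs // addf_div.
- move=> U f g _ /regular_affineP hf /regular_affineP hg.
  apply/regular_affineP => v Uv.
  have [p [q [qv hpq]]] := hf v Uv; have [r [s [sv hrs]]] := hg v Uv.
  exists (p * r), (q * s); split=> [|w Uw].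
    by rewrite pevalM mulf_neq0.
  rewrite !pevalE mulf_eq0 negb_or => /andP[qw sw].
  by rewrite hpq // hrs // mulf_div.
move=> U f /zopen_affineP oU /regular_affineP hf /=; split.
  apply/zopen_affineP => v [Uv fv].
  have [s sv hs] := oU v Uv; have [p [q [qv hpq]]] := hf v Uv.
  have pv : peval p v != 0 by move: fv; rewrite hpq // mulf_eq0 negb_or => /andP[].
  exists (p * q * s); first by rewrite !pevalM !mulf_neq0.
  move=> w; rewrite !pevalM !mulf_eq0 !negb_or => /andP[/andP[pw qw] sw].
  have Uw := hs w sw; split=> //; rewrite hpq // mulf_neq0 ?invr_eq0 //.
apply/regular_affineP => v [Uv fv]; have [p [q [qv hpq]]] := hf v Uv.
have pv : peval p v != 0 by move: fv; rewrite hpq // mulf_eq0 negb_or => /andP[].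
exists (q * q), (p * q); split=> [|w [Uw fw]]; rewrite !pevalM; first exact: mulf_neq0.
rewrite mulf_eq0 negb_or => /andP[pw qw].
by rewrite hpq // invf_div -mulf_div divff // mulr1.
Qed.

End Affine.

Section Subspace.
Variables (K : fieldType) (X : space_with_functions K) (A : set X).
Hypothesis rX : ringed X.
Local Notation aX := (ringed_axioms rX).
Local Notation SA := (subspace_wf A).

Lemma zopen_sub (U : set X) : zopen U -> @zopen K SA (set_val @^-1` U).
Proof. by exists U. Qed.

Lemma regular_sub (U : set X) g : zopen U -> regular U g ->
  @regular K SA (set_val @^-1` U) (fun a => g (set_val a)).
Proof. by move=> oU rg a Ua; exists U, g; split. Qed.

Lemma subspace_axioms : space_axioms SA.
Proof.
split.
- by exists setT; split; [exact: (zopenT aX)|rewrite preimage_setT].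
- move=> _ _ [U [oU ->]] [V [oV ->]]; exists (U `&` V); split; last by [].
  exact: (zopenI aX).
- move=> F oF; exists (\bigcup_(U in [set U : set X | zopen U /\
    set_val @^-1` U `<=` \bigcup_(W in F) W]) U); split.
    by case: aX => _ _ hU _; apply: hU => U [].
  apply/seteqP; split=> [a [W FW Wa]|a [U [_ hU] Ua]]; last exact: hU.
  have [U [oU eW]] := oF W FW; exists U; last by rewrite eW in Wa.
  by split=> //; rewrite -eW => b Wb; exists W.
move=> W f oW; split=> [rf x Wx|h x Wx].
  by exists W, f; split=> // y.
have [V [g [[U [oU eV]] Vx rg fg]]] := h x Wx.
have [U' [g' [oU' U'x rg' gg']]] := rg x Vx; subst V.
exists (U `&` U'), g'; split; first exact: (zopenI aX).
- by split.
- by apply: (regularS aX oU' _ _ rg'); [exact: (zopenI aX)|move=> ? []].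
move=> y; rewrite inE => -[Wy [Uy U'y]].
by rewrite fg ?inE //; apply: gg'; rewrite inE.
Qed.

Lemma subspace_ringed : ringed SA.
Proof.
split; first exact: subspace_axioms.
- move=> _ c [U [oU ->]] a Ua; exists U, (fun=> c); split=> //.
  exact: (ringed_cst rX).
- move=> W f g _ hf hg a Wa.
  have [U [f' [oU Ua rf ff']]] := hf a Wa; have [V [g' [oV Va rg gg']]] := hg a Wa.
  have oUV := zopenI aX oU oV.
  exists (U `&` V), (fun x => f' x + g' x); split=> //.
    apply: (ringedD rX) => //; first by apply: (regularS aX oU) => // ? [].
    by apply: (regularS aX oV) => // ? [].
  by move=> y; rewrite inE => -[Wy [Uy Vy]]; rewrite ff' ?inE // gg' ?inE.
- move=> W f g _ hf hg a Wa.
  have [U [f' [oU Ua rf ff']]] := hf a Wa; have [V [g' [oV Va rg gg']]] := hg a Wa.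
  have oUV := zopenI aX oU oV.
  exists (U `&` V), (fun x => f' x * g' x); split=> //.
    apply: (ringedM rX) => //; first by apply: (regularS aX oU) => // ? [].
    by apply: (regularS aX oV) => // ? [].
  by move=> y; rewrite inE => -[Wy [Uy Vy]]; rewrite ff' ?inE // gg' ?inE.
move=> W f [U0 [oU0 eW]] hf /=; split.
  apply: (zopen_local subspace_axioms) => a [Wa fa].
  have [U [f' [oU Ua rf ff']]] := hf a Wa; have [oV _] := ringedV rX oU rf.
  have oV' := zopenI aX oU0 oV; rewrite eW in Wa.
  exists (set_val @^-1` (U0 `&` [set x | U x /\ f' x != 0])); split.
  - exact: zopen_sub.
  - by split=> //; split=> //; rewrite -ff' ?inE // eW.
  - by move=> b [U0b [Ub fb]]; rewrite eW; split=> //; rewrite ff' ?inE // eW.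
move=> a [Wa fa].
have [U [f' [oU Ua rf ff']]] := hf a Wa; have [oV rV] := ringedV rX oU rf.
exists [set x | U x /\ f' x != 0], (fun x => (f' x)^-1); split=> //.
  by split=> //; rewrite -ff' ?inE.
by move=> b; rewrite inE => -[[Wb fb] [Ub f'b]]; rewrite ff' ?inE.
Qed.

End Subspace.

Section Quotient.
Variables (K : fieldType) (X : space_with_functions K) (E : X -> X -> Prop).
Hypothesis rX : ringed X.
Local Notation aX := (ringed_axioms rX).
Local Notation Q := (quotient_wf E).
Local Notation pr := (quotient_proj E).

Lemma quotient_axioms : space_axioms Q.
Proof.
split.
- by rewrite /= preimage_setT; exact: (zopenT aX).
- by move=> U V oU oV; rewrite /= preimage_setI; exact: (zopenI aX).
- move=> F oF; rewrite /= preimage_bigcup.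
  apply: (zopen_local aX) => x [U FU Ux]; exists (pr @^-1` U); split=> //.
    exact: (oF U FU).
  by move=> y Uy; exists U.
move=> U f oU; split=> [rf x Ux|h].
  by exists U, f; split=> // y.
apply: (regular_local aX) => // x Ux.
have [V [g [oV Vx rg fg]]] := h (pr x) Ux.
exists (pr @^-1` V), (g \o pr); split=> // y Uy Vy.
by rewrite /= fg // inE.
Qed.

Lemma quotient_ringed : ringed Q.
Proof.
split; first exact: quotient_axioms.
- by move=> U c oU; exact: (ringed_cst rX).
- by move=> U f g oU rf rg; exact: (ringedD rX oU rf rg).
- by move=> U f g oU rf rg; exact: (ringedM rX oU rf rg).
by move=> U f oU rf; exact: (ringedV rX oU rf).
Qed.

Lemma quotient_proj_morphism : @morphism K X Q pr.
Proof. by move=> V oV; split. Qed.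

End Quotient.

Section Morphisms.
Variable K : fieldType.
Implicit Types X Y Z : space_with_functions K.

Lemma morphism_comp X Y Z (f : X -> Y) (g : Y -> Z) :
  morphism f -> morphism g -> morphism (g \o f).
Proof.
move=> mf mg V oV; have [oW hW] := mg V oV; have [oU hU] := mf _ oW.
by split=> // h rh; exact: (hU _ (hW _ rh)).
Qed.

Lemma isomorphic_sym X Y : isomorphic X Y -> isomorphic Y X.
Proof. by move=> [f [mf [g [mg fg gf]]]]; exists g; split=> //; exists f. Qed.

Lemma isomorphic_trans X Y Z : isomorphic X Y -> isomorphic Y Z -> isomorphic X Z.
Proof.
move=> [f [mf [g [mg fg gf]]]] [f' [mf' [g' [mg' fg' gf']]]].
exists (f' \o f); split; first exact: morphism_comp.
by exists (g \o g'); split; [exact: morphism_comp|exact: can_comp|exact: can_comp].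
Qed.

Lemma set_val_inj X (A : set X) : injective (set_val : subspace_wf A -> X).
Proof. by rewrite set_valE; exact: val_inj. Qed.

Lemma set_val_morphism X (A : set X) : @morphism K (subspace_wf A) X set_val.
Proof.
by move=> V oV; split=> [|f rf]; [exact: zopen_sub|exact: regular_sub].
Qed.

Definition corestr X Y (f : X -> Y) (B : set Y) (fB : forall x, B (f x)) :
  X -> subspace_wf B := fun x => exist _ (f x) (mem_set (fB x)).

Lemma corestrK X Y (f : X -> Y) (B : set Y) (fB : forall x, B (f x)) x :
  set_val (corestr fB x) = f x.
Proof. by rewrite set_valE. Qed.

Lemma into_subspace_morphism X Y (B : set Y) (f : X -> subspace_wf B) :
  space_axioms X -> morphism (set_val \o f : X -> Y) -> morphism f.
Proof.
move=> aX mf _ [U [oU ->]]; have [oV hV] := mf U oU.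
split=> // h rh; apply: (regular_local aX) => // x Ux.
have [U' [g [oU' U'x rg hg]]] := rh (f x) Ux.
have [oV' /(_ g rg) rV'] := mf U' oU'.
exists ((set_val \o f) @^-1` U'), (g \o (set_val \o f)); split=> // y Uy U'y.
by rewrite /= hg // inE.
Qed.

Lemma corestr_morphism X Y (f : X -> Y) (B : set Y) (fB : forall x, B (f x)) :
  space_axioms X -> morphism f -> morphism (corestr fB).
Proof.
move=> aX mf; exact: into_subspace_morphism.
Qed.

Lemma morphism_local X Y (f : X -> Y) : space_axioms X ->
  (forall x, exists U : set X, [/\ zopen U, U x &
     @morphism K (subspace_wf U) Y (f \o set_val)]) -> morphism f.
Proof.
move=> aX h V oV; have oW : zopen (f @^-1` V).
  apply: (zopen_local aX) => x Vfx; have [U [oU Ux mU]] := h x.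
  have [[W [oW eW]] _] := mU V oV; exists (U `&` W); split.
  - exact: (zopenI aX).
  - split=> //.
    by move: eW => /(congr1 (fun P : set _ => P (SigSub (mem_set Ux)))) /= <-.
  - move=> y [Uy Wy].
    by move: eW => /(congr1 (fun P : set _ => P (SigSub (mem_set Uy)))) /= ->.
split=> // g rg; apply: (regular_local aX) => // x Vfx.
have [U [oU Ux mU]] := h x; have [_ /(_ g rg) rU] := mU V oV.
pose x' : subspace_wf U := SigSub (mem_set Ux).
have [U' [k [oU' U'x rk gk]]] := rU x' Vfx.
have oUU' := zopenI aX oU oU'.
exists (U `&` U'), k; split=> //; first by apply: (regularS aX oU') => // ? [].
move=> y Vfy [Uy U'y].
by rewrite -(gk (SigSub (mem_set Uy))) // inE.
Qed.

Definition greg X (f : X -> K) := regular [set: X] f.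

Lemma morphism_greg X Y (f : X -> Y) (g : Y -> K) : 
  space_axioms Y -> morphism f -> greg g -> greg (g \o f).
Proof. by move=> aY mf; have [_ +] := mf setT (zopenT aY); apply. Qed.

Section Greg.
Variable X : space_with_functions K.
Hypothesis rX : ringed X.
Local Notation aX := (ringed_axioms rX).
Implicit Types f g : X -> K.

Lemma gregC c : greg (fun _ : X => c). Proof. exact: (ringed_cst rX _ (zopenT aX)). Qed.
Lemma gregD f g : greg f -> greg g -> greg (fun x => f x + g x).
Proof. exact: (ringedD rX (zopenT aX)). Qed.
Lemma gregM f g : greg f -> greg g -> greg (fun x => f x * g x).
Proof. exact: (ringedM rX (zopenT aX)). Qed.
Lemma greg_eq f g : greg f -> f =1 g -> greg g.
Proof. by move=> rf fg; have <- : f = g by exact/funext. Qed.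
Lemma gregN f : greg f -> greg (fun x => - f x).
Proof.
by move=> rf; apply: (greg_eq (gregM (gregC (-1)) rf)) => x; rewrite mulN1r.
Qed.
Lemma gregB f g : greg f -> greg g -> greg (fun x => f x - g x).
Proof. by move=> rf rg; exact: (gregD rf (gregN rg)). Qed.
Lemma gregXn f n : greg f -> greg (fun x => f x ^+ n).
Proof.
move=> rf; elim: n => [|n IH]; first exact: gregC.
by apply: (greg_eq (gregM rf IH)) => x; rewrite exprS.
Qed.
Lemma gregV f : greg f -> (forall x, f x != 0) -> greg (fun x => (f x)^-1).
Proof.
move=> rf f0; have [_] := ringedV rX (zopenT aX) rf.
by rewrite (_ : [set x | _] = setT) //; apply/seteqP; split.
Qed.
Lemma greg_sum I (r : seq I) (P : pred I) (F : I -> X -> K) :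
  (forall i, greg (F i)) -> greg (fun x => \sum_(i <- r | P i) F i x).
Proof.
move=> h; elim: r => [|i r IH].
  by apply: (greg_eq (gregC 0)) => x; rewrite big_nil.
case Pi: (P i); last by apply: (greg_eq IH) => x; rewrite big_cons Pi.
by apply: (greg_eq (gregD (h i) IH)) => x; rewrite big_cons Pi.
Qed.
Lemma greg_prod I (r : seq I) (P : pred I) (F : I -> X -> K) :
  (forall i, greg (F i)) -> greg (fun x => \prod_(i <- r | P i) F i x).
Proof.
move=> h; elim: r => [|i r IH].
  by apply: (greg_eq (gregC 1)) => x; rewrite big_nil.
case Pi: (P i); last by apply: (greg_eq IH) => x; rewrite big_cons Pi.
by apply: (greg_eq (gregM (h i) IH)) => x; rewrite big_cons Pi.
Qed.
Lemma greg_open f : greg f -> zopen [set x | f x != 0].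
Proof.
move=> rf; have [+ _] := ringedV rX (zopenT aX) rf.
by rewrite (_ : [set x | _ /\ _] = [set x | f x != 0]) //; apply/seteqP; split=> x /= [].
Qed.
Lemma regular_greg U f : zopen U -> greg f -> regular U f.
Proof. by move=> oU; apply: (regularS aX (zopenT aX)). Qed.

Lemma into_affine_morphism n (f : X -> affine_space K n) :
  (forall i, greg (fun x => f x 0 i)) -> morphism f.
Proof.
move=> rf.
have hp p : greg (fun x => peval p (f x)).
  elim/mpoly_ring_ind: p => [c|i|p q hp hq|p q hp hq].
  - by apply: (greg_eq (gregC c)) => x; rewrite pevalE.
  - by apply: (greg_eq (rf i)) => x; rewrite pevalE.
  - by apply: (greg_eq (gregD hp hq)) => x; rewrite pevalE.
  - by apply: (greg_eq (gregM hp hq)) => x; rewrite pevalE.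
move=> V /zopen_affineP oV.
have oW : zopen (f @^-1` V).
  apply: (zopen_local aX) => x Vfx; have [s sx hs] := oV _ Vfx.
  exists [set y | peval s (f y) != 0]; split=> //; first exact: greg_open.
  by move=> y; apply: hs.
split=> // g /regular_affineP rg; apply: (regular_local aX) => // x Vfx.
have [p [q [qx hpq]]] := rg _ Vfx.
have [oU rU] := ringedV rX (zopenT aX) (hp q).
exists [set x | [set: X] x /\ peval q (f x) != 0],
  (fun x => peval p (f x) * (peval q (f x))^-1); split=> //.
- by apply: (ringedM rX) => //; apply: regular_greg.
- by move=> y Vfy [_ qy]; rewrite /= hpq.
Qed.

End Greg.

Lemma coord_greg n (A : set (affine_space K n)) i :
  @greg (subspace_wf A) (fun v => set_val v 0 i).
Proof.
have aA := affine_axioms K n.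
have h : @greg (affine_space K n) (fun v => v 0 i).
  apply/regular_affineP => v _; exists (@mpolyX n K (mnm1 i)), 1.
  by split=> [|w _ _]; rewrite !pevalE ?oner_eq0 // divr1.
have := regular_sub (A := A) (zopenT aA) h.
by rewrite preimage_setT.
Qed.

Lemma into_zero_locus_morphism X n (B : set (affine_space K n))
    (f : X -> subspace_wf B) : ringed X ->
  (forall i, greg (fun x => set_val (f x) 0 i)) -> morphism f.
Proof.
move=> rX h; apply: into_subspace_morphism; first exact: (ringed_axioms rX).
exact: into_affine_morphism.
Qed.

Lemma greg_restrict X (A : set X) (f : X -> K) :
  ringed X -> greg f -> @greg (subspace_wf A) (f \o set_val).
Proof.
move=> rX rf; exact: (morphism_greg (ringed_axioms rX) (@set_val_morphism X A)).
Qed.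

Section LocalModel.
Variables (X Y : space_with_functions K) (V : set Y) (h : X -> subspace_wf V).
Hypotheses (aX : space_axioms X) (aY : ringed Y) (oV : zopen V).
Hypothesis isoh : isomorphism h.

Lemma local_model_embed x m (Z : set 'rV[K]_m) z :
  local_model x Z z -> local_model (set_val (h x)) Z z.
Proof.
case: isoh => mh [k [mk hk kh]] [U [O [oU oO Ux [phi [[mphi [psi [mpsi fK gK]]] hz]]]]].
pose U' : set Y := [set y | exists2 u, U u & set_val (h u) = y].
have oU' : zopen U'.
  have [[W [oW eW]] _] := mk U oU.
  have -> : U' = V `&` W; last exact: (zopenI (ringed_axioms aY)).
  apply/seteqP; split=> [_ [u Uu <-]|y [Vy Wy]].
    split; first exact: set_valP.
    have : (k @^-1` U) (h u) by rewrite /preimage /= hk.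
    by rewrite eW.
  have [Vy' ey] : exists y' : subspace_wf V, set_val y' = y.
    by exists (SigSub (mem_set Vy)); rewrite set_valE.
  exists (k Vy'); last by rewrite kh.
  have : (set_val @^-1` W) Vy' by rewrite /preimage /= ey.
  by rewrite -eW.
have UV (y : subspace_wf U') : V (set_val y).
  by have [u _ eu] := set_valP y; rewrite set_valE -eu; exact: set_valP.
have rSU' : ringed (subspace_wf U') by exact: subspace_ringed.
pose f1 : subspace_wf U' -> subspace_wf V := corestr (f := (set_val : subspace_wf U' -> Y)) UV.
have f1K y : set_val (f1 y) = set_val y by exact: corestrK.
have mf1 : morphism f1.
  apply: corestr_morphism; first exact: (ringed_axioms rSU').
  exact: set_val_morphism.
have kU y : U (k (f1 y)).
  have [u Uu eu] := set_valP y.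
  have -> : f1 y = h u by apply: set_val_inj; rewrite f1K eu set_valE.
  by rewrite hk.
pose f2 : subspace_wf U' -> subspace_wf U := corestr (f := k \o f1) kU.
have mf2 : morphism f2.
  apply: corestr_morphism; first exact: (ringed_axioms rSU').
  exact: morphism_comp.
have gU (u : subspace_wf U) : U' (set_val (h (set_val u))).
  by exists (set_val u) => //; exact: set_valP.
pose g2 : subspace_wf U -> subspace_wf U' :=
  corestr (f := (set_val : subspace_wf V -> Y) \o
    (h \o (set_val : subspace_wf U -> X))) gU.
have aZ : space_axioms (@subspace_wf K (affine_space K m) (Z `&` O)).
  exact: (ringed_axioms (subspace_ringed _ (affine_ringed K m))).
have f2g2 u : f2 (g2 u) = u.
  apply: set_val_inj; rewrite corestrK /=.
  have -> : f1 (g2 u) = h (set_val u) by apply: set_val_inj; rewrite f1K corestrK.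
  by rewrite hk.
have g2f2 y : g2 (f2 y) = y.
  by apply: set_val_inj; rewrite corestrK /= corestrK /= kh f1K.
exists U', O; split=> //; first by exists x.
exists (phi \o f2); split; last first.
  move=> y ey; apply: hz; rewrite corestrK /=.
  have -> : f1 y = h x by apply: set_val_inj; rewrite f1K.
  by rewrite hk.
split; first exact: morphism_comp.
exists (g2 \o psi); split.
- apply: into_subspace_morphism; first exact: aZ.
  have -> : set_val \o (g2 \o psi) = set_val \o h \o set_val \o psi.
    by apply/funext => u; rewrite /= corestrK.
  apply: morphism_comp => //; apply: morphism_comp; first exact: set_val_morphism.
  by apply: morphism_comp => //; exact: set_val_morphism.
- by move=> y; rewrite /= fK g2f2.
- by move=> y; rewrite /= f2g2 gK.
Qed.

Lemma smooth_at_embed d x : smooth_at d x -> smooth_at d (set_val (h x)).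
Proof.
by move=> [n [f [z [lz rk]]]]; exists n, f, z; split=> //; exact: local_model_embed.
Qed.

End LocalModel.
End Morphisms.

(** * Polynomials in two variables *)

Section Univariate.
Variable K : closedFieldType.
Implicit Types p q : {poly K}.

Lemma poly_eq0_off (l : seq K) p : (forall t, t \notin l -> p.[t] = 0) -> p = 0.
Proof.
move=> hp; apply/eqP/negPn/negP => p0.
pose q := p * \prod_(x <- l) ('X - x%:P).
have q0 : q != 0 by rewrite mulf_neq0 // monic_neq0 // monic_prod_XsubC.
have qt t : q.[t] = 0.
  rewrite hornerM; have [tl|tl] := boolP (t \in l); last by rewrite hp // mul0r.
  have /rootP -> : root (\prod_(x <- l) ('X - x%:P)) t by rewrite root_prod_XsubC.
  by rewrite mulr0.
have : size (q * 'X + 1) != 1%N.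
  by rewrite -[1]/(1%:P) size_MXaddC (negPf q0) /= eqSS size_poly_eq0.
move/closed_rootP => [t /rootP]; rewrite hornerD hornerM hornerX qt mul0r add0r.
by rewrite hornerC => /eqP; rewrite oner_eq0.
Qed.

Lemma dvdp_exp_roots p q : p != 0 -> (forall t, root p t -> root q t) ->
  p %| q ^+ (size p).-1.
Proof.
move=> p0 pq; have [r er] := closed_field_poly_normal p.
have lp : lead_coef p != 0 by rewrite lead_coef_eq0.
have -> : size p = (size r).+1.
  by rewrite er size_scale // size_prod_XsubC.
rewrite {1}er dvdpZl //= ; have : {in r, forall t, root q t}.
  by move=> t tr; apply: pq; rewrite er rootZ // root_prod_XsubC.
elim: r {er} => [|x r IH] hr; first by rewrite big_nil dvd1p.
rewrite big_cons exprS dvdp_mul //.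
  by rewrite dvdp_XsubCl hr ?mem_head.
by apply: IH => t tr; rewrite hr // in_cons tr orbT.
Qed.

(** A root of the denominator of a/p in lowest terms would be a pole, so a
    rational function without poles is a polynomial. *)
Lemma dvdp_local p a : p != 0 ->
  (forall t, exists a' p', a * p' = a' * p /\ p'.[t] != 0) -> p %| a.
Proof.
move=> p0 h; pose g := gcdp p a.
have g0 : g != 0 by rewrite gcdp_eq0 negb_and p0.
have ep : p = (p %/ g) * g by rewrite divpK // dvdp_gcdl.
have ea : a = (a %/ g) * g by rewrite divpK // dvdp_gcdr.
have cop : coprimep (p %/ g) (a %/ g) by rewrite coprimep_div_gcd // p0.
have [s1|/closed_rootP[t rt]] := boolP (size (p %/ g) == 1%N).
  rewrite ea ep dvdp_mul //; have /size_poly1P[c c0 ->] := s1.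
  by rewrite -[c%:P]mulr1 mul_polyC dvdpZl // dvd1p.
have [a' [p' [e pt]]] := h t; case/negP: pt; apply/rootP.
have : p %/ g %| p'.
  rewrite -(Gauss_dvdpr _ cop); apply/dvdpP; exists a'.
  by apply: (mulIf g0); rewrite mulrAC -ea e {1}ep mulrA.
by move/dvdpP => [k ->]; rewrite hornerM (rootP rt) mulr0.
Qed.

End Univariate.

Section Bivariate.
Variable K : closedFieldType.
Local Notation P2 := {poly {poly K}}.
Implicit Types (n a k f g : P2) (c w : {poly K}).

(** The specialisation of the inner variable; the outer one is kept. *)
Definition spec (s : K) f : {poly K} := map_poly (horner_eval s) f.

Definition ev (t s : K) f : K := (spec s f).[t].

Lemma specD s f g : spec s (f + g) = spec s f + spec s g.
Proof. exact: rmorphD. Qed.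
Lemma specM s f g : spec s (f * g) = spec s f * spec s g.
Proof. exact: rmorphM. Qed.
Lemma specC s c : spec s c%:P = c.[s]%:P.
Proof. exact: map_polyC. Qed.
Lemma specZ s c f : spec s (c *: f) = c.[s] *: spec s f.
Proof. by rewrite -[c *: f]mul_polyC specM specC mul_polyC. Qed.
Lemma specXn s f m : spec s (f ^+ m) = spec s f ^+ m.
Proof. exact: rmorphXn. Qed.

Lemma evD t s f g : ev t s (f + g) = ev t s f + ev t s g.
Proof. by rewrite /ev specD hornerD. Qed.
Lemma evN t s f : ev t s (- f) = - ev t s f.
Proof. by rewrite /ev /spec rmorphN hornerN. Qed.
Lemma evM t s f g : ev t s (f * g) = ev t s f * ev t s g.
Proof. by rewrite /ev specM hornerM. Qed.
Lemma evC t s c : ev t s c%:P = c.[s].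
Proof. by rewrite /ev specC hornerC. Qed.
Lemma evZ t s c f : ev t s (c *: f) = c.[s] * ev t s f.
Proof. by rewrite /ev specZ hornerZ. Qed.
Lemma evX t s : ev t s 'X = t.
Proof. by rewrite /ev /spec map_polyX hornerX. Qed.
Lemma ev1 t s : ev t s 1 = 1.
Proof. by rewrite -[1 in LHS]/(1%:P) evC -[1 in LHS]/(1%:P) hornerC. Qed.
Lemma ev0 t s : ev t s 0 = 0.
Proof. by rewrite /ev /spec rmorph0 horner0. Qed.
Lemma evXn t s f m : ev t s (f ^+ m) = ev t s f ^+ m.
Proof. by elim: m => [|m IH]; rewrite ?ev1 // !exprS evM IH. Qed.

Definition evE := (evD, evN, evM, evXn, evC, evX, ev1, evZ, hornerC, hornerX).

Lemma spec_neq0 s f : (lead_coef f).[s] != 0 -> spec s f != 0.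
Proof.
move=> h; apply/eqP => /(congr1 (fun p : {poly K} => p`_(size f).-1)).
by rewrite coef_map coef0 /= /horner_eval => /eqP; rewrite (negPf h).
Qed.

Lemma ev_eq0 (l : seq (K * K)) f :
  (forall t s, (t, s) \notin l -> ev t s f = 0) -> f = 0.
Proof.
move=> hf; apply/eqP/negPn/negP => f0.
have lf0 : lead_coef f != 0 by rewrite lead_coef_eq0.
case/negP: (lf0); apply/eqP; apply: (@poly_eq0_off _ (map snd l)) => s sl.
apply/eqP/negPn/negP => /spec_neq0/negP; apply; apply/eqP.
apply: (@poly_eq0_off _ [::]) => t _; apply: hf.
by apply/negP => /(map_f snd); rewrite (negPf sl).
Qed.

Lemma ev_subst m (p : mpoly m K) (h : 'I_m -> P2) :
  exists f, forall t s, ev t s f = peval p (\row_i ev t s (h i)).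
Proof.
elim/mpoly_ring_ind: p => [c|i|p q [f hf] [g hg]|p q [f hf] [g hg]].
- by exists c%:P%:P => t s; rewrite !evE pevalE.
- by exists (h i) => t s; rewrite pevalE mxE.
- by exists (f + g) => t s; rewrite evD pevalE hf hg.
- by exists (f * g) => t s; rewrite evM pevalE hf hg.
Qed.

Lemma size_spec s f : (size (spec s f) <= size f)%N.
Proof. exact: size_poly. Qed.

(** The remainder of the pseudo-division of a by n specialises, for almost all
    values of the inner variable, to a multiple of n of smaller degree, hence
    to 0. *)
Lemma generic_dvdp n a w : n != 0 -> w != 0 ->
  (forall s, w.[s] != 0 -> spec s n %| spec s a) ->
  exists c k, c != 0 /\ c *: a = k * n.
Proof.
move=> n0 w0 h; pose c := lead_coef n ^+ scalp a n.
have c0 : c != 0 by rewrite expf_neq0 // lead_coef_eq0.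
exists c, (a %/ n)%R; split=> //; have := Pdiv.Idomain.divp_eq a n.
rewrite -/c => e; rewrite e; suff -> : a %% n = 0 by rewrite addr0.
apply/eqP/negPn/negP => r0.
pose b := w * lead_coef n * lead_coef (a %% n).
have b0 : b != 0 by rewrite !mulf_neq0 ?lead_coef_eq0.
case/negP: (b0); apply/eqP; apply: (@poly_eq0_off _ [::]) => s _.
apply/eqP/negPn/negP; rewrite !hornerM !mulf_eq0 !negb_or => /andP[/andP[ws ls] rs].
have sr : spec s n %| spec s (a %% n).
  have -> : a %% n = c *: a + (- (a %/ n)) * n by rewrite e mulNr addrAC subrr add0r.
  by rewrite specD specM specZ dvdp_add ?dvdp_mull // -mul_polyC dvdp_mull ?h.
have := dvdp_leq (spec_neq0 rs) sr; rewrite leqNgt => /negP; apply.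
have <- : size n = size (spec s n).
  apply/eqP; rewrite eqn_leq size_spec andbT leqNgt; apply/negP => lt.
  by case/negP: ls; rewrite lead_coefE -[_.[s]]/(horner_eval s _) -coef_map
    nth_default // -ltnS prednK // (leq_ltn_trans _ lt).
by apply: leq_ltn_trans (size_spec _ _) _; rewrite Pdiv.Idomain.ltn_modp.
Qed.

(** Denominators in the inner variable cancel at the points where they do not
    create a pole. *)
Lemma cancel_denominator n a (T : K -> Prop) c k : c != 0 -> c *: a = k * n ->
  (forall s c k, T s -> c *: a = k * n -> c.[s] = 0 -> spec s k = 0) ->
  exists c k, [/\ c != 0, c *: a = k * n & forall s, T s -> c.[s] != 0].
Proof.
move=> + + hT; have [m] := ubnP (size c); elim: m c k => // m IH c k sc c0 e.
have [[s [Ts cs]]|no] := pselect (exists s, T s /\ c.[s] = 0); last first.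
  exists c, k; split=> // s Ts; apply/eqP => cs; apply: no; by exists s.
have [c' ec] : exists c', c = c' * ('X - s%:P) by apply/factor_theorem/rootP.
have c'0 : c' != 0 by apply: contraNneq c0 => z; rewrite ec z mul0r.
pose k' := map_poly (fun d => d %/ ('X - s%:P)) k.
have ek : k = ('X - s%:P) *: k'.
  apply/polyP => i; rewrite coefZ coef_map_id0 ?div0p // mulrC divpK //.
  rewrite dvdp_XsubCl; apply/rootP.
  have := hT s c k Ts e cs; move=> /(congr1 (fun p : {poly K} => p`_i)).
  by rewrite coef_map coef0.
apply: (IH c' k') => //.
  by move: sc; rewrite ec size_Mmonic ?monicXsubC // size_XsubC addn2 ltnS.
have x0 : ('X - s%:P)%:P != 0 :> P2 by rewrite polyC_eq0 polyXsubC_eq0.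
apply: (mulfI x0); rewrite !mul_polyC scalerA mulrC -ec e ek -!mul_polyC.
by rewrite mulrA.
Qed.

(** A rational function on the plane that is regular outside a finite set is a
    polynomial (Hartogs): a denominator depending on one variable only is
    enough, and its zero lines carry points where the function is regular. *)
Lemma plane_hartogs n a (l : seq (K * K)) : n != 0 ->
  (forall t s, (t, s) \notin l ->
     exists a' n', a * n' = a' * n /\ ev t s n' != 0) ->
  exists k, a = k * n.
Proof.
move=> n0 h; pose w := lead_coef n * \prod_(x <- l) ('X - x.2%:P).
have w0 : w != 0.
  by rewrite mulf_neq0 ?lead_coef_eq0 // monic_neq0 // monic_prod_XsubC.
have off t s : (\prod_(x <- l) ('X - x.2%:P)).[s] != 0 -> (t, s) \notin l.
  move=> ps; apply/negP => tsl; move/negP: ps; apply.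
  by rewrite horner_prod prodf_seq_eq0; apply/hasP; exists (t, s); rewrite //= hornerXsubC subrr.
have [c [k [c0 e]]] : exists c k, c != 0 /\ c *: a = k * n.
  apply: (generic_dvdp n0 w0) => s; rewrite hornerM mulf_eq0 negb_or => /andP[ls ps].
  apply: (dvdp_local (spec_neq0 ls)) => t.
  have [a' [n' [e n't]]] := h t s (off t s ps).
  by exists (spec s a'), (spec s n'); rewrite -!specM e.
have hT s c' k' : True -> c' *: a = k' * n -> c'.[s] = 0 -> spec s k' = 0.
  move=> _ {c0}e cs.
  apply: (@poly_eq0_off _ (map fst l)) => t tl.
  have tsl : (t, s) \notin l by apply/negP => /(map_f fst); rewrite (negPf tl).
  have [a' [n' [e' n't]]] := h t s tsl.
  have e2 : k' * n' = c' *: a'.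
    by apply: (mulIf n0); rewrite mulrAC -e -scalerAl e' scalerAl.
  apply/eqP; rewrite -(mulIr_eq0 _ (mulIf n't)) -[_.[t]]/(ev t s k') -evM e2.
  by rewrite evZ cs mul0r.
have [{}c [{}k [{}c0 {}e rc]]] := cancel_denominator c0 e hT.
have /size_poly1P[d d0 ed] : size c == 1%N.
  have [//|/closed_rootP[s /rootP cs]] := boolP (size c == 1%N).
  by have := rc s I; rewrite cs eqxx.
exists (d^-1%:P *: k); rewrite -scalerAl -e ed scalerA -polyCM mulVf //.
by rewrite scale1r.
Qed.

(** The curve f = 0, which does not contain the line s = 0, has points off that
    line in every neighbourhood g != 0 of one of its points on it: otherwise f
    divides a power of g up to a denominator in s, which cancels at s = 0. *)
Lemma curve_leaves_line f g t0 : ev t0 0 f = 0 -> spec 0 f != 0 ->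
  ev t0 0 g != 0 -> exists t s, [/\ s != 0, ev t s f = 0 & ev t s g != 0].
Proof.
move=> f0 sf0 g0; apply: contrapT => no.
have fn0 : f != 0 by apply: contraNneq sf0 => ->; rewrite /spec rmorph0.
have [] := @generic_dvdp f (g ^+ (size f)) ('X * lead_coef f) => //.
- by rewrite mulf_neq0 ?polyX_eq0 ?lead_coef_eq0.
- move=> s; rewrite hornerM hornerX mulf_eq0 negb_or => /andP[s0 ls].
  have sf := spec_neq0 ls; rewrite specXn.
  apply: dvdp_trans (dvdp_exp_roots (q := spec s g) sf _) _.
    move=> t /rootP ft; apply/rootP/eqP/negPn/negP => gt.
    by apply: no; exists t, s.
  by apply: dvdp_exp2l; apply: leq_trans (leq_pred _) (size_spec _ _).
move=> c [k [c0 e]].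
have hT s c' k' : s = 0 -> c' *: g ^+ size f = k' * f -> c'.[s] = 0 ->
    spec s k' = 0.
  move=> -> e' cs; have /eqP : spec 0 k' * spec 0 f = 0 by rewrite -specM -e' specZ cs scale0r.
  by rewrite mulf_eq0 (negPf sf0) orbF => /eqP.
have [{}c [{}k [{}c0 {}e rc]]] := cancel_denominator c0 e hT.
have /eqP : ev t0 0 (c *: g ^+ size f) = 0 by rewrite e evM f0 mulr0.
by rewrite evZ evXn mulf_eq0 (negPf (rc 0 erefl)) expf_eq0 (negPf g0) andbF.
Qed.

End Bivariate.

(** * Extension of places *)

Section Place.
Variables (K : closedFieldType) (P : Type) (U : set_system P).
Hypothesis ultraU : UltraFilter U.
Local Notation fct := (option P -> K).

#[local] Instance proper_of_ultra : ProperFilter U.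
Proof. exact: ultra_proper. Qed.

Lemma ultra_or (A : set P) : U A \/ U (~` A).
Proof. exact: in_ultra_setVsetC. Qed.

(** A subring of the ultraproduct of copies of K together with a K-valued
    place of it, written as one ring of functions: the value of the place is
    the value at the added point [None]. *)
Record place_ring (G : set fct) : Prop := PlaceRing {
  place_cst : forall c, G (fun=> c);
  placeD : forall f g, G f -> G g -> G (fun y => f y + g y);
  placeM : forall f g, G f -> G g -> G (fun y => f y * g y);
  place_ae : forall f g, G f -> f None = g None ->
    U [set x | f (Some x) = g (Some x)] -> G g;
  place_zero : forall f, G f -> U [set x | f (Some x) = 0] -> f None = 0 }.

Lemma place_ring_chain (F : set (set fct)) : F !=set0 ->
  (forall A, F A -> place_ring A) ->
  (forall A B, F A -> F B -> A `<=` B \/ B `<=` A) ->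
  place_ring (\bigcup_(A in F) A).
Proof.
move=> [A0 FA0] hF tF.
have two f g : (\bigcup_(A in F) A) f -> (\bigcup_(A in F) A) g ->
    exists A, [/\ F A, A f & A g].
  move=> [A FA Af] [B FB Bg].
  by have [AB|BA] := tF A B FA FB; [exists B|exists A]; split=> //; auto.
split.
- by move=> c; exists A0 => //; apply: place_cst; exact: hF.
- move=> f g hf hg; have [A [FA Af Ag]] := two f g hf hg.
  by exists A => //; apply: placeD => //; exact: hF.
- move=> f g hf hg; have [A [FA Af Ag]] := two f g hf hg.
  by exists A => //; apply: placeM => //; exact: hF.
- by move=> f g [A FA Af] e ae; exists A => //; exact: (place_ae (hF A FA) Af).
- by move=> f [A FA Af]; exact: (place_zero (hF A FA) Af).
Qed.

Lemma place_ring_max (G0 : set fct) : place_ring G0 -> exists G,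
  [/\ G0 `<=` G, place_ring G & forall G', place_ring G' -> G `<=` G' -> G' `<=` G].
Proof.
move=> hG0.
have [F FP tF|A [hA maxA]] := @Zorn_bigcup _ [set A | place_ring (G0 `|` A)].
  pose F' := [set B | B = G0 \/ exists2 A, F A & B = G0 `|` A].
  rewrite /mkset; have -> : G0 `|` \bigcup_(X in F) X = \bigcup_(X in F') X.
    apply/seteqP; split=> [f [G0f|[A FA Af]]|f [B [->|[A FA ->]]]].
    - by exists G0 => //; left.
    - by exists (G0 `|` A); [right; exists A|right].
    - by left.
    - by case=> [?|Af]; [left|right; exists A].
  apply: place_ring_chain; first by exists G0; left.
    by move=> B [->//|[A FA ->]]; exact: FP.
  move=> B C [->|[A FA ->]] [->|[A' FA' ->]].
  - by left.
  - by left=> f; left.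
  - by right=> f; left.
  - by have [h|h] := tF A A' FA FA'; [left|right] => f [?|?]; [left|right; apply: h|left|right; apply: h].
exists (G0 `|` A); split=> [f|//|G' hG' sub]; first by left.
apply: contrapT => nsub; apply: (maxA G') => //; last first.
  rewrite /mkset; suff -> : G0 `|` G' = G' by [].
  by apply/seteqP; split=> [f [G0f|//]|f]; [apply: sub; left|right].
split=> [f Af|h]; first by apply: sub; right.
by apply: nsub => f /h Af; right.
Qed.

Section Maximal.
Variable G : set fct.
Hypothesis rG : place_ring G.
Hypothesis maxG : forall G', place_ring G' -> G `<=` G' -> G' `<=` G.

Lemma place_sum n (F : 'I_n -> fct) : (forall i, G (F i)) ->
  G (fun y => \sum_i F i y).
Proof.
elim: n F => [|n IH] F hF.
  by rewrite (_ : (fun=> _) = fun=> 0); [exact: place_cst|apply/funext => y; rewrite big_ord0].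
rewrite (_ : (fun=> _) = fun y => F ord0 y + \sum_i F (lift ord0 i) y).
  by apply: placeD => //; exact: IH.
by apply/funext => y; rewrite big_ord_recl.
Qed.

Lemma place_exp f n : G f -> G (fun y => f y ^+ n).
Proof.
move=> Gf; elim: n => [|n IH]; first exact: place_cst.
by rewrite (_ : (fun=> _) = fun y => f y * f y ^+ n);
  [exact: placeM|apply/funext => y; rewrite exprS].
Qed.

Lemma placeB f g : G f -> G g -> G (fun y => f y - g y).
Proof.
move=> Gf Gg; rewrite (_ : (fun=> _) = fun y => f y + (-1) * g y).
  by apply: placeD => //; apply: placeM => //; exact: place_cst.
by apply/funext => y; rewrite mulN1r.
Qed.

(** Polynomials over the ring [G], as families of polynomials over K. *)
Definition Gpoly (p : option P -> {poly K}) :=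
  (exists N, forall y, size (p y) <= N)%N /\ forall i, G (fun y => (p y)`_i).

Lemma GpolyC f : G f -> Gpoly (fun y => (f y)%:P).
Proof.
move=> Gf; split=> [|[|i]]; first by exists 1%N => y; exact: size_polyC_leq1.
  by rewrite (_ : (fun=> _) = f) //; apply/funext => y; rewrite coefC.
by rewrite (_ : (fun=> _) = fun=> 0);
  [exact: place_cst|apply/funext => y; rewrite coefC].
Qed.

Lemma Gpoly_cst q : Gpoly (fun=> q).
Proof. by split=> [|i]; [exists (size q)|exact: place_cst]. Qed.

Lemma GpolyD p q : Gpoly p -> Gpoly q -> Gpoly (fun y => p y + q y).
Proof.
move=> [[N hN] hp] [[M hM] hq]; split=> [|i].
  exists (maxn N M) => y; apply: leq_trans (size_polyD _ _) _.
  by rewrite geq_max !leq_max hN hM orbT.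
rewrite (_ : (fun=> _) = fun y => (p y)`_i + (q y)`_i); first exact: placeD.
by apply/funext => y; rewrite coefD.
Qed.

Lemma GpolyM p q : Gpoly p -> Gpoly q -> Gpoly (fun y => p y * q y).
Proof.
move=> [[N hN] hp] [[M hM] hq]; split=> [|i].
  exists (N + M)%N => y; apply: leq_trans (size_polyMleq _ _) _.
  by apply: leq_trans (leq_pred _) _; exact: leq_add.
rewrite (_ : (fun=> _) = fun y => \sum_(j < i.+1) (p y)`_j * (q y)`_(i - j)).
  by apply: place_sum => j; exact: placeM.
by apply/funext => y; rewrite coefM.
Qed.

Definition vanishes (p : option P -> {poly K}) (h : P -> K) :=
  U [set x | (p (Some x)).[h x] = 0].

Definition at_inf (h : P -> K) c : fct := fun y => if y is Some x then h x else c.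

(** A value can be assigned to h unless an algebraic relation forbids it. *)
Lemma place_adjoin h c : G (at_inf h c) \/
  exists p, [/\ Gpoly p, vanishes p h & (p None).[c] != 0].
Proof.
have [|no] := pselect (exists p, [/\ Gpoly p, vanishes p h & (p None).[c] != 0]).
  by right.
left; pose G' := [set g | exists p, [/\ Gpoly p, g None = (p None).[c] &
  U [set x | g (Some x) = (p (Some x)).[h x]]]].
have sub : G `<=` G'.
  move=> g Gg; exists (fun y => (g y)%:P); split; first exact: GpolyC.
    by rewrite hornerC.
  by apply: filterE => x; rewrite /= hornerC.
apply: (maxG (G' := G')) => //; last first.
  exists (fun=> 'X); split; [exact: Gpoly_cst|by rewrite hornerX|].
  by apply: filterE => x; rewrite /= hornerX.
split.
- by move=> d; apply: sub; exact: place_cst.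
- move=> f g [p [Gp fp pf]] [q [Gq gq qg]]; exists (fun y => p y + q y).
  split; [exact: GpolyD|by rewrite hornerD fp gq|].
  by apply: filterS2 pf qg => x /= -> ->; rewrite hornerD.
- move=> f g [p [Gp fp pf]] [q [Gq gq qg]]; exists (fun y => p y * q y).
  split; [exact: GpolyM|by rewrite hornerM fp gq|].
  by apply: filterS2 pf qg => x /= -> ->; rewrite hornerM.
- move=> f g [p [Gp fp pf]] e ae; exists p; split=> //; first by rewrite -e.
  by apply: filterS2 pf ae => x /= -> ->.
- move=> f [p [Gp fp pf]] ae; rewrite fp; apply/eqP/negPn/negP => pc; apply: no.
  by exists p; split=> //; apply: filterS2 pf ae => x /= -> ->.
Qed.

Lemma place_inv f : G f -> f None != 0 -> G (fun y => (f y)^-1).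
Proof.
move=> Gf f0; have [] := place_adjoin (fun x => (f (Some x))^-1) (f None)^-1.
  by rewrite (_ : at_inf _ _ = fun y => (f y)^-1) //; apply/funext; case.
move=> [p [[[N hN] Gp] pz /negP p0]]; case: p0.
pose g y := \sum_(i < N) (p y)`_i * f y ^+ (N - i).
have gE y : f y != 0 -> g y = f y ^+ N * (p y).[(f y)^-1].
  move=> fy; rewrite (horner_coef_wide _ (hN y)) mulr_sumr; apply: eq_bigr => i _.
  by rewrite mulrCA exprVn -expfB_cond // (negPf fy) add0n ltnW.
have : g None = 0.
  apply: (place_zero rG).
    by apply: place_sum => i; apply: placeM => //; exact: place_exp.
  apply: filterS pz => x /= px; have [fx|fx] := eqVneq (f (Some x)) 0; last first.
    by rewrite gE // px mulr0.
  by apply: big1 => i _; rewrite fx expr0n subn_eq0 leqNgt ltn_ord mulr0.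
by rewrite gE // => /eqP; rewrite mulf_eq0 expf_eq0 (negPf f0) andbF.
Qed.

Lemma ae_neq0 f : G f -> f None != 0 -> U [set x | f (Some x) != 0].
Proof.
move=> Gf; have [h|h] := ultra_or [set x | f (Some x) = 0].
  by rewrite (place_zero rG Gf h) eqxx.
by move=> _; apply: filterS h => x /= /eqP.
Qed.

(** The values at [None] of the relations for h form an ideal of polynomials
    without common root. *)
Lemma relation_one h : (forall c, ~ G (at_inf h c)) ->
  exists p, [/\ Gpoly p, vanishes p h & p None = 1].
Proof.
move=> hno; pose I := [set q | exists p, [/\ Gpoly p, vanishes p h & p None = q]].
have ID q r : I q -> I r -> I (q + r).
  move=> [p [Gp pz <-]] [p' [Gp' pz' <-]]; exists (fun y => p y + p' y).
  split=> //; first exact: GpolyD.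
  by apply: filterS2 pz pz' => x /= e e'; rewrite hornerD e e' addr0.
have IM q r : I r -> I (q * r).
  move=> [p [Gp pz <-]]; exists (fun y => q * p y); split=> //.
    by apply: GpolyM => //; exact: Gpoly_cst.
  by apply: filterS pz => x /= e; rewrite hornerM e mulr0.
have Ic c : exists2 q, I q & q.[c] != 0.
  by have [/hno//|[p [Gp pz pc]]] := place_adjoin h c; exists (p None) => //; exists p.
suff [d] : exists d, I d%:P /\ d != 0.
  by move=> [Id d0]; have := IM d^-1%:P _ Id; rewrite -polyCM mulVf.
have [q Iq q0] := Ic 0; have {}q0 : q != 0 by apply: contraNneq q0 => ->; rewrite horner0.
have [m] := ubnP (size q); elim: m q Iq q0 => // m IH q Iq q0 sq.
have [/size_poly1P[d d0 eq]|/closed_rootP[c /rootP qc]] := boolP (size q == 1%N).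
  by exists d; rewrite -eq.
have [r Ir rc] := Ic c; apply: (IH (r %% q)).
- have -> : r %% q = r + (- (r %/ q)) * q.
    by rewrite {2}(divp_eq r q) mulNr addrAC subrr add0r.
  by apply: ID => //; exact: IM.
- apply: contraNneq rc => /modp_eq0P /dvdpP [k ->].
  by rewrite hornerM qc mulr0.
by rewrite -ltnS (leq_trans _ sq) // ltnS ltn_modp.
Qed.

(** One step of Euclidean division: a relation for k loses its top term by
    means of a relation for the inverse of k with constant term 1. *)
Lemma relation_reduce n k s u : U [set x | k x != 0] ->
  Gpoly s -> (forall y, size (s y) <= n.+1)%N -> vanishes s k ->
  Gpoly u -> (forall y, size (u y) <= n.+1)%N -> vanishes u (fun x => (k x)^-1) ->
  U [set x | (u (Some x))`_0 = 1] ->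
  let r y := \poly_(i < n) ((s y)`_i - (s y)`_n * (u y)`_(n - i)) in
  Gpoly r /\ vanishes r k.
Proof.
move=> k0 [_ Gs] ss sz [_ Gu] su uz u1 r; split.
  split=> [|i]; first by exists n => y; exact: size_poly.
  have [lin|lin] := boolP (i < n)%N.
    rewrite (_ : (fun=> _) = fun y => (s y)`_i - (s y)`_n * (u y)`_(n - i)).
      by apply: placeB => //; exact: placeM.
    by apply/funext => y; rewrite coef_poly lin.
  rewrite (_ : (fun=> _) = fun=> 0); first exact: place_cst.
  by apply/funext => y; rewrite coef_poly (negPf lin).
apply: filterS2 (filterI k0 u1) (filterI sz uz) => x /= [{}k0 {}u1] [{}sz {}uz].
rewrite (horner_coef_wide _ (ss _)) big_ord_recr /= in sz.
rewrite (horner_coef_wide _ (su _)) big_ord_recl /= u1 expr0 mulr1 in uz.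
rewrite horner_poly.
under eq_bigr => i _ do rewrite mulrBl.
rewrite sumrB; set S := (X in X - _).
have -> : S = - ((s (Some x))`_n * k x ^+ n) by apply/eqP; rewrite -addr_eq0 sz.
have e : \sum_(i < n) (u (Some x))`_(lift ord0 i) * (k x)^-1 ^+ lift ord0 i = -1.
  by apply/eqP; rewrite -addr_eq0 addrC uz.
rewrite (reindex_inj rev_ord_inj) /=.
suff -> : \sum_(i < n) (s (Some x))`_n * (u (Some x))`_(n - (n - i.+1)) *
    k x ^+ (n - i.+1) = - ((s (Some x))`_n * k x ^+ n) by rewrite subrr.
rewrite -mulrN1 -e mulr_sumr; apply: eq_bigr => i _.
rewrite subKn ?ltn_ord // !lift0 -!mulrA; congr (_ * _).
rewrite [RHS]mulrCA exprVn; congr (_ * _).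
by rewrite -expfB_cond // (negPf k0) /= ltn_ord.
Qed.

Lemma relation_normalize q h : Gpoly q -> vanishes q h -> (q None)`_0 = 1 ->
  exists u, [/\ Gpoly u, vanishes u h, U [set x | (u (Some x))`_0 = 1],
    u None = q None & forall y, (size (u y) <= size (q y))%N].
Proof.
move=> Gq qz q0; have Gi : G (fun y => ((q y)`_0)^-1).
  by apply: place_inv; [case: Gq|rewrite q0 oner_eq0].
have nz : U [set x | (q (Some x))`_0 != 0].
  by apply: (ae_neq0 (f := fun y => (q y)`_0)); [case: Gq|rewrite q0 oner_eq0].
exists (fun y => ((q y)`_0)^-1%:P * q y); split.
- by apply: GpolyM => //; exact: GpolyC Gi.
- by apply: filterS qz => x /= e; rewrite hornerM e mulr0.
- by apply: filterS nz => x /= e; rewrite coefCM mulVf.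
- by rewrite q0 invr1 mul1r.
- by move=> y; rewrite mul_polyC; exact: size_scale_leq.
Qed.

(** Chevalley: relations of least degree for h and for its inverse would
    shorten one another. *)
Lemma place_total h :
  (exists c, G (at_inf h c)) \/ G (at_inf (fun x => (h x)^-1) 0).
Proof.
have [|/forallNP hno] := pselect (exists c, G (at_inf h c)); first by left.
right; have [//|[q0 [Gq0 q0z q00]]] := place_adjoin (fun x => (h x)^-1) 0.
have h0 : U [set x | h x != 0].
  have [z|z] := ultra_or [set x | h x = 0]; last by apply: filterS z => x /= /eqP.
  case: (hno 0); apply: (place_ae rG (place_cst rG 0)) => //.
  by apply: filterS z => x /= ->.
pose A n := exists p, [/\ Gpoly p, vanishes p h, p None = 1 &
  forall y, (size (p y) <= n.+1)%N].
pose B m := exists q, [/\ Gpoly q, vanishes q (fun x => (h x)^-1), (q None)`_0 = 1 &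
  forall y, (size (q y) <= m.+1)%N].
have exA : exists n, `[< A n >].
  have [p [Gp pz p1]] := relation_one hno; have [N hN] := Gp.1.
  by exists N; apply/asboolP; exists p; split=> // y; rewrite (leq_trans (hN y)).
have exB : exists m, `[< B m >].
  have [N hN] := Gq0.1; exists N; apply/asboolP.
  rewrite horner_coef0 in q00.
  exists (fun y => ((q0 None)`_0)^-1%:P * q0 y); split.
  - by apply: GpolyM => //; exact: Gpoly_cst.
  - by apply: filterS q0z => x /= e; rewrite hornerM e mulr0.
  - by rewrite coefCM mulVf.
  - move=> y; rewrite mul_polyC; apply: leq_trans (size_scale_leq _ _) _.
    exact: leq_trans (hN y) _.
case: (ex_minnP exA) => n /asboolP[p [Gp pz p1 sp]] minn.
case: (ex_minnP exB) => m /asboolP[q [Gq qz q1 sq]] minm.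
have const (r : option P -> {poly K}) k : Gpoly r -> vanishes r k ->
    (r None)`_0 = 1 -> ~ (forall y, size (r y) <= 1)%N.
  move=> [_ Gr] rz r1 sr; have /eqP := oner_eq0 K; rewrite -r1; apply.
  apply: (place_zero rG (Gr 0%N)); apply: filterS rz => x /=.
  by rewrite (horner_coef_wide _ (sr _)) big_ord1 expr0 mulr1.
have p10 : (p None)`_0 = 1 by rewrite p1 coefC.
case: n => [|n] in sp minn *; first by case: (const p h).
case: m => [|m] in sq minm *; first by case: (const q (fun x => (h x)^-1)).
have [mn|nm] := leqP m n.
  have [u [Gu uz u1 uq su]] := relation_normalize Gq qz q1.
  have [|Gr rz] := relation_reduce h0 Gp sp pz Gu _ uz u1.
    by move=> y; apply: leq_trans (su y) (leq_trans (sq y) _).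
  suff /minn : `[< A n >] by rewrite ltnn.
  apply/asboolP; exists (fun y => \poly_(i < n.+1)
    ((p y)`_i - (p y)`_n.+1 * (u y)`_(n.+1 - i))); split=> //.
    apply/polyP => i; rewrite coef_poly p1 !coefC /= mul0r subr0.
    by case: i => //= i; case: ltnP.
have [u [Gu uz u1 up su]] := relation_normalize Gp pz p10.
have hi0 : U [set x | (h x)^-1 != 0].
  by apply: filterS h0 => x /=; rewrite invr_eq0.
have uz' : vanishes u (fun x => ((h x)^-1)^-1).
  by apply: filterS uz => x /=; rewrite invrK.
have [|Gr rz] := relation_reduce hi0 Gq sq qz Gu _ uz' u1.
  by move=> y; apply: leq_trans (su y) (leq_trans (sp y) _); rewrite ltnS ltnW.
suff /minm : `[< B m >] by rewrite ltnn.
apply/asboolP; exists (fun y => \poly_(i < m.+1)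
  ((q y)`_i - (q y)`_m.+1 * (u y)`_(m.+1 - i))); split=> //.
by rewrite coef_poly up p1 coefC /= mulr0 subr0.
Qed.

End Maximal.

(** A K-valued place of a subring extends to the whole ultraproduct, with
    values in K and infinity, because K is algebraically closed. *)
Lemma place_exists (G0 : set fct) : place_ring G0 -> exists G,
  [/\ G0 `<=` G, place_ring G,
    forall f, G f -> f None != 0 -> G (fun y => (f y)^-1)
  & forall h, (exists c, G (at_inf h c)) \/ G (at_inf (fun x => (h x)^-1) 0)].
Proof.
move=> /place_ring_max[G [G0G rG mG]]; exists G; split=> //.
- exact: place_inv.
- exact: place_total.
Qed.

End Place.

(** * Quotients and the projective cubic surface *)

Section QuotientPoints.
Variables (K : fieldType) (X : space_with_functions K) (E : X -> X -> Prop).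
Hypotheses (Er : forall x, E x x) (Es : forall x y, E x y -> E y x)
  (Et : forall x y z, E x y -> E y z -> E x z).
Local Notation pr := (quotient_proj E).

Definition class_repr (c : quotient_class E) : X := projT1 (cid (proj2_sig c)).

Lemma class_reprK c : pr (class_repr c) = c.
Proof.
rewrite /class_repr; case: cid => x /= ex; case: c ex => C hC /= ex.
by apply: eq_exist; rewrite /= ex.
Qed.

Lemma quotient_projP x y : pr x = pr y <-> E x y.
Proof.
split=> [/(congr1 sval) /= e|xy]; first by rewrite e.
apply: eq_exist => /=; apply/funext => z; apply/propext.
by split=> h; [apply: Et h; exact: Es|exact: Et h].
Qed.

Lemma class_repr_proj x : E x (class_repr (pr x)).
Proof. by apply/quotient_projP; rewrite class_reprK. Qed.

End QuotientPoints.

Section CubicSurface.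
Variable K : closedFieldType.

Definition I0 : 'I_4 := Ordinal (isT : 0 < 4)%N.
Definition I1 : 'I_4 := Ordinal (isT : 1 < 4)%N.
Definition I2 : 'I_4 := Ordinal (isT : 2 < 4)%N.
Definition I3 : 'I_4 := Ordinal (isT : 3 < 4)%N.

Lemma ord4P (P : 'I_4 -> Prop) : P I0 -> P I1 -> P I2 -> P I3 -> forall i, P i.
Proof.
move=> h0 h1 h2 h3 [[|[|[|[|//]]]] hi].
- by rewrite (_ : Ordinal hi = I0) //; apply: val_inj.
- by rewrite (_ : Ordinal hi = I1) //; apply: val_inj.
- by rewrite (_ : Ordinal hi = I2) //; apply: val_inj.
- by rewrite (_ : Ordinal hi = I3) //; apply: val_inj.
Qed.

Definition vec4 (x y z w : K) : 'rV[K]_4 := \row_i nth 0 [:: x; y; z; w] i.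

Lemma vec4E x y z w : ((vec4 x y z w 0 I0 = x) * (vec4 x y z w 0 I1 = y) *
  (vec4 x y z w 0 I2 = z) * (vec4 x y z w 0 I3 = w))%type.
Proof. by rewrite !mxE. Qed.

Lemma vec4_eta (v : 'rV[K]_4) : v = vec4 (v 0 I0) (v 0 I1) (v 0 I2) (v 0 I3).
Proof. by apply/rowP; apply: ord4P; rewrite vec4E. Qed.

Lemma vec4Z k x y z w : k *: vec4 x y z w = vec4 (k * x) (k * y) (k * z) (k * w).
Proof. by apply/rowP; apply: ord4P; rewrite mxE !vec4E. Qed.

(** The coefficients of z^2 - (x y + p1 x + p2 y + p3) z + c x^3 + a y^3 +
    q1 x^2 + q2 x y + q3 y^2 + q4 x + q5 y + q6. *)
Record cubic := Cubic {
  cp1 : K; cp2 : K; cp3 : K; cc : K; ca : K;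
  cq1 : K; cq2 : K; cq3 : K; cq4 : K; cq5 : K; cq6 : K }.

Variable C : cubic.

Definition Plin (x y : K) := x * y + (cp1 C * x + cp2 C * y + cp3 C).
Definition Qcub (x y : K) := cc C * x ^+ 3 + ca C * y ^+ 3 +
  (cq1 C * x ^+ 2 + cq2 C * (x * y) + cq3 C * y ^+ 2) +
  (cq4 C * x + cq5 C * y) + cq6 C.

Local Notation X_ i := (@mpolyX 4 K (mnm1 i)).
Local Notation cst c := (mpolyC 4 c).

Definition cubic_poly : mpoly 4 K :=
  X_ I2 ^+ 2 * X_ I3
  - X_ I2 * (X_ I0 * X_ I1
      + X_ I3 * (cst (cp1 C) * X_ I0 + cst (cp2 C) * X_ I1 + cst (cp3 C) * X_ I3))
  + (cst (cc C) * X_ I0 ^+ 3 + cst (ca C) * X_ I1 ^+ 3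
     + X_ I3 * (cst (cq1 C) * X_ I0 ^+ 2 + cst (cq2 C) * (X_ I0 * X_ I1)
                + cst (cq3 C) * X_ I1 ^+ 2)
     + X_ I3 ^+ 2 * (cst (cq4 C) * X_ I0 + cst (cq5 C) * X_ I1)
     + X_ I3 ^+ 3 * cst (cq6 C)).

Definition cubic_form (x y z w : K) : K :=
  z ^+ 2 * w - z * (x * y + w * (cp1 C * x + cp2 C * y + cp3 C * w))
  + (cc C * x ^+ 3 + ca C * y ^+ 3
     + w * (cq1 C * x ^+ 2 + cq2 C * (x * y) + cq3 C * y ^+ 2)
     + w ^+ 2 * (cq4 C * x + cq5 C * y) + w ^+ 3 * cq6 C).

Lemma peval_cubic (v : 'rV[K]_4) :
  peval cubic_poly v = cubic_form (v 0 I0) (v 0 I1) (v 0 I2) (v 0 I3).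
Proof. by rewrite /cubic_poly /cubic_form !pevalE. Qed.

Lemma peval_cubicZ k (v : 'rV[K]_4) :
  peval cubic_poly (k *: v) = k ^+ 3 * peval cubic_poly v.
Proof. rewrite !peval_cubic !mxE /cubic_form; ring. Qed.

Definition cone : set (affine_space K 4) :=
  [set v | v != 0 /\ peval cubic_poly v = 0].
Definition cone_space := @subspace_wf K (affine_space K 4) cone.
Definition proportional (u v : cone_space) :=
  exists2 k : K, k != 0 & set_val v = k *: set_val u :> 'rV[K]_4.

(** The closure in projective space of the affine cubic, as the quotient of its
    punctured cone. *)
Definition proj_cubic := quotient_wf proportional.
Local Notation X := proj_cubic.
Local Notation pr := (quotient_proj proportional).

Lemma cone_ringed : ringed cone_space.
Proof. exact: subspace_ringed (affine_ringed K 4). Qed.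

Lemma proj_cubic_ringed : ringed X.
Proof. exact: quotient_ringed cone_ringed. Qed.
Local Notation aX := (ringed_axioms proj_cubic_ringed).

Lemma proportional_refl u : proportional u u.
Proof. by exists 1; rewrite ?oner_eq0 // scale1r. Qed.
Lemma proportional_sym u v : proportional u v -> proportional v u.
Proof.
by move=> [k k0 e]; exists k^-1; rewrite ?invr_eq0 // e scalerA mulVf // scale1r.
Qed.
Lemma proportional_trans u v w :
  proportional u v -> proportional v w -> proportional u w.
Proof.
move=> [k k0 e] [l l0 e']; exists (l * k); first by rewrite mulf_neq0.
by rewrite e' e scalerA.
Qed.

(** Homogeneous coordinates, for some normalisation. *)
Definition hc (x : X) : 'rV[K]_4 := set_val (class_repr x).

Lemma hc_cone x : cone (hc x).
Proof. exact: set_valP. Qed.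

Lemma hc_neq0 x : hc x != 0. Proof. by case: (hc_cone x). Qed.

Definition pt (v : 'rV[K]_4) (hv : cone v) : X := pr (SigSub (mem_set hv)).

Lemma hc_pr u : exists2 k : K, k != 0 & hc (pr u) = k *: set_val u.
Proof.
exact: (class_repr_proj proportional_refl proportional_sym proportional_trans u).
Qed.

Lemma hc_pt v (hv : cone v) : exists2 k : K, k != 0 & hc (pt hv) = k *: v.
Proof. exact: hc_pr. Qed.

Lemma pt_eq x v (hv : cone v) k : hc x = k *: v -> pt hv = x.
Proof.
move=> e; have k0 : k != 0.
  by apply/eqP => k0; have := hc_neq0 x; rewrite e k0 scale0r eqxx.
rewrite -[RHS]class_reprK.
apply/(quotient_projP proportional_refl proportional_sym proportional_trans).
by exists k => //; rewrite -/(hc x) e.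
Qed.

Lemma pt_hc x (hx : cone (hc x)) : pt hx = x.
Proof. by apply: (@pt_eq _ _ _ 1); rewrite scale1r. Qed.

Definition ratio j i (x : X) : K := hc x 0 j / hc x 0 i.
Definition chart i : set X := [set x | hc x 0 i != 0].

Lemma hc_pr_eq0 u i : (hc (pr u) 0 i == 0) = (set_val u 0 i == 0).
Proof.
by have [k k0 ->] := hc_pr u; rewrite mxE mulf_eq0 (negPf k0).
Qed.

Lemma ratio_pr u j i : ratio j i (pr u) = set_val u 0 j / set_val u 0 i.
Proof.
have [k k0 e] := hc_pr u.
by rewrite /ratio e !mxE -mulf_div divff // mul1r.
Qed.

Lemma preimage_chart i : pr @^-1` chart i = [set u : cone_space | set_val u 0 i != 0].
Proof. by apply/seteqP; split=> u; rewrite /preimage /chart /= hc_pr_eq0. Qed.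

Lemma chart_open i : zopen (chart i).
Proof.
by rewrite /= preimage_chart; apply: (greg_open cone_ringed); exact: coord_greg.
Qed.

Lemma ratio_regular j i : regular (chart i) (ratio j i).
Proof.
have e : ratio j i \o pr = fun u : cone_space => set_val u 0 j * (set_val u 0 i)^-1.
  by apply/funext => u; exact: ratio_pr.
change (@regular K cone_space (pr @^-1` chart i) (ratio j i \o pr)).
rewrite e preimage_chart.
have rj := @coord_greg K 4 cone j; have ri := @coord_greg K 4 cone i.
have rX := cone_ringed.
have oU := greg_open rX ri.
have rV : @regular K cone_space [set u : cone_space | set_val u 0 i != 0]
    (fun u => (set_val u 0 i)^-1).
  have [_] := ringedV rX (zopenT (ringed_axioms rX)) ri.
  by rewrite (_ : [set x | _ /\ _] = [set u : cone_space | set_val u 0 i != 0]) //;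
    apply/seteqP; split=> u /= [].
exact: (ringedM rX oU (regular_greg rX oU rj) rV).
Qed.

Lemma ratio_greg j i (A : set X) : A `<=` chart i ->
  @greg K (subspace_wf A) (ratio j i \o set_val).
Proof.
move=> Ai; have := regular_sub (A := A) (chart_open i) (@ratio_regular j i).
by rewrite (_ : _ @^-1` _ = setT) //; apply/seteqP; split=> // a _; apply: Ai; exact: set_valP.
Qed.

Lemma pt_morphism (Y : space_with_functions K) (f : Y -> 'rV[K]_4)
    (fc : forall y, cone (f y)) : ringed Y ->
  (forall i, greg (fun y => f y 0 i)) -> @morphism K Y X (fun y => pt (fc y)).
Proof.
move=> rY rf.
have m1 : @morphism K Y cone_space (fun y => SigSub (mem_set (fc y))).
  exact: into_zero_locus_morphism.
exact: (morphism_comp m1 (@quotient_proj_morphism K cone_space proportional)).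
Qed.

Definition affine_chart i : set (affine_space K 4) :=
  [set v : 'rV[K]_4 | v 0 i = 1 /\ peval cubic_poly v = 0].

Lemma affine_chart_cone i v : affine_chart i v -> cone v.
Proof.
move=> [vi fv]; split=> //; apply/eqP => v0; have := oner_eq0 K.
by rewrite -vi v0 mxE eqxx.
Qed.

Definition to_affine i x : 'rV[K]_4 := (hc x 0 i)^-1 *: hc x.

Lemma to_affine_chart i (x : subspace_wf (chart i)) :
  affine_chart i (to_affine i (set_val x)).
Proof.
have xi : chart i (set_val x) by exact: set_valP.
split; first by rewrite mxE mulVf.
by rewrite peval_cubicZ (hc_cone _).2 mulr0.
Qed.

Definition chart_map i : subspace_wf (chart i) ->
    @subspace_wf K (affine_space K 4) (affine_chart i) :=
  fun x => SigSub (mem_set (to_affine_chart x)).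

Lemma chart_mapE i (x : subspace_wf (chart i)) : set_val (chart_map x) = to_affine i (set_val x).
Proof. by rewrite set_valE. Qed.

Lemma chart_pt i v (hv : cone v) : v 0 i != 0 -> chart i (pt hv).
Proof. by move=> vi; have [k k0] := hc_pt hv; rewrite /chart /= => ->; rewrite mxE mulf_neq0. Qed.

Lemma to_affine_pt i v (hv : cone v) : to_affine i (pt hv) = (v 0 i)^-1 *: v.
Proof.
have [k k0 e] := hc_pt hv; rewrite /to_affine e mxE scalerA invfM mulrC mulrA.
by rewrite mulfV // mul1r.
Qed.

Lemma chart_iso i : isomorphism (@chart_map i).
Proof.
have rA : ringed (@subspace_wf K (affine_space K 4) (affine_chart i)).
  exact: subspace_ringed (affine_ringed K 4).
split.
  apply: into_zero_locus_morphism => [|j].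
    exact: subspace_ringed proj_cubic_ringed.
  apply: (greg_eq (@ratio_greg j i _ (@subset_refl _ (chart i)))) => x.
  by rewrite chart_mapE mxE mulrC.
have hv (v : @subspace_wf K (affine_space K 4) (affine_chart i)) : cone (set_val v).
  by apply: affine_chart_cone; exact: set_valP.
have ci v : chart i (pt (hv v)).
  by apply: chart_pt; have [-> _] := set_valP v; exact: oner_neq0.
exists (corestr ci); split.
- apply: corestr_morphism; first exact: (ringed_axioms rA).
  by apply: pt_morphism => [//|j]; exact: (@coord_greg K 4 (affine_chart i) j).
- move=> x; apply: set_val_inj; rewrite corestrK.
  apply: (@pt_eq _ _ _ (hc (set_val x) 0 i)).
  by rewrite chart_mapE scalerA mulfV ?scale1r //; exact: (set_valP (A := chart i) x).
- move=> v; apply: set_val_inj; rewrite chart_mapE corestrK to_affine_pt.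
  have [vi _] : affine_chart i (set_val v) by exact: set_valP.
  by rewrite vi invr1 scale1r.
Qed.

Lemma charts_cover x : exists i, chart i x.
Proof.
apply: contrapT => /forallNP no; have := hc_neq0 x; apply/negP; rewrite negbK.
by apply/eqP/rowP => i; rewrite mxE; apply/eqP/negPn/negP; exact: no.
Qed.

Lemma proj_cubic_prevariety : prevariety X.
Proof.
split; first exact: aX.
exists 4, chart; split.
- exact: chart_open.
- move=> i; exists 4, [set p | p = @mpolyX 4 K (mnm1 i) - 1 \/ p = cubic_poly].
  rewrite (_ : zero_set _ = affine_chart i); last first.
    apply/seteqP; split=> v h.
      split; last by apply: h; right.
      have := h _ (or_introl erefl); rewrite pevalB !pevalE.
      by move/eqP; rewrite subr_eq0 => /eqP.
    move=> p [->|->]; last by case: h.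
    by rewrite pevalB !pevalE h.1 subrr.
  by exists (@chart_map i); exact: chart_iso.
- by apply/seteqP; split=> // x _; have [i xi] := charts_cover x; exists i.
Qed.

Lemma proj_cubic_separated : @prod_zclosed K X X [set z | z.1 = z.2].
Proof.
move=> [x y] xy; have [i xi] := charts_cover x; have [j yj] := charts_cover y.
have [k [l kl]] : exists k l, ratio k i x * ratio l j y - ratio l i x * ratio k j y != 0.
  apply: contrapT => no; apply: xy.
  have e k l : ratio k i x * ratio l j y = ratio l i x * ratio k j y.
    by apply/eqP; rewrite -subr_eq0; apply/negPn/negP => h; apply: no; exists k, l.
  rewrite -(pt_hc (hc_cone y)); apply/esym.
  apply: (@pt_eq _ _ _ (hc x 0 i * ratio j i x / hc y 0 j)).
  apply/rowP => k; rewrite mxE.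
  have -> : hc x 0 k = hc x 0 i * ratio k i x by rewrite /ratio mulrC divfK.
  rewrite -!mulrA; congr (_ * _).
  have := e k j; rewrite [ratio j j y]divff // mulr1 => ->.
  by rewrite /ratio (mulrC (hc y 0 k)) -!mulrA.
exists (chart i), (chart j), 2.
exists (fun m => if m == 0 then ratio k i else fun x => - ratio l i x).
exists (fun m => if m == 0 then ratio l j else ratio k j).
have o u := chart_open u.
split=> //.
- move=> m; split; last by case: ifP => _; exact: ratio_regular.
  case: ifP => _; first exact: ratio_regular.
  exact: (regular_eq aX (o i) (ringedM proj_cubic_ringed (o i)
    (ringed_cst proj_cubic_ringed (-1) (o i)) (@ratio_regular l i))
    (fun u _ => mulN1r _)).
- by rewrite !big_ord_recl big_ord0 /= addr0 mulNr.
- move=> x' y' _ _; rewrite !big_ord_recl big_ord0 /= addr0 mulNr => h e.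
  move/negP: h; apply; rewrite subr_eq0; rewrite /= in e; rewrite e /ratio.
  by rewrite !mulf_div (mulrC (hc y' 0 k)).
Qed.

Lemma proj_cubic_variety : variety X.
Proof. by split; [exact: proj_cubic_prevariety|exact: proj_cubic_separated]. Qed.

End CubicSurface.

(** * Completeness *)

Section AffineCoordinates.
Variable K : fieldType.

(** The coordinates of an affine neighbourhood of y0, extended by zero to Y, so
    that statements about the points near y0 need no subspace. *)
Lemma affine_coordinates (Y : space_with_functions K) (y0 : Y) : prevariety Y ->
  exists n (c : Y -> 'rV[K]_n),
    (forall p, peval p (c y0) != 0 -> exists V : set Y,
       [/\ zopen V, V y0 & forall y, V y -> peval p (c y) != 0])
 /\ (forall (V : set Y) g, zopen V -> V y0 -> regular V g ->
       exists p q (W : set Y), [/\ peval q (c y0) != 0, zopen W, W y0 &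
         forall y, W y -> peval q (c y) != 0 /\ g y = peval p (c y) / peval q (c y)]).
Proof.
move=> [aY [N [U [oU hU cov]]]].
have [k _ Uy0] : (\bigcup_i U i) y0 by rewrite cov.
have [n [S [phi [mphi [psi [mpsi pK pK']]]]]] := hU k.
pose c y := match pselect (U k y) with
  | left h => set_val (phi (SigSub (mem_set h)))
  | right _ => 0 end.
have cE (y : subspace_wf (U k)) : c (set_val y) = set_val (phi y).
  rewrite /c; case: pselect => [h|[]]; last exact: set_valP.
  by congr (set_val (phi _)); exact: val_inj.
have pull (O : set (affine_space K n)) : zopen O -> exists W : set Y,
    [/\ zopen W, W `<=` U k & forall y, U k y -> (W y <-> O (c y))].
  move=> oO; have [+ _] := mphi (set_val @^-1` O) (zopen_sub _ oO).
  move=> [W [oW eW]]; exists (W `&` U k); split.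
  - exact: (zopenI aY).
  - by move=> y [].
  - move=> y Uy; pose y' : subspace_wf (U k) := SigSub (mem_set Uy).
    have ey : set_val y' = y by rewrite set_valE.
    have := congr1 (fun P : set _ => P y') eW; rewrite /preimage /= ey.
    by rewrite -cE ey => ->; split=> [[]|].
exists n, c; split=> [p py|V g oV Vy0 rg].
  have [W [oW WU hW]] := pull _ (zopen_nonzero p).
  exists W; split=> //; first by apply/hW.
  by move=> y Wy; have := (hW y (WU y Wy)).1 Wy.
have := mpsi _ (zopen_sub _ oV).
move=> [oV' /(_ _ (regular_sub oV rg)) rg'].
pose y0' : subspace_wf (U k) := SigSub (mem_set Uy0).
have ey0 : set_val y0' = y0 by rewrite set_valE.
have Vy0' : (psi @^-1` (set_val @^-1` V)) (phi y0').
  by rewrite /preimage /= pK ey0.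
have [O [g' [oO Oy0 /regular_affineP rg2 gg']]] := rg' _ Vy0'.
have [p [q [qy0 hpq]]] := rg2 _ Oy0.
have oOq := zopenI (affine_axioms K n) oO (zopen_nonzero q).
have [W [oW WU hW]] := pull _ oOq.
exists p, q, (V `&` W); split.
- by rewrite -ey0 cE.
- exact: (zopenI aY).
- by split=> //; apply/hW => //; rewrite -ey0 cE.
move=> y [Vy Wy]; have Uy := WU y Wy; have [Oy qy] := (hW y Uy).1 Wy.
split=> //; pose y' : subspace_wf (U k) := SigSub (mem_set Uy).
have ey : set_val y' = y by rewrite set_valE.
rewrite -hpq // -ey cE -gg' /= ?pK // inE; split; last by rewrite /preimage /= -cE ey.
by rewrite /preimage /= pK ey.
Qed.

End AffineCoordinates.

Section PlaceMax.
Variables (K : closedFieldType) (P : Type) (U : set_system P) (G : set (option P -> K)).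
Hypotheses (ultraU : UltraFilter U) (rG : place_ring U G).
Hypothesis totG : forall h,
  (exists c, G (at_inf h c)) \/ G (at_inf (fun x => (h x)^-1) 0).

Local Lemma filter_of_ultra : Filter U.
Proof. exact: (@ultra_proper _ _ ultraU). Qed.
#[local] Existing Instance filter_of_ultra.

Lemma place_div_max n (H : 'I_n -> P -> K) (j0 : 'I_n) : U [set x | H j0 x != 0] ->
  exists j, U [set x | H j x != 0] /\
    forall i, exists c, G (at_inf (fun x => H i x / H j x) c).
Proof.
move=> Uj0.
suff [j [Uj hj]] : exists j, U [set x | H j x != 0] /\
    forall i, i \in j0 :: enum 'I_n -> exists c, G (at_inf (fun x => H i x / H j x) c).
  by exists j; split=> // i; apply: hj; rewrite in_cons mem_enum orbT.
have self j : U [set x | H j x != 0] -> G (at_inf (fun x => H j x / H j x) 1).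
  move=> Uj; apply: (place_ae rG (place_cst rG 1)) => //.
  by apply: filterS Uj => x /= h; rewrite divff.
elim: (enum _) => [|i s [j [Uj hj]]].
  by exists j0; split=> // i; rewrite inE => /eqP ->; exists 1; exact: self.
have [[c Gc]|Gi] := totG (fun x => H i x / H j x).
  exists j; split=> // k; rewrite !inE => /or3P[kj|/eqP ->|ks].
  - by apply: hj; rewrite in_cons kj.
  - by exists c.
  - by apply: hj; rewrite in_cons ks orbT.
have [Ui|Ui] := ultra_or ultraU [set x | H i x = 0].
  exists j; split=> // k; rewrite !inE => /or3P[kj|/eqP ->|ks].
  - by apply: hj; rewrite in_cons kj.
  - exists 0; apply: (place_ae rG (place_cst rG 0)) => //.
    by apply: filterS Ui => x /= ->; rewrite mul0r.
  - by apply: hj; rewrite in_cons ks orbT.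
have {}Ui : U [set x | H i x != 0] by apply: filterS Ui => x /= /eqP.
have step k : (exists c, G (at_inf (fun x => H k x / H j x) c)) ->
    exists c, G (at_inf (fun x => H k x / H i x) c).
  move=> [c Gc]; exists (c * 0).
  apply: (place_ae rG (placeM rG Gc Gi)) => //.
  by apply: filterS2 Uj Ui => x /= hj0 hi0; rewrite invf_div mulrA divfK.
exists i; split=> // k; rewrite !inE => /or3P[kj|/eqP ->|ks].
- by apply: step; apply: hj; rewrite in_cons kj.
- by exists 1; exact: self.
- by apply: step; apply: hj; rewrite in_cons ks orbT.
Qed.

Lemma place_peval n (h : 'I_n -> option P -> K) p : (forall i, G (h i)) ->
  G (fun y => peval p (\row_i h i y)).
Proof.
move=> Gh; elim/mpoly_ring_ind: p => [c|i|p q Gp Gq|p q Gp Gq].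
- rewrite (_ : (fun=> _) = fun=> c); first exact: (place_cst rG).
  by apply/funext => y; rewrite pevalE.
- by rewrite (_ : (fun=> _) = h i) //; apply/funext => y; rewrite pevalE mxE.
- rewrite (_ : (fun=> _) = fun y => peval p (\row_i h i y) + peval q (\row_i h i y)).
    exact: (placeD rG).
  by apply/funext => y; rewrite pevalE.
- rewrite (_ : (fun=> _) = fun y => peval p (\row_i h i y) * peval q (\row_i h i y)).
    exact: (placeM rG).
  by apply/funext => y; rewrite pevalE.
Qed.

End PlaceMax.

Section Completeness.
Variables (K : closedFieldType) (C : cubic K).
Local Notation X := (proj_cubic C).

(** Valuative criterion: if y0 is in the closure of the image of Z, then an
    ultrafilter on Z converges to y0, and a place of the corresponding
    ultraproduct that extends evaluation at y0 provides, after division of the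
    homogeneous coordinates by one of largest valuation, a point of Z over y0. *)
Lemma proj_cubic_complete : complete X.
Proof.
move=> Y [pY _] Z cZ; have aY := pY.1; apply: (zopen_local aY) => y0 nZy0.
apply: contrapT => noV.
have meet (V : set Y) : zopen V -> V y0 -> exists2 z, Z z & V z.2.
  move=> oV Vy0; apply: contrapT => no; apply: noV; exists V; split=> // y Vy [z Zz ezy].
  by apply: no; exists z; rewrite // ezy.
pose F : set_system (X * Y) := [set A | exists V : set Y,
  [/\ zopen V, V y0 & forall z, Z z -> V z.2 -> A z]].
have FF : ProperFilter F.
  apply: Build_ProperFilter_ex => [A [V [oV Vy0 hA]]|].
    by have [z Zz Vz] := meet V oV Vy0; exists z; exact: hA.
  split.
  - by exists setT; split=> //; exact: zopenT.
  - move=> A B [V [oV Vy hA]] [W [oW Wy hB]]; exists (V `&` W).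
    split=> //; first exact: (zopenI aY).
    by move=> z Zz [Vz Wz]; split; [exact: hA|exact: hB].
  - move=> A B AB [V [oV Vy hA]]; exists V; split=> // z Zz Vz; apply: AB; exact: hA.
have [U [ultraU FU]] := ultraFilterLemma FF.
have FFU : ProperFilter U by exact: ultra_proper.
have nearY (V : set Y) : zopen V -> V y0 -> U [set z | V z.2].
  by move=> oV Vy0; apply: FU; exists V.
have nearZ : U Z by apply: FU; exists setT; split=> //; exact: zopenT.
have [n [c [copen creg]]] := affine_coordinates y0 pY.
have cnear q : peval q (c y0) != 0 -> U [set z | peval q (c z.2) != 0].
  move=> /copen[V [oV Vy hV]]; apply: filterS (nearY V oV Vy) => z /=; exact: hV.
pose G0 : set (option (X * Y) -> K) := [set f | exists p q, [/\ peval q (c y0) != 0,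
  f None = peval p (c y0) / peval q (c y0) &
  U [set z | f (Some z) = peval p (c z.2) / peval q (c z.2)]]].
have rG0 : place_ring U G0.
  split.
  - move=> d; exists (mpolyC n d), 1; rewrite !pevalE divr1 oner_eq0; split=> //.
    by apply: filterE => z; rewrite /= !pevalE divr1.
  - move=> f g [p [q [q0 f0 fz]]] [r [s [s0 g0 gz]]]; exists (p * s + r * q), (q * s).
    rewrite !pevalE mulf_neq0 // f0 g0 addf_div //; split=> //.
    apply: filterS2 (filterI fz gz) (filterI (cnear q q0) (cnear s s0)).
    by move=> z /= [-> ->] [qz sz]; rewrite !pevalE addf_div.
  - move=> f g [p [q [q0 f0 fz]]] [r [s [s0 g0 gz]]]; exists (p * r), (q * s).
    rewrite !pevalE mulf_neq0 // f0 g0 mulf_div; split=> //.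
    by apply: filterS2 fz gz => z /= -> ->; rewrite !pevalE mulf_div.
  - move=> f g [p [q [q0 f0 fz]]] e ae; exists p, q; split=> //; first by rewrite -e.
    by apply: filterS2 fz ae => z /= -> ->.
  - move=> f [p [q [q0 f0 fz]]] ae; rewrite f0.
    have [->|p0] := eqVneq (peval p (c y0)) 0; first by rewrite mul0r.
    have [z [/= [e1 e2] [pz qz]]] := filter_ex
      (filterI (filterI fz ae) (filterI (cnear p p0) (cnear q q0))).
    move: e1 => /eqP; rewrite e2 eq_sym mulf_eq0 invr_eq0 (negPf pz).
    by rewrite /= (negPf (qz : _ != 0)).
have [G [G0G rG invG totG]] := place_exists ultraU rG0.
pose H i (z : X * Y) := hc z.1 0 i.
have [j0 Uj0] : exists j, U [set z | H j z != 0].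
  apply: contrapT => /forallNP no.
  have Uz j : U [set z | H j z = 0].
    have [//|h] := ultra_or ultraU [set z | H j z = 0].
    by case: (no j); apply: filterS h => z /= /eqP.
  have [z [/= [h0 h1] [h2 h3]]] := filter_ex
    (filterI (filterI (Uz I0) (Uz I1)) (filterI (Uz I2) (Uz I3))).
  have /eqP := hc_neq0 z.1; apply; apply/rowP => i; rewrite mxE; move: i.
  exact: ord4P.
have [j [Uj /choice[v0 hv0]]] := place_div_max ultraU rG totG Uj0.
pose h i := at_inf (fun z => H i z / H j z) (v0 i).
pose V y := \row_i h i y.
have VE z : V (Some z) = (H j z)^-1 *: hc z.1.
  by apply/rowP => i; rewrite !mxE mulrC.
have Gh i : G (h i) by exact: hv0.
have GV p : G (fun y => peval p (V y)) by exact: (place_peval rG p Gh).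
have v0j : v0 j = 1.
  apply/eqP; rewrite -subr_eq0; apply/eqP.
  apply: (place_zero rG (f := fun y => h j y + (-1))).
    by apply: (placeD rG) => //; exact: place_cst rG _.
  by apply: filterS Uj => z /= hz; rewrite divff // subrr.
have Vcone : cone C (V None).
  split; first by apply/eqP => /rowP/(_ j); rewrite !mxE /= v0j => /eqP; rewrite oner_eq0.
  apply: (place_zero rG (GV _)); apply: filterE => z /=.
  by rewrite VE peval_cubicZ (hc_cone _).2 mulr0.
have Vz z : H j z != 0 -> exists u : cone_space C,
    set_val u = V (Some z) /\ quotient_proj (@proportional K C) u = z.1.
  move=> hz; have hV : cone C (V (Some z)).
    rewrite VE; split; last by rewrite peval_cubicZ (hc_cone _).2 mulr0.
    by rewrite scaler_eq0 negb_or invr_eq0 hz hc_neq0.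
  exists (SigSub (mem_set hV)); rewrite set_valE; split=> //.
  by apply: (@pt_eq _ _ _ _ hV (H j z)); rewrite VE scalerA mulfV // scale1r.
pose u0 : cone_space C := SigSub (mem_set Vcone).
have eu0 : set_val u0 = V None by rewrite set_valE.
pose x0 : X := pt Vcone.
have nearV p : peval p (V None) != 0 -> U [set z | peval p (V (Some z)) != 0].
  by move=> p0; exact: (ae_neq0 ultraU rG (GV p) p0).
have nearX (W : set X) : zopen W -> W x0 -> U [set z | W z.1].
  move=> [O [oO eO]] Wx0.
  have Ou0 : O (V None).
    by have : (set_val @^-1` O) u0 by rewrite -eO. 
  have [s s0 hs] := (zopen_affineP _).1 oO _ Ou0.
  apply: filterS2 (nearV s s0) Uj => z /= sz hz.
  have [u [eu <-]] := Vz z hz.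
  have : (set_val @^-1` O) u by rewrite /preimage /= eu; exact: hs.
  by rewrite -eO.
have regX (W : set X) f : zopen W -> W x0 -> regular W f ->
    G (at_inf (fun z => f z.1) (f x0)).
  move=> oW Wx0 rf; have [O [g [oO Ou0 /regular_affineP rg fg]]] := rf u0 Wx0.
  rewrite eu0 in Ou0.
  have [p [q [q0 hpq]]] := rg _ Ou0.
  have [s s0 hs] := (zopen_affineP _).1 oO _ Ou0.
  apply: (place_ae rG (placeM rG (GV p) (invG _ (GV q) q0))) => /=.
    rewrite -hpq // -eu0 -fg // inE; split; first exact: Wx0.
    by change (O (set_val u0)); rewrite eu0.
  have nW := nearX W oW Wx0.
  apply: filterS2 (filterI (nearV q q0) (nearV s s0)) (filterI Uj nW).
  move=> z /= [qz sz] [hz Wz]; have [u [eu ez]] := Vz z hz.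
  have e1 : f z.1 = g (V (Some z)).
    rewrite -eu -ez; apply: fg; rewrite inE; split.
      by change (W (quotient_proj (@proportional K C) u)); rewrite ez.
    by change (O (set_val u)); rewrite eu; exact: hs.
  by rewrite e1; apply/esym; exact: (hpq _ (hs _ sz) qz).
have regY (W : set Y) g : zopen W -> W y0 -> regular W g ->
    G (at_inf (fun z => g z.2) (g y0)).
  move=> oW Wy0 rg; have [p [q [W' [q0 oW' W'y hW']]]] := creg W g oW Wy0 rg.
  apply: G0G; exists p, q; split=> //; first by have [_ ->] := hW' y0 W'y.
  by apply: filterS (nearY W' oW' W'y) => z /= /hW'[].
have [|W1 [W2 [m [f [g [[oW1 oW2] rfg [W1x W2y] nz sub]]]]]] := cZ (x0, y0).
  by move=> Zxy; apply: nZy0; exists (x0, y0).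
have Gs : G (fun y => \sum_i at_inf (fun z => f i z.1) (f i x0) y *
                       at_inf (fun z => g i z.2) (g i y0) y).
  apply: (place_sum rG) => i; have [rf rg] := rfg i.
  by apply: (placeM rG); [exact: (regX W1)|exact: (regY W2)].
have Us := ae_neq0 ultraU rG Gs nz.
have [[x y] [/= [Zz sz] [W1z W2z]]] := filter_ex
  (filterI (filterI nearZ Us) (filterI (nearX W1 oW1 W1x) (nearY W2 oW2 W2y))).
exact: (sub x y W1z W2z sz).
Qed.

End Completeness.

(** * A node is not a smooth point *)

Section NodeNotSmooth.
Variable K : numClosedFieldType.
Local Notation P2 := {poly {poly K}}.

Definition J0 : 'I_2 := Ordinal (isT : 0 < 2)%N.
Definition J1 : 'I_2 := Ordinal (isT : 1 < 2)%N.

Lemma ord2P (P : 'I_2 -> Prop) : P J0 -> P J1 -> forall i, P i.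
Proof.
move=> h0 h1 [[|[|//]] hi].
- by rewrite (_ : Ordinal hi = J0) //; apply: val_inj.
- by rewrite (_ : Ordinal hi = J1) //; apply: val_inj.
Qed.

Lemma det2 (R : comPzRingType) (M : 'M[R]_2) :
  \det M = M J0 J0 * M J1 J1 - M J0 J1 * M J1 J0.
Proof.
pose m a b := M (inord a) (inord b).
have E i j : M i j = m (val i) (val j) by rewrite /m !inord_val.
rewrite (expand_det_row _ J0) !big_ord_recl big_ord0 /cofactor !det_mx11 !mxE !E /=.
rewrite /bump /= addr0; ring.
Qed.

Lemma mderiv_var n (i j : 'I_n) :
  mderiv i (@mpolyX n K (mnm1 j)) = (i == j)%:R.
Proof.
rewrite mderivX mnm1E eq_sym; have [->|ij] := eqVneq i j; last by rewrite scale0r.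
by rewrite scale1r -[RHS](mpolyX0 n K); congr mpolyX; apply/mnmP => k;
  rewrite mnmBE subnn mnm0E.
Qed.

Section Point.
Variables (z : 'rV[K]_2).

Definition d1 i (f : mpoly 2 K) := peval (mderiv i f) z.
Definition d2 i j (f : mpoly 2 K) := peval (mderiv i (mderiv j f)) z.

Definition lin f (a b : K) := d1 J0 f * a + d1 J1 f * b.
Definition quad f (a b : K) :=
  d2 J0 J0 f * a ^+ 2 + 2%:R * (d2 J0 J1 f * (a * b)) + d2 J1 J1 f * b ^+ 2.

Lemma linD f g a b : lin (f + g) a b = lin f a b + lin g a b.
Proof. rewrite /lin /d1 !mderivD !pevalD; ring. Qed.

Lemma quadD f g a b : quad (f + g) a b = quad f a b + quad g a b.
Proof. rewrite /quad /d2 !mderivD !pevalD; ring. Qed.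

Lemma linM f g a b : lin (f * g) a b = peval f z * lin g a b + lin f a b * peval g z.
Proof. rewrite /lin /d1 !mderivM !pevalD !pevalM; ring. Qed.

Lemma quadM f g a b : quad (f * g) a b = peval f z * quad g a b
  + 2%:R * (lin f a b * lin g a b) + quad f a b * peval g z.
Proof.
rewrite /quad /lin /d1 /d2 !mderivM !mderivD !mderivM !pevalD !pevalM; ring.
Qed.

Lemma jet_mul (F L Q R G M N S t : K) :
  (F + t * L + t ^+ 2 * (Q / 2%:R) + t ^+ 3 * R) *
  (G + t * M + t ^+ 2 * (N / 2%:R) + t ^+ 3 * S) =
  F * G + t * (F * M + L * G) + t ^+ 2 * ((F * N + 2%:R * (L * M) + Q * G) / 2%:R)
  + t ^+ 3 * (F * S + L * (N / 2%:R) + Q / 2%:R * M + R * G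
    + t * (L * S + Q / 2%:R * (N / 2%:R) + R * M)
    + t ^+ 2 * (Q / 2%:R * S + R * (N / 2%:R)) + t ^+ 3 * (R * S)).
Proof. by field. Qed.

Section Directions.
Variables (e0 e1 g0 g1 : K).

(** The point z + t (e + v g): the blow-up of the plane at z in the chart of
    the directions close to e. *)
Definition blowup (v t : K) : 'rV[K]_2 :=
  \row_i (z 0 i + t * (if i == J0 then e0 + v * g0 else e1 + v * g1)).

Lemma lin_poly f : exists k : P2, forall v t,
  ev v t k = lin f (e0 + v * g0) (e1 + v * g1).
Proof.
exists ((d1 J0 f)%:P%:P * (e0%:P%:P + 'X * g0%:P%:P)
      + (d1 J1 f)%:P%:P * (e1%:P%:P + 'X * g1%:P%:P)) => v t.
by rewrite /lin !evE.
Qed.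

Lemma quad_poly f : exists k : P2, forall v t,
  ev v t k = quad f (e0 + v * g0) (e1 + v * g1).
Proof.
pose p : P2 := e0%:P%:P + 'X * g0%:P%:P; pose q : P2 := e1%:P%:P + 'X * g1%:P%:P.
exists ((d2 J0 J0 f)%:P%:P * (p * p) + 2%:R%:P%:P * ((d2 J0 J1 f)%:P%:P * (p * q))
  + (d2 J1 J1 f)%:P%:P * (q * q)) => v t.
by rewrite /quad !expr2 !evE.
Qed.

(** The remainder is divisible by t ^ 3 because the statement is stable under
    products: see [jet_mul]. *)
Lemma blowup_taylor (f : mpoly 2 K) : exists r : P2, forall v t,
  let a := e0 + v * g0 in let b := e1 + v * g1 in
  peval f (blowup v t) =
    peval f z + t * lin f a b + t ^+ 2 * (quad f a b / 2%:R) + t ^+ 3 * ev v t r.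
Proof.
elim/mpoly_ring_ind: f => [c|i|f g [r hr] [s hs]|f g [r hr] [s hs]].
- exists 0 => v t /=; rewrite /lin /quad /d1 /d2 !mderivC !pevalC.
  by rewrite ev0 !(mul0r, mulr0, addr0).
- exists 0 => v t /=; rewrite /lin /quad /d1 /d2 !mderiv_var !pevalX mxE.
  rewrite ev0.
  have d0 k (b : bool) : mderiv k (b%:R : mpoly 2 K) = 0.
    by case: b; rewrite ?raddf0 // -(mpolyC1 2 K) mderivC.
  have p0 : peval (0 : mpoly 2 K) z = 0 by exact: meval0.
  rewrite !d0 !p0.
  have pb (b : bool) : peval (b%:R : mpoly 2 K) z = b%:R.
    by case: b; rewrite ?peval1 // p0.
  rewrite !pb; move: i; apply: ord2P => /=; ring.
- exists (r + s) => v t /=; rewrite evD pevalD hr hs linD quadD; ring.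
have evc c : exists k : P2, forall v t, ev v t k = c.
  by exists c%:P%:P => v t; rewrite evC hornerC.
have [f0 ef0] := evc (peval f z); have [k0 ek0] := evc (peval g z).
have [h eh] := evc 2%:R^-1.
have [tt ett] : exists k : P2, forall v t, ev v t k = t.
  by exists 'X%:P => v t; rewrite evC hornerX.
have [lf elf] := lin_poly f; have [lg elg] := lin_poly g.
have [qf eqf] := quad_poly f; have [qg eqg] := quad_poly g.
exists (f0 * s + lf * (qg * h) + qf * h * lg + r * k0
  + tt * (lf * s + qf * h * (qg * h) + r * lg)
  + tt ^+ 2 * (qf * h * s + r * (qg * h)) + tt ^+ 3 * (r * s)) => v t.
cbv zeta; rewrite pevalM hr hs linM quadM jet_mul; congr (_ + _ * _).
- by rewrite pevalM.
- by rewrite !(evXn, evM, evD) ef0 ek0 eh ett elf elg eqf eqg.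
Qed.

Lemma blowup_first (f : mpoly 2 K) : exists r : P2, forall v t,
  peval f (blowup v t) = peval f z + t * ev v t r.
Proof.
have [r hr] := blowup_taylor f.
have [lf elf] := lin_poly f; have [qf eqf] := quad_poly f.
exists (lf + 'X%:P * (qf * 2%:R^-1%:P%:P) + 'X%:P * ('X%:P * r)) => v t.
by rewrite hr !(evM, evD) !evC hornerX hornerC elf eqf; ring.
Qed.

Lemma blowup_poly (p : mpoly 2 K) : exists r : P2, forall v t,
  peval p (blowup v t) = ev v t r.
Proof.
have [r hr] := blowup_first p; exists ((peval p z)%:P%:P + 'X%:P * r) => v t.
by rewrite hr evD evM !evC hornerC hornerX.
Qed.

Lemma blowup00 : blowup 0 0 = z.
Proof. by apply/rowP => i; rewrite mxE mul0r addr0. Qed.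

(** The strict transform of a nodal curve meets the exceptional line
    transversally at an isotropic direction, so the curve has points close to
    z in directions close to it. *)
Lemma node_branch f (G : P2) :
  peval f z = 0 -> (forall a b, lin f a b = 0) ->
  quad f e0 e1 = 0 -> quad f g0 g1 = 0 -> quad f (e0 + g0) (e1 + g1) != 0 ->
  ev 0 0 G != 0 ->
  exists v t, [/\ t != 0, peval f (blowup v t) = 0 & ev v t G != 0].
Proof.
move=> fz fl qe qg qeg G0; have [r hr] := blowup_taylor f.
have [qf eqf] := quad_poly f; pose F := 2%:R^-1%:P%:P * qf + 'X%:P * r.
have FE v t : ev v t F = quad f (e0 + v * g0) (e1 + v * g1) / 2%:R + t * ev v t r.
  by rewrite evD !evM !evC hornerX hornerC eqf mulrC.
have F0 : ev 0 0 F = 0 by rewrite FE !mul0r !addr0 qe mul0r.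
have sF : spec 0 F != 0.
  apply/eqP => e; have := FE 1 0; rewrite /ev e horner0 !mul1r mul0r addr0.
  by move/esym/eqP; rewrite mulf_eq0 (negPf qeg) invr_eq0 pnatr_eq0.
have [v [t [t0 Ft Gt]]] := curve_leaves_line F0 sF G0.
exists v, t; split=> //; rewrite hr fz fl.
transitivity (t ^+ 2 * ev v t F); last by rewrite Ft mulr0.
by rewrite FE; ring.
Qed.

End Directions.

Lemma isotropic_directions (A B C : K) : A * C - B ^+ 2 != 0 ->
  let q a b := A * a ^+ 2 + 2%:R * (B * (a * b)) + C * b ^+ 2 in
  exists e0 e1 g0 g1, [/\ q e0 e1 = 0, q g0 g1 = 0, q (e0 + g0) (e1 + g1) != 0
    & e0 * g1 - e1 * g0 != 0].
Proof.
move=> disc q; have [C0|C0] := eqVneq C 0.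
  have B0 : B != 0 by apply: contraNneq disc => ->; rewrite C0 mulr0 expr0n subrr.
  exists 0, 1, (2%:R * B), (- A); split; rewrite /q ?C0.
  - by ring.
  - by ring.
  - have -> : A * (0 + 2%:R * B) ^+ 2 + 2%:R * (B * ((0 + 2%:R * B) * (1 - A))) +
      0 * (1 - A) ^+ 2 = 2%:R ^+ 2 * B ^+ 2 by ring.
    by rewrite mulf_neq0 // expf_neq0 // pnatr_eq0.
  - by rewrite mul0r sub0r mul1r oppr_eq0 mulf_neq0 // pnatr_eq0.
pose d := sqrtC (B ^+ 2 - A * C); have dd : d ^+ 2 = B ^+ 2 - A * C by rewrite sqrtCK.
have d0 : d != 0 by rewrite sqrtC_eq0 -oppr_eq0 opprB.
exists 1, ((- B + d) / C), 1, ((- B - d) / C); split; rewrite /q.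
- have -> : A * 1 ^+ 2 + 2%:R * (B * (1 * ((- B + d) / C))) + C * ((- B + d) / C) ^+ 2
    = (d ^+ 2 - (B ^+ 2 - A * C)) / C by field.
  by rewrite dd subrr mul0r.
- have -> : A * 1 ^+ 2 + 2%:R * (B * (1 * ((- B - d) / C))) + C * ((- B - d) / C) ^+ 2
    = (d ^+ 2 - (B ^+ 2 - A * C)) / C by field.
  by rewrite dd subrr mul0r.
- have -> : A * (1 + 1) ^+ 2 + 2%:R * (B * ((1 + 1) * ((- B + d) / C + (- B - d) / C)))
    + C * ((- B + d) / C + (- B - d) / C) ^+ 2 = - (2%:R ^+ 2 * (B ^+ 2 - A * C) / C).
    by field.
  by rewrite oppr_eq0 !mulf_neq0 ?invr_eq0 ?expf_neq0 ?pnatr_eq0 // -oppr_eq0 opprB.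
- have -> : 1 * ((- B - d) / C) - (- B + d) / C * 1 = - (2%:R * d / C) by field.
  by rewrite oppr_eq0 !mulf_neq0 ?invr_eq0 ?pnatr_eq0.
Qed.

End Point.

Lemma homogenize n (P Q : mpoly n K) (p : {poly K}) N : (size p <= N.+1)%N ->
  exists m, forall w : 'rV[K]_n, peval Q w != 0 ->
    peval m w = peval Q w ^+ N * p.[peval P w / peval Q w].
Proof.
move=> sp; exists (\sum_(i < N.+1) mpolyC n p`_i * P ^+ i * Q ^+ (N - i)) => w Qw.
rewrite (horner_coef_wide _ sp) mulr_sumr.
transitivity (\sum_(i < N.+1) peval (mpolyC n p`_i * P ^+ i * Q ^+ (N - i)) w).
  exact: raddf_sum.
apply: eq_bigr => i _; rewrite !pevalE expr_div_n.
have -> : peval Q w ^+ N = peval Q w ^+ (N - i) * peval Q w ^+ i.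
  by rewrite -exprD subnK // -ltnS.
by field; exact: expf_neq0.
Qed.

(** A nodal curve is not parametrised near its node by a function u = P/Q of
    which the coordinates are rational functions a/b: along each branch the
    coordinates would grow in the direction of their derivatives with respect
    to u, so there would be only one tangent. *)
Section NotParametrized.
Variables (f : mpoly 2 K) (z : 'rV[K]_2).
Hypotheses (fz : peval f z = 0) (dfz : forall j, peval (mderiv j f) z = 0).
Variables (P Q s : mpoly 2 K) (c : {poly K}) (a b : 'I_2 -> {poly K}).
Local Notation u w := (peval P w / peval Q w).
Hypotheses (sz : peval s z != 0) (Qz : peval Q z != 0) (cz : c.[u z] != 0)
  (bz : forall i, (b i).[u z] != 0).
Hypothesis param : forall w : 'rV[K]_2, peval f w = 0 -> peval s w != 0 ->
  peval Q w != 0 -> c.[u w] != 0 -> forall i, w 0 i * (b i).[u w] = (a i).[u w].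

(** The branch with tangent e is the strict transform at v = 0. Were the two
    sides different, the defect G of their equality, freed of denominators,
    would be nonzero at some of its points with t != 0, where the
    parametrisation forces it to vanish. *)
Lemma branch_direction (k : 'I_2 -> {poly K}) (e0 e1 g0 g1 : K) :
  (forall i, a i - z 0 i *: b i = k i * ('X - (u z)%:P)) ->
  quad z f e0 e1 = 0 -> quad z f g0 g1 = 0 -> quad z f (e0 + g0) (e1 + g1) != 0 ->
  exists x, forall i, (if i == J0 then e0 else e1) * (b i).[u z] * peval Q z ^+ 2
    = x * (k i).[u z].
Proof.
move=> hk qe qg qeg.
pose T := P * mpolyC 2 (peval Q z) - mpolyC 2 (peval P z) * Q.
have [T' hT'] := blowup_first z e0 e1 g0 g1 T.
have Tz : peval T z = 0 by rewrite pevalB !pevalE mulrC subrr.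
exists (ev 0 0 T') => i; apply/eqP; rewrite -subr_eq0; apply/negPn/negP => ne.
pose N := maxn (size (b i)) (size (k i)).
have [mb hmb] : exists m, forall w : 'rV[K]_2, peval Q w != 0 ->
    peval m w = peval Q w ^+ N * (b i).[u w].
  by apply: homogenize; rewrite leqW // leq_maxl.
have [mk hmk] : exists m, forall w : 'rV[K]_2, peval Q w != 0 ->
    peval m w = peval Q w ^+ N * (k i).[u w].
  by apply: homogenize; rewrite leqW // leq_maxr.
have [mc hmc] : exists m, forall w : 'rV[K]_2, peval Q w != 0 ->
    peval m w = peval Q w ^+ size c * c.[u w].
  exact: homogenize.
have [r1 hr1] := blowup_poly z e0 e1 g0 g1 (s * (Q * mc)).
have [r2 hr2] := blowup_poly z e0 e1 g0 g1 (mb * (Q * mpolyC 2 (peval Q z))).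
have [r3 hr3] := blowup_poly z e0 e1 g0 g1 mk.
pose d : P2 := (if i == J0 then e0 else e1)%:P%:P + 'X * (if i == J0 then g0 else g1)%:P%:P.
have ed v t : ev v t d = if i == J0 then e0 + v * g0 else e1 + v * g1.
  by rewrite !evE; case: ifP.
pose G := r1 * (d * r2 - T' * r3).
have evG v t : ev v t G = ev v t r1 * (ev v t d * ev v t r2 - ev v t T' * ev v t r3).
  by rewrite evM evD evN !evM.
have G0 : ev 0 0 G != 0.
  rewrite evG ed -hr1 -hr2 -hr3 blowup00 !pevalM pevalC hmc // hmb // hmk //.
  rewrite !mul0r !addr0 mulf_neq0 ?mulf_neq0 ?expf_neq0 //.
  apply: contra_neq ne => e; apply: (@mulfI _ (peval Q z ^+ N)); first by rewrite expf_neq0.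
  rewrite mulr0 -[RHS]e.
  move: (if i == J0 then e0 else e1) ((b i).[u z]) ((k i).[u z]) (ev 0 0 T') => *.
  by ring.
have fl x y : lin z f x y = 0 by rewrite /lin /d1 !dfz !mul0r addr0.
have [v [t [t0 fw]]] := node_branch fz fl qe qg qeg G0.
have := hT' v t; rewrite Tz add0r; set w := blowup _ _ _ _ _ _ _ in fw * => Tw.
rewrite evG mulf_eq0 negb_or -hr1 -/w !pevalM !mulf_eq0 !negb_or.
move=> /andP[/and3P[sw Qw mcw]] /eqP; apply.
have cw : c.[u w] != 0.
  by move: mcw; rewrite hmc // mulf_eq0 negb_or => /andP[].
have wi : w 0 i = z 0 i + t * ev v t d by rewrite ed mxE.
have uw : u w - u z = t * ev v t T' / (peval Q w * peval Q z).
  rewrite -Tw /T pevalB !pevalE -mulNr addf_div //; congr (_ / _).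
  by rewrite mulNr.
have rel : t * (ev v t d * (b i).[u w]) = (k i).[u w] * (u w - u z).
  have := congr1 (fun p : {poly K} => p.[u w]) (hk i).
  rewrite hornerM hornerXsubC => <-; rewrite hornerD hornerN hornerZ.
  by rewrite -(param fw sw Qw cw) wi; ring.
rewrite -hr2 -hr3 -/w !pevalM pevalC hmb // hmk //; apply: (mulfI t0).
have -> : t * (ev v t d * (peval Q w ^+ N * (b i).[u w] * (peval Q w * peval Q z)) -
  ev v t T' * (peval Q w ^+ N * (k i).[u w])) = peval Q w ^+ N *
  (t * (ev v t d * (b i).[u w]) * (peval Q w * peval Q z)
   - (k i).[u w] * (t * ev v t T')) by ring.
rewrite rel uw mulr0; move: ((k i).[u w]) => kk; field; by rewrite Qw Qz.
Qed.

Lemma node_not_param : \det (hessian f z) != 0 -> False.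
Proof.
move=> hess.
have disc : d2 z J0 J0 f * d2 z J1 J1 f - d2 z J0 J1 f ^+ 2 != 0.
  apply: contra_neq hess => e; rewrite det2 !mxE -[RHS]e /d2.
  by rewrite (mderiv_comm J0 J1); ring.
have [e0 [e1 [g0 [g1 [qe qg qeg ind]]]]] := isotropic_directions disc.
have az i : z 0 i * (b i).[u z] = (a i).[u z] by exact: param.
have /choice[k hk] : forall i, exists k, a i - z 0 i *: b i = k * ('X - (u z)%:P).
  move=> i; have /factor_theorem[k ek] : root (a i - z 0 i *: b i) (u z).
    by apply/rootP; rewrite hornerD hornerN hornerZ az subrr.
  by exists k.
have [x hx] := branch_direction hk qe qg qeg.
have [y hy] : exists y, forall i, (if i == J0 then g0 else g1) * (b i).[u z] *
    peval Q z ^+ 2 = y * (k i).[u z].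
  by apply: (branch_direction hk qg qe); rewrite (addrC g0) (addrC g1).
move/negP: ind; apply; apply/eqP.
have q0 : (b J0).[u z] * (b J1).[u z] * peval Q z ^+ 2 * peval Q z ^+ 2 != 0.
  by rewrite !mulf_neq0 ?expf_neq0.
apply: (mulIf q0); rewrite mul0r.
have := hx J0; have := hx J1; have := hy J0; have := hy J1 => /=.
move=> y1 y0 x1 x0.
have -> : (e0 * g1 - e1 * g0) * ((b J0).[u z] * (b J1).[u z] * peval Q z ^+ 2 *
    peval Q z ^+ 2) =
  (e0 * (b J0).[u z] * peval Q z ^+ 2) * (g1 * (b J1).[u z] * peval Q z ^+ 2)
  - (e1 * (b J1).[u z] * peval Q z ^+ 2) * (g0 * (b J0).[u z] * peval Q z ^+ 2) by ring.
by rewrite x0 x1 y0 y1; ring.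
Qed.

End NotParametrized.
End NodeNotSmooth.

Section LocalExtraction.
Variable K : fieldType.

Lemma regular_sub_affine n (A : set (affine_space K n)) (W : set (subspace_wf A)) f a :
  @regular K (subspace_wf A) W f -> W a ->
  exists p q, peval q (set_val a) != 0 /\ forall b, W b -> peval q (set_val b) != 0 ->
    f b = peval p (set_val b) / peval q (set_val b).
Proof.
move=> rf Wa; have [U [g [oU Ua /regular_affineP rg fg]]] := rf a Wa.
have [s sa hs] := (zopen_affineP U).1 oU _ Ua; have [p [q [qa hpq]]] := rg _ Ua.
exists (p * s), (q * s); rewrite pevalM mulf_neq0 //; split=> // b Wb.
rewrite !pevalM mulf_eq0 negb_or => /andP[qb sb]; have Ub := hs _ sb.
rewrite fg; last by rewrite inE.
by rewrite hpq // -mulf_div divff // mulr1.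
Qed.

Lemma zopen_sub_affine n (A : set (affine_space K n)) (W : set (subspace_wf A)) a :
  zopen W -> W a -> exists s, peval s (set_val a) != 0 /\
    forall b : subspace_wf A, peval s (set_val b) != 0 -> W b.
Proof.
move=> [U [oU ->]] Ua; have [s sa hs] := (zopen_affineP U).1 oU _ Ua.
by exists s; split=> // b; exact: hs.
Qed.

Lemma regular_of_sub (X : space_with_functions K) (U : set X) f : space_axioms X ->
  zopen U -> @greg K (subspace_wf U) (f \o set_val) -> regular U f.
Proof.
move=> aX oU rf; apply: (regular_local aX) => // x Ux.
pose x' : subspace_wf U := SigSub (mem_set Ux).
have [V [g [oV Vx rg fg]]] := rf x' I.
exists V, g; split=> // y Uy Vy.
by have := fg (SigSub (mem_set Uy)); rewrite inE; apply.
Qed.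

(** A section over U is a total function, whence the extension by zero. *)
Definition extend_coord (X : space_with_functions K) (U : set X) n
    (B : set (affine_space K n)) (phi : subspace_wf U -> subspace_wf B) (i : 'I_n) y :=
  match pselect (U y) with
  | left h => (set_val (phi (SigSub (mem_set h))) : 'rV[K]_n) 0 i
  | right _ => 0 end.

Lemma extend_coordE X U n B (phi : @subspace_wf K X U -> @subspace_wf K (affine_space K n) B) i y :
  extend_coord phi i (set_val y) = (set_val (phi y) : 'rV[K]_n) 0 i.
Proof.
rewrite /extend_coord; case: pselect => [h|[]]; last exact: set_valP.
by congr ((set_val (phi _) : 'rV[K]_n) 0 i); exact: val_inj.
Qed.

Lemma extend_coord_regular X U n B
    (phi : @subspace_wf K X U -> @subspace_wf K (affine_space K n) B) i :
  space_axioms X -> zopen U -> morphism phi -> regular U (extend_coord phi i).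
Proof.
move=> aX oU mphi; apply: regular_of_sub => //.
have aB := ringed_axioms (subspace_ringed B (affine_ringed K n)).
rewrite (_ : _ \o _ = (fun v : @subspace_wf K (affine_space K n) B =>
    (set_val v : 'rV[K]_n) 0 i) \o phi).
  exact: (morphism_greg aB mphi (@coord_greg K n B i)).
by apply/funext => y; exact: extend_coordE.
Qed.

Lemma mpoly1_poly (p : mpoly 1 K) : exists q : {poly K},
  forall t : 'rV[K]_1, peval p t = q.[t 0 0].
Proof.
elim/mpoly_ring_ind: p => [c|i|p q [p' hp] [q' hq]|p q [p' hp] [q' hq]].
- by exists c%:P => t; rewrite pevalE hornerC.
- by exists 'X => t; rewrite pevalE hornerX (ord1 i).
- by exists (p' + q') => t; rewrite pevalE hp hq hornerD.
- by exists (p' * q') => t; rewrite pevalE hp hq hornerM.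
Qed.

End LocalExtraction.

(** On an open part of the line, local coordinates at the node and the
    coordinate of the line would be rational functions of each other. *)
Lemma node_not_line (K : numClosedFieldType) (Y : space_with_functions K) (x : Y)
    (U1 : set Y) (V : set (affine_space K 1)) : ringed Y -> zopen U1 -> U1 x ->
  isomorphic (subspace_wf U1) (subspace_wf V) -> ~ node_at x.
Proof.
move=> rY oU1 U1x [phi [mphi [psi [mpsi pK pK']]]].
move=> [f [z [[U2 [O [oU2 oO U2x [chi [[mchi [xi [mxi cK cK']]] hz]]]]] df hess]]].
have aY := ringed_axioms rY.
pose g := extend_coord phi 0; pose k i := extend_coord chi i.
have rg : regular U1 g by exact: extend_coord_regular.
have rk i : regular U2 (k i) by exact: extend_coord_regular.
pose h : @subspace_wf K (affine_space K 2) (zero_set [set f] `&` O) -> Y := set_val \o xi.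
pose h' : subspace_wf V -> Y := set_val \o psi.
have mh : morphism h by apply: morphism_comp => //; exact: set_val_morphism.
have mh' : morphism h' by apply: morphism_comp => //; exact: set_val_morphism.
pose x1 : subspace_wf U1 := SigSub (mem_set U1x).
pose x2 : subspace_wf U2 := SigSub (mem_set U2x).
have ex1 : set_val x1 = x by rewrite set_valE.
have ex2 : set_val x2 = x by rewrite set_valE.
have ez : set_val (chi x2) = z by exact: hz.
have [Zz Oz] : (zero_set [set f] `&` O) z by rewrite -ez; exact: set_valP.
have hz0 : h (chi x2) = x by rewrite /h /= cK.
have ht0 : h' (phi x1) = x by rewrite /h' /= pK.
have [oW1 rW1] := mh U1 oU1; have [oW2 rW2] := mh' U2 oU2.
have W1z : (h @^-1` U1) (chi x2) by rewrite /preimage /mkset hz0.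
have W2t : (h' @^-1` U2) (phi x1) by rewrite /preimage /mkset ht0.
have [s1 [s1z hs1]] := zopen_sub_affine oW1 W1z.
have [s2 [s2t hs2]] := zopen_sub_affine oW2 W2t.
have [s3 s3z hs3] := (zopen_affineP O).1 oO _ Oz.
have [P [Q [Qz hPQ]]] := regular_sub_affine (rW1 g rg) W1z.
rewrite ez in s1z Qz.
have /choice[a' /choice[b' hab]] : forall i, exists p q, peval q (set_val (phi x1)) != 0 /\
    forall t, (h' @^-1` U2) t -> peval q (set_val t) != 0 ->
      (k i \o h') t = peval p (set_val t) / peval q (set_val t).
  by move=> i; exact: (regular_sub_affine (rW2 (k i) (rk i)) W2t).
have [c2 hc2] := mpoly1_poly s2.
have /choice[a ha] : forall i, exists q : {poly K},
    forall t : 'rV[K]_1, peval (a' i) t = q.[t 0 0] by move=> i; exact: mpoly1_poly.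
have /choice[b hb] : forall i, exists q : {poly K},
    forall t : 'rV[K]_1, peval (b' i) t = q.[t 0 0] by move=> i; exact: mpoly1_poly.
have uz : peval P z / peval Q z = set_val (phi x1) 0 0.
  have := hPQ _ W1z; rewrite ez => /(_ Qz) <-.
  by rewrite /= hz0 -ex1 /g extend_coordE.
have bz i : (b i).[peval P z / peval Q z] != 0 by rewrite uz -hb; have [] := hab i.
have fz : peval f z = 0 by exact: Zz.
apply: (@node_not_param K f z fz df P Q (s1 * s3) (c2 * (b J0 * b J1)) a b) => //.
- by rewrite pevalM mulf_neq0.
- by rewrite !hornerM !mulf_neq0 // uz -hc2.
move=> w fw; rewrite pevalM mulf_eq0 negb_or => /andP[s1w s3w] Qw.
rewrite !hornerM !mulf_eq0 !negb_or => /and3P[c2w b0w b1w].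
have Aw : (zero_set [set f] `&` O) w by split; [move=> _ ->|exact: hs3].
pose y : @subspace_wf K (affine_space K 2) (zero_set [set f] `&` O) := SigSub (mem_set Aw).
have ey : set_val y = w by rewrite set_valE.
have W1y : (h @^-1` U1) y by apply: hs1; rewrite ey.
have U1y : U1 (h y) by [].
pose y1 : subspace_wf U1 := SigSub (mem_set U1y).
have ey1 : set_val y1 = h y by rewrite set_valE.
have ew : peval P w / peval Q w = set_val (phi y1) 0 0.
  have := hPQ y W1y; rewrite ey => /(_ Qw) <-.
  by rewrite /= -ey1 /g extend_coordE.
have W2y : (h' @^-1` U2) (phi y1) by apply: hs2; rewrite hc2 -ew.
have e : h' (phi y1) = set_val (xi y) by rewrite /h' /= pK ey1.
move=> i; have [_ hi] := hab i.
have bw : (b i).[peval P w / peval Q w] != 0.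
  by move: i {hi}; apply: ord2P.
have := hi _ W2y; rewrite hb ha -ew => /(_ bw).
rewrite /= e /k extend_coordE cK' ey => ->.
by rewrite divfK.
Qed.

(** * The cubic surface and its section at infinity *)

Definition hornE := (hornerD, hornerN, hornerM, hornerXn, hornerC, hornerX).

Section CubicGeometry.
Variables (K : numClosedFieldType) (C : cubic K).
Hypotheses (c0 : cc C != 0) (a0 : ca C != 0).
Local Notation X := (proj_cubic C).
Local Notation P2 := {poly {poly K}}.
Local Notation pr := (quotient_proj (@proportional K C)).

Definition on_cubic (x y z : K) := z ^+ 2 - Plin C x y * z + Qcub C x y = 0.

Lemma cubic_form1 x y z : cubic_form C x y z 1 = z ^+ 2 - Plin C x y * z + Qcub C x y.
Proof. rewrite /cubic_form /Plin /Qcub; ring. Qed.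

Lemma on_cubicP x y z : on_cubic x y z <-> peval (cubic_poly C) (vec4 x y z 1) = 0.
Proof. by rewrite peval_cubic !vec4E cubic_form1. Qed.

Lemma affine_chart_on_cubic v : affine_chart C I3 v ->
  on_cubic (v 0 I0) (v 0 I1) (v 0 I2) /\ v = vec4 (v 0 I0) (v 0 I1) (v 0 I2) 1.
Proof.
move=> [v3 hv]; have e : v = vec4 (v 0 I0) (v 0 I1) (v 0 I2) 1.
  by rewrite [LHS]vec4_eta v3.
by split=> //; apply/on_cubicP; rewrite -e.
Qed.

(** In the next polynomials the outer variable is x, the inner one y. *)
Definition Ppoly : P2 := 'X * ('X + (cp1 C)%:P)%:P + ((cp2 C)%:P * 'X + (cp3 C)%:P)%:P.
Definition Qpoly : P2 := (cc C)%:P%:P * 'X ^+ 3 + (cq1 C)%:P%:P * 'X ^+ 2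
  + ((cq2 C)%:P * 'X + (cq4 C)%:P)%:P * 'X
  + ((ca C)%:P * 'X ^+ 3 + (cq3 C)%:P * 'X ^+ 2 + (cq5 C)%:P * 'X + (cq6 C)%:P)%:P.

Lemma ev_Ppoly x y : ev x y Ppoly = Plin C x y.
Proof. rewrite /Ppoly /Plin !(evD, evM, evC, evX) !hornE. ring. Qed.

Lemma ev_Qpoly x y : ev x y Qpoly = Qcub C x y.
Proof.
by rewrite /Qpoly /Qcub !(evXn, evD, evM, evC, evX) !hornE; ring.
Qed.

(** The coordinate ring of the affine cubic is free over K[x, y] with basis
    1, z, because the equation is monic in z. *)
Definition module_form (f : K -> K -> K -> K) := exists al be : P2, forall x y z,
  on_cubic x y z -> f x y z = ev x y al + ev x y be * z.

Lemma module_form_poly (a : P2) : module_form (fun x y _ => ev x y a).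
Proof. by exists a, 0 => x y z _; rewrite ev0 mul0r addr0. Qed.

Lemma module_form_cst d : module_form (fun _ _ _ => d).
Proof. by exists d%:P%:P, 0 => x y z _; rewrite evC hornerC ev0 mul0r addr0. Qed.

Lemma module_form_z : module_form (fun _ _ z => z).
Proof. by exists 0, 1 => x y z _; rewrite ev1 ev0 mul1r add0r. Qed.

Lemma module_formD f g : module_form f -> module_form g ->
  module_form (fun x y z => f x y z + g x y z).
Proof.
move=> [al [be h]] [al' [be' h']]; exists (al + al'), (be + be') => x y z S.
by rewrite h // h' // !evD; ring.
Qed.

Lemma module_formM f g : module_form f -> module_form g ->
  module_form (fun x y z => f x y z * g x y z).
Proof.
move=> [al [be h]] [al' [be' h']].
exists (al * al' + - (be * be' * Qpoly)), (al * be' + be * al' + be * be' * Ppoly).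
move=> x y z S; rewrite h // h' // !(ev_Ppoly, ev_Qpoly, evD, evN, evM).
have -> : (ev x y al + ev x y be * z) * (ev x y al' + ev x y be' * z) =
  ev x y al * ev x y al' - ev x y be * ev x y be' * Qcub C x y +
  (ev x y al * ev x y be' + ev x y be * ev x y al' + ev x y be * ev x y be' * Plin C x y) * z
  + ev x y be * ev x y be' * (z ^+ 2 - Plin C x y * z + Qcub C x y) by ring.
by rewrite S mulr0 addr0.
Qed.

Lemma module_form_subst n (p : mpoly n K) (h : 'I_n -> K -> K -> K -> K) :
  (forall i, module_form (h i)) -> module_form (fun x y z => peval p (\row_i h i x y z)).
Proof.
move=> mh; elim/mpoly_ring_ind: p => [d|i|p q mp mq|p q mp mq].
- have [al [be e]] := module_form_cst d; exists al, be => x y z S.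
  by rewrite pevalE (e x y z S).
- have [al [be e]] := mh i; exists al, be => x y z S.
  by rewrite pevalE mxE (e x y z S).
- have [al [be e]] := module_formD mp mq; exists al, be => x y z S.
  by rewrite pevalE (e x y z S).
- have [al [be e]] := module_formM mp mq; exists al, be => x y z S.
  by rewrite pevalE (e x y z S).
Qed.

Lemma normal_form (s : mpoly 4 K) : module_form (fun x y z => peval s (vec4 x y z 1)).
Proof.
have [] := @module_form_subst 4 s (fun i x y z => vec4 x y z 1 0 i).
  apply: ord4P.
  - have [al [be e]] := module_form_poly 'X; exists al, be => x y z S.
    by rewrite vec4E -(e x y z S) evX.
  - have [al [be e]] := module_form_poly 'X%:P; exists al, be => x y z S.
    by rewrite vec4E -(e x y z S) evC hornerX.
  - have [al [be e]] := module_form_z; exists al, be => x y z S.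
    by rewrite vec4E -(e x y z S).
  - have [al [be e]] := module_form_cst 1; exists al, be => x y z S.
    by rewrite vec4E -(e x y z S).
move=> al [be e]; exists al, be => x y z S; rewrite -(e x y z S); congr peval.
by apply/rowP => i; rewrite [RHS]mxE.
Qed.

Definition norm (al be : P2) : P2 := al * al + al * be * Ppoly + be * be * Qpoly.

Lemma ev_norm x y al be : ev x y (norm al be) = ev x y al * ev x y al +
  ev x y al * ev x y be * Plin C x y + ev x y be * ev x y be * Qcub C x y.
Proof. by rewrite !(ev_Ppoly, ev_Qpoly, evD, evM). Qed.

Lemma norm_factor x y z al be : on_cubic x y z ->
  ev x y (norm al be) = (ev x y al + ev x y be * z) *
                        (ev x y al + ev x y be * (Plin C x y - z)).
Proof.
move=> S; rewrite ev_norm.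
have -> : (ev x y al + ev x y be * z) * (ev x y al + ev x y be * (Plin C x y - z)) =
  ev x y al * ev x y al + ev x y al * ev x y be * Plin C x y +
  ev x y be * ev x y be * Qcub C x y
  - ev x y be * ev x y be * (z ^+ 2 - Plin C x y * z + Qcub C x y) by ring.
by rewrite S mulr0 subr0.
Qed.

Lemma on_cubic_conj x y z : on_cubic x y z -> on_cubic x y (Plin C x y - z).
Proof.
rewrite /on_cubic => S; rewrite -[RHS]S; ring.
Qed.

Lemma on_cubic_ex x y : exists z, on_cubic x y z.
Proof.
pose d := sqrtC (Plin C x y ^+ 2 - 4%:R * Qcub C x y).
have dd : d ^+ 2 = Plin C x y ^+ 2 - 4%:R * Qcub C x y by rewrite sqrtCK.
exists ((Plin C x y + d) / 2%:R); rewrite /on_cubic.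
have -> : ((Plin C x y + d) / 2%:R) ^+ 2 - Plin C x y * ((Plin C x y + d) / 2%:R)
  + Qcub C x y = (d ^+ 2 - (Plin C x y ^+ 2 - 4%:R * Qcub C x y)) / 4%:R by field.
by rewrite dd subrr mul0r.
Qed.

Lemma size_sqr (p : P2) : p != 0 -> size (p * p) = (size p).*2.-1.
Proof. by move=> p0; rewrite size_mul // addnn. Qed.

(** The discriminant has odd degree in x, so it is not a square: the affine
    cubic is irreducible. *)
Lemma norm_eq0 al be : norm al be = 0 -> al = 0 /\ be = 0.
Proof.
pose D0 : {poly K} := ('X + (cp1 C)%:P) ^+ 2 - 4%:R%:P * (cq1 C)%:P.
pose D1 : {poly K} := 2%:R%:P * (('X + (cp1 C)%:P) * ((cp2 C)%:P * 'X + (cp3 C)%:P))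
  - 4%:R%:P * ((cq2 C)%:P * 'X + (cq4 C)%:P).
pose D2 : {poly K} := ((cp2 C)%:P * 'X + (cp3 C)%:P) ^+ 2 - 4%:R%:P *
  ((ca C)%:P * 'X ^+ 3 + (cq3 C)%:P * 'X ^+ 2 + (cq5 C)%:P * 'X + (cq6 C)%:P).
pose disc : P2 := (((- (4%:R * cc C))%:P%:P * 'X + D0%:P) * 'X + D1%:P) * 'X + D2%:P.
have c4 : (- (4%:R * cc C))%:P%:P != 0 :> P2.
  by rewrite !polyC_eq0 oppr_eq0 mulf_neq0 // pnatr_eq0.
have sd : size disc = 4.
  have h3 : (- (4%:R * cc C))%:P%:P * 'X + D0%:P != 0 :> P2.
    by rewrite -size_poly_eq0 size_MXaddC (negPf c4).
  have h2 : ((- (4%:R * cc C))%:P%:P * 'X + D0%:P) * 'X + D1%:P != 0 :> P2.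
    by rewrite -size_poly_eq0 size_MXaddC (negPf h3).
  rewrite /disc size_MXaddC (negPf h2) /= size_MXaddC (negPf h3) /=.
  by rewrite size_MXaddC (negPf c4) /= size_polyC -polyC_eq0 c4.
have disc0 : disc != 0 by rewrite -size_poly_eq0 sd.
move=> N0; pose ga := 2%:R%:P%:P * al + be * Ppoly.
have e : ga * ga = be * be * disc.
  apply/eqP; rewrite -subr_eq0; apply/eqP; apply: (@ev_eq0 _ [::]) => x y _.
  have := congr1 (ev x y) N0; rewrite ev_norm ev0 => n0.
  rewrite !(ev_Ppoly, evD, evN, evM, evC, evX) !hornE.
  have -> : 0 = 4%:R * 0 :> K by rewrite mulr0.
  rewrite -n0 /Plin /Qcub; ring.
have [b0|b0] := eqVneq be 0.
  split=> //; apply/eqP; have /eqP : ga * ga = 0 by rewrite e b0 !mul0r.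
  rewrite mulf_eq0 orbb /ga b0 mul0r addr0 mulf_eq0 !polyC_eq0 pnatr_eq0 /=.
  by [].
have g0 : ga != 0.
  by apply/eqP => z; move/esym/eqP: e; rewrite z mul0r !mulf_eq0 (negPf b0) (negPf disc0).
have := congr1 (fun p : P2 => size p) e.
rewrite size_sqr // (size_mul (mulf_neq0 b0 b0) disc0) size_sqr // sd.
have : (0 < size be)%N by rewrite size_poly_gt0.
have : (0 < size ga)%N by rewrite size_poly_gt0.
case: (size be) (size ga) => // m [] // n _ _.
rewrite !doubleS /= addn4 /= => /(congr1 odd).
by rewrite /= !odd_double.
Qed.

(** The product of the values at the two points over (x, y) is the norm, which
    therefore vanishes outside a finite set. *)
Lemma normal_form_eq0 (l : seq (K * K)) al be :
  (forall x y z, (x, y) \notin l -> on_cubic x y z -> ev x y al + ev x y be * z = 0) ->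
  al = 0 /\ be = 0.
Proof.
move=> h; apply: norm_eq0; apply: (@ev_eq0 _ l) => x y xyl.
have [z S] := on_cubic_ex x y.
by rewrite (norm_factor _ _ S) h // mul0r.
Qed.

Lemma cone1 x y z : on_cubic x y z -> cone C (vec4 x y z 1).
Proof.
move=> /on_cubicP h; split=> //; apply/eqP => /rowP/(_ I3).
by rewrite vec4E mxE => /eqP; rewrite oner_eq0.
Qed.

Definition affine_pt x y z (S : on_cubic x y z) : X := pt (cone1 S).

Lemma open_basis (A : set X) v (hv : cone C v) : zopen A -> A (pt hv) ->
  exists s, peval s v != 0 /\ forall w (hw : cone C w), peval s w != 0 -> A (pt hw).
Proof.
move=> oA Av; have [s [sv hs]] := zopen_sub_affine (A := cone C) (a := SigSub (mem_set hv)) oA Av.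
exists s; rewrite set_valE in sv; split=> // w hw sw.
by apply: (hs (SigSub (mem_set hw))); rewrite set_valE.
Qed.

(** The affine cubic is dense: the surface leaves the plane at infinity in
    every neighbourhood of each of its points there. *)
Lemma open_meets_affine (A : set X) : zopen A -> A !=set0 ->
  exists x y z (S : on_cubic x y z), A (affine_pt S).
Proof.
move=> oA [p Ap]; pose v := hc p; have hv : cone C v by exact: hc_cone.
have e0 : pt hv = p by exact: pt_hc.
have [s [sv hs]] : exists s, peval s v != 0 /\
    forall w (hw : cone C w), peval s w != 0 -> A (pt hw).
  by apply: (open_basis (hv := hv)) => //; rewrite e0.
suff [w [hw [Aw w3]]] : exists w (hw : cone C w), A (pt hw) /\ w 0 I3 != 0.
  pose u := (w 0 I3)^-1 *: w.
  have S : on_cubic (u 0 I0) (u 0 I1) (u 0 I2).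
    apply/on_cubicP; have <- : u = vec4 (u 0 I0) (u 0 I1) (u 0 I2) 1.
      by rewrite [LHS]vec4_eta; congr vec4; rewrite mxE mulVf.
    by rewrite peval_cubicZ hw.2 mulr0.
  exists (u 0 I0), (u 0 I1), (u 0 I2), S.
  suff -> : affine_pt S = pt hw by [].
  have [k k0 ek] := hc_pt hw; apply: (@pt_eq _ _ _ _ _ (k * w 0 I3)).
  have <- : u = vec4 (u 0 I0) (u 0 I1) (u 0 I2) 1.
    by rewrite [LHS]vec4_eta; congr vec4; rewrite mxE mulVf.
  by rewrite ek -scalerA; congr (_ *: _); rewrite /u scalerA mulfV // scale1r.
have [v3|v3] := eqVneq (v 0 I3) 0; last first.
  by exists v, hv; rewrite e0.
(* the added coordinate runs along the x-axis at the node (0:0:1:0), and along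
   the z-axis elsewhere *)
have [d [q [hq q0 q1]]] : exists (d : 'rV[K]_4) (q : {poly K}), [/\
    forall t, peval (cubic_poly C) (v + t *: d) = q.[t], q != 0 & d 0 I3 = 0].
  have [v0|v0] := eqVneq (v 0 I0) 0.
    exists (vec4 1 0 0 0), ((cc C)%:P * 'X ^+ 3 + (- (v 0 I2 * v 0 I1))%:P * 'X + (ca C * v 0 I1 ^+ 3)%:P).
    split; last by rewrite vec4E.
      move=> t; rewrite peval_cubic !mxE /= /cubic_form v0 v3 !hornE; ring.
    apply/eqP => /(congr1 (fun p : {poly K} => p`_3)).
    by rewrite !coefD !coefCM coefXn coefX coefC coef0 /= mulr1 mulr0 !addr0 => /eqP; rewrite (negPf c0).
  exists (vec4 0 0 1 0), ((- (v 0 I0 * v 0 I1))%:P * 'X + (cc C * v 0 I0 ^+ 3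
    + ca C * v 0 I1 ^+ 3 - v 0 I2 * (v 0 I0 * v 0 I1))%:P).
  split; last by rewrite vec4E.
    move=> t; rewrite peval_cubic !mxE /= /cubic_form v3 !hornE; ring.
  apply/eqP => e; have e1 := congr1 (horner^~ 0) e; have e2 := congr1 (horner^~ 1) e.
  move: e1 e2; rewrite /= !hornE !(mulr0, mulr1) add0r => -> /eqP.
  rewrite !addr0 oppr_eq0 mulf_eq0 (negPf v0) /= => /eqP v1.
  have := congr1 (horner^~ 0) e.
  rewrite /= !hornE v1 !mulr0 expr0n /= mulr0 !(addr0, add0r) subr0 => /eqP.
  by rewrite mulf_eq0 expf_eq0 (negPf c0) (negPf v0).
pose h i : P2 := (v 0 i)%:P%:P + 'X * (d 0 i)%:P%:P + ('X%:P * ((i == I3)%:R)%:P%:P).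
pose m t s := \row_i (v 0 i + t * d 0 i + s * (i == I3)%:R) : 'rV[K]_4.
have evh t s' : \row_i ev t s' (h i) = m t s'.
  by apply/rowP => i; rewrite !mxE !evE.
have [f hf] := ev_subst (cubic_poly C) h; have [g hg] := ev_subst s h.
have m0 t : m t 0 = v + t *: d by apply/rowP => i; rewrite !mxE mul0r addr0.
have [] := @curve_leaves_line _ f g 0.
- by rewrite hf evh m0 scale0r addr0 hv.2.
- apply: contra_neq q0 => e; apply: (@poly_eq0_off _ [::]) => t _.
  by rewrite -hq -m0 -evh -hf /ev e horner0.
- by rewrite hg evh m0 scale0r addr0.
move=> t [s' [s0]]; rewrite hf hg !evh => fm gm.
have m3 : m t s' 0 I3 = s' by rewrite mxE v3 q1 eqxx mulr0 !add0r mulr1.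
have hm : cone C (m t s').
  by split=> //; apply/eqP => /rowP/(_ I3); rewrite m3 mxE => /eqP; rewrite (negPf s0).
by exists (m t s'), hm; rewrite m3; split=> //; exact: hs.
Qed.

Lemma open_normal_form (A : set X) : zopen A -> A !=set0 -> exists al be,
  norm al be != 0 /\ forall x y z (S : on_cubic x y z),
    ev x y al + ev x y be * z != 0 -> A (affine_pt S).
Proof.
move=> oA An; have [x [y [z [S AS]]]] := open_meets_affine oA An.
have [s [sv hs]] := open_basis oA AS.
have [al [be h]] := normal_form s; exists al, be; split.
  apply/eqP => /norm_eq0[ea eb]; move/negP: sv; apply.
  by rewrite h // ea eb !ev0 mul0r addr0.
by move=> x' y' z' S'; rewrite -h // => hz; exact: hs.
Qed.

(** Two nonempty open subsets contain the nonvanishing loci of two nonzero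
    norms, so they meet over a common point (x, y). *)
Lemma proj_cubic_irreducible : irreducible_space X.
Proof.
have meet (A B : set X) : zopen A -> zopen B -> A !=set0 -> B !=set0 ->
    exists p, A p /\ B p.
  move=> oA oB An Bn.
  have [al [be [N0 hA]]] := open_normal_form oA An.
  have [al' [be' [N0' hB]]] := open_normal_form oB Bn.
  have [x [y xy]] : exists x y, ev x y (norm al be * norm al' be') != 0.
    apply: contrapT => no; have : norm al be * norm al' be' = 0.
      apply: (@ev_eq0 _ [::]) => x y _; apply/eqP/negPn/negP => h.
      by apply: no; exists x, y.
    by move/eqP; rewrite mulf_eq0 (negPf N0) (negPf N0').
  have [z S] := on_cubic_ex x y; move: xy.
  rewrite evM (norm_factor _ _ S) (norm_factor al' be' S) !mulf_eq0 !negb_or.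
  move=> /andP[/andP[h1 _] /andP[h2 _]].
  by exists (affine_pt S); split; [exact: hA|exact: hB].
split.
  have [z S] := on_cubic_ex 0 0; by exists (affine_pt S).
move=> F G cF cG cov; apply: contrapT => no.
have [FA|FA] := pselect ((~` F) !=set0); last first.
  by apply: no; left=> x _; apply: contrapT => Fx; apply: FA; exists x.
have [GA|GA] := pselect ((~` G) !=set0); last first.
  by apply: no; right=> x _; apply: contrapT => Gx; apply: GA; exists x.
by have [p [Fp Gp]] := meet _ _ cF cG FA GA; have [] := cov p I.
Qed.


(** The plane section at infinity: the nodal cubic x y z = c x^3 + a y^3. *)
Definition infinity_section : set X := [set x | hc x 0 I3 = 0].
Local Notation D := infinity_section.
Local Notation SD := (subspace_wf infinity_section).

Lemma compl_infinity : ~` D = chart I3.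
Proof. by apply/seteqP; split=> x /= /eqP. Qed.

Lemma infinity_closed : zclosed D.
Proof. by rewrite /zclosed compl_infinity; exact: chart_open. Qed.

Lemma SD_ringed : ringed SD.
Proof. exact: subspace_ringed (proj_cubic_ringed C). Qed.

(** The normalisation of the nodal cubic, with parameter u = y / x; it sends
    0 and infinity to the node. *)
Definition nodal_param (u : K) := vec4 u (u ^+ 2) (cc C + ca C * u ^+ 3) 0.

Lemma nodal_param_cone u : cone C (nodal_param u).
Proof.
split; last by rewrite peval_cubic !vec4E /cubic_form; ring.
apply/eqP => e; have /eqP := congr1 (fun v : 'rV_4 => v 0 I0) e.
rewrite vec4E mxE => /eqP u0; have /eqP := congr1 (fun v : 'rV_4 => v 0 I2) e.
by rewrite vec4E mxE u0 expr0n /= mulr0 addr0 (negPf c0).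
Qed.

Lemma pt_infinity v (hv : cone C v) : v 0 I3 = 0 -> D (pt hv).
Proof. by move=> v3; have [k _ e] := hc_pt hv; rewrite /D /= e mxE v3 mulr0. Qed.

Lemma nodal_pt_infinity u : D (pt (nodal_param_cone u)).
Proof. by apply: pt_infinity; rewrite vec4E. Qed.

Definition nodal_pt u : SD := SigSub (mem_set (nodal_pt_infinity u)).

Lemma nodal_ptE u : set_val (nodal_pt u) = pt (nodal_param_cone u).
Proof. by rewrite set_valE. Qed.

Lemma infinity_equation (x : SD) : let v := hc (set_val x) in
  v 0 I0 * v 0 I1 * v 0 I2 = cc C * v 0 I0 ^+ 3 + ca C * v 0 I1 ^+ 3.
Proof.
move=> v; have v3 : v 0 I3 = 0 by exact: (set_valP x).
have [_] := hc_cone (set_val x); rewrite peval_cubic -/v /cubic_form v3 => e.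
by apply/eqP; rewrite eq_sym -subr_eq0 -[X in _ == X]e; apply/eqP; ring.
Qed.

Lemma infinity_y0 (x : SD) :
  (hc (set_val x) 0 I0 == 0) = (hc (set_val x) 0 I1 == 0).
Proof.
have := infinity_equation x => /=; set v := hc _ => e.
apply/eqP/eqP => h; move: e; rewrite h !(mul0r, mulr0) expr0n /= mulr0 ?(addr0, add0r).
  by move/esym/eqP; rewrite mulf_eq0 expf_eq0 (negPf a0) => /eqP.
by move/esym/eqP; rewrite mulf_eq0 expf_eq0 (negPf c0) => /eqP.
Qed.

Lemma nodal_pt_onto (x : SD) : x = nodal_pt (hc (set_val x) 0 I1 / hc (set_val x) 0 I0).
Proof.
apply: set_val_inj; rewrite nodal_ptE; apply/esym.
have := infinity_equation x; have := infinity_y0 x; cbv zeta; set v := hc _.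
have v3 : v 0 I3 = 0 by exact: (set_valP x).
have [x0|x0] := eqVneq (v 0 I0) 0; move=> /esym y0 e.
  apply: (@pt_eq _ _ _ _ _ (v 0 I2 / cc C)); rewrite -/v.
  rewrite [LHS]vec4_eta /nodal_param x0 invr0 mulr0 vec4Z v3 (eqP y0).
  by rewrite expr0n /= !mulr0 expr0n /= mulr0 addr0 divfK.
have y0' : v 0 I1 != 0 by rewrite y0.
apply: (@pt_eq _ _ _ _ _ (v 0 I0 ^+ 2 / v 0 I1)); rewrite -/v.
rewrite [LHS]vec4_eta /nodal_param vec4Z v3 mulr0; congr vec4.
- by field; rewrite x0 y0'.
- by field; rewrite x0 y0'.
have -> : v 0 I2 = (v 0 I0 * v 0 I1 * v 0 I2) / (v 0 I0 * v 0 I1).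
  by field; rewrite x0 y0'.
by rewrite e; field; rewrite x0 y0'.
Qed.

Lemma nodal_open (A : set SD) : zopen A -> A !=set0 ->
  exists q : {poly K}, q != 0 /\ forall u, q.[u] != 0 -> A (nodal_pt u).
Proof.
move=> [A' [oA' eA]] [x Ax]; subst A.
pose u0 := hc (set_val x) 0 I1 / hc (set_val x) 0 I0.
have Ax' : A' (pt (nodal_param_cone u0)).
  by rewrite -nodal_ptE -nodal_pt_onto.
have [s [s0 hs]] := open_basis oA' Ax'.
have [f hf] := ev_subst s (fun i : 'I_4 => nth 0 [:: 'X; 'X ^+ 2;
  (cc C)%:P%:P + (ca C)%:P%:P * 'X ^+ 3; 0] i).
have ef u : ev u 0 f = peval s (nodal_param u).
  rewrite hf; congr peval; rewrite [LHS]vec4_eta !mxE /= ev0.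
  by congr vec4; rewrite !(evXn, evD, evM, evC, evX) ?hornerC.
exists (spec 0 f); split.
  by apply: contraNneq s0 => e; rewrite -ef /ev e horner0.
move=> u hu; rewrite /preimage /mkset nodal_ptE; apply: hs.
by rewrite -ef.
Qed.

Lemma infinity_irreducible : irreducible_space SD.
Proof.
split; first by exists (nodal_pt 0).
move=> F G cF cG cov; apply: contrapT => no.
have [FA|FA] := pselect ((~` F) !=set0); last first.
  by apply: no; left=> x _; apply: contrapT => Fx; apply: FA; exists x.
have [GA|GA] := pselect ((~` G) !=set0); last first.
  by apply: no; right=> x _; apply: contrapT => Gx; apply: GA; exists x.
have [p [p0 hp]] := nodal_open cF FA; have [q [q0 hq]] := nodal_open cG GA.
have [u] : exists u, (p * q).[u] != 0.
  apply: contrapT => nou; have : p * q = 0.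
    by apply: (@poly_eq0_off _ [::]) => u _; apply/eqP/negPn/negP => h; apply: nou; exists u.
  by move/eqP; rewrite mulf_eq0 (negPf p0) (negPf q0).
rewrite hornerM mulf_eq0 negb_or => /andP[/hp Fu /hq Gu].
by have [] := cov (nodal_pt u) I.
Qed.

Lemma infinity_component (S : set SD) : irreducible_component S <-> S = setT.
Proof.
split=> [[_ maxS]|->]; first by rewrite -(maxS setT infinity_irreducible (@subsetT _ S)).
split; first exact: infinity_irreducible.
by move=> S' _ sub; apply/seteqP; split.
Qed.

Definition smooth_infinity : set SD := [set x | hc (set_val x) 0 I0 != 0].
Definition punctured_line : set (affine_space K 1) := [set u : 'rV[K]_1 | u 0 0 != 0].

Lemma smooth_infinity_open : zopen smooth_infinity.
Proof. by exists (chart I0); split; first exact: chart_open. Qed.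

Lemma punctured_line_open : zopen punctured_line.
Proof.
rewrite (_ : punctured_line = [set u | peval (@mpolyX 1 K (mnm1 0)) u != 0]).
  exact: zopen_nonzero.
by apply/seteqP; split=> u; rewrite /punctured_line /= pevalX.
Qed.

Lemma smooth_infinity_param u : u != 0 -> smooth_infinity (nodal_pt u).
Proof.
move=> u0; rewrite /smooth_infinity /mkset nodal_ptE.
have [k k0 ->] := hc_pt (nodal_param_cone u); rewrite mxE vec4E; exact: mulf_neq0.
Qed.

Lemma smooth_infinity_slope (x : subspace_wf smooth_infinity) :
  punctured_line (const_mx (ratio I1 I0 (set_val (set_val x))) : 'rV[K]_1).
Proof.
have x0 : smooth_infinity (set_val x) by exact: set_valP.
rewrite /punctured_line /= mxE mulf_neq0 ?invr_eq0 //.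
by rewrite -(infinity_y0 (set_val x)).
Qed.

Definition slope_map : subspace_wf smooth_infinity ->
  @subspace_wf K (affine_space K 1) punctured_line :=
  fun x => SigSub (mem_set (smooth_infinity_slope x)).

Lemma slope_mapE x : set_val (slope_map x) =
  const_mx (ratio I1 I0 (set_val (set_val x))) :> 'rV[K]_1.
Proof. by rewrite set_valE. Qed.

Lemma slope_map_iso : isomorphism slope_map.
Proof.
have rS := subspace_ringed smooth_infinity SD_ringed.
have rG := subspace_ringed punctured_line (affine_ringed K 1).
split.
  apply: into_zero_locus_morphism => // i.
  have r1 := @ratio_greg K C I1 I0 _ (@subset_refl _ (chart I0)).
  have m1 := morphism_comp (@set_val_morphism _ SD smooth_infinity)
    (@set_val_morphism _ X D).
  have h1 (x : subspace_wf smooth_infinity) :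
      chart I0 (((set_val : SD -> X) \o (set_val : subspace_wf smooth_infinity -> SD)) x).
    exact: (set_valP x).
  have m2 := corestr_morphism h1 (ringed_axioms rS) m1.
  have aC := ringed_axioms (subspace_ringed (chart I0) (proj_cubic_ringed C)).
  apply: (greg_eq (morphism_greg aC m2 r1)) => x.
  transitivity (ratio I1 I0 (set_val (set_val x))).
    by congr ratio; exact: (corestrK h1).
  by rewrite slope_mapE mxE.
have hu (u : @subspace_wf K (affine_space K 1) punctured_line) :
    smooth_infinity (nodal_pt ((set_val u : 'rV[K]_1) 0 0)).
  by apply: smooth_infinity_param; exact: (set_valP u).
exists (corestr hu); split.
- apply: corestr_morphism; first exact: (ringed_axioms rG).
  apply: into_subspace_morphism; first exact: (ringed_axioms rG).
  rewrite (_ : _ \o _ = fun u : @subspace_wf K (affine_space K 1) punctured_line =>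
     pt (nodal_param_cone ((set_val u : 'rV[K]_1) 0 0))); last first.
    by apply/funext => u; exact: nodal_ptE.
  have ru : @greg K (@subspace_wf K (affine_space K 1) punctured_line)
      (fun u => (set_val u : 'rV[K]_1) 0 0) by exact: coord_greg.
  apply: pt_morphism => //; apply: ord4P.
  + by apply: (greg_eq ru) => u; rewrite vec4E.
  + by apply: (greg_eq (gregXn rG 2 ru)) => u; rewrite vec4E.
  + apply: (greg_eq (gregD rG (gregC rG (cc C)) (gregM rG (gregC rG (ca C)) (gregXn rG 3 ru)))).
    by move=> u; rewrite vec4E.
  + by apply: (greg_eq (gregC rG 0)) => u; rewrite vec4E.
- move=> x; apply: set_val_inj; rewrite corestrK.
  rewrite [RHS]nodal_pt_onto; congr nodal_pt.
  by rewrite slope_mapE mxE.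
- move=> u; apply: set_val_inj; apply/rowP => i.
  rewrite slope_mapE mxE corestrK nodal_ptE ratio_pr set_valE /=.
  rewrite !mxE /= (ord1 i) expr2 mulfK //.
  exact: (set_valP u).
Qed.

Lemma infinity_rational : rational_curve SD.
Proof.
exists smooth_infinity, punctured_line; split.
- split; first exact: smooth_infinity_open.
  by exists (nodal_pt 1); apply: smooth_infinity_param; exact: oner_neq0.
- split; first exact: punctured_line_open.
  by exists (const_mx 1 : 'rV[K]_1); rewrite /punctured_line /= mxE oner_neq0.
- by exists slope_map; exact: slope_map_iso.
Qed.

Definition infinity_node : SD := nodal_pt 0.

Lemma not_node_smooth (x : SD) : x <> infinity_node -> smooth_infinity x.
Proof.
move=> xn; apply/negP => /eqP x0; apply: xn.
by rewrite [LHS]nodal_pt_onto x0 invr0 mulr0.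
Qed.

Lemma infinity_smooth (x : SD) : x <> infinity_node -> smooth_at 1 x.
Proof.
move=> /not_node_smooth x0; pose x' : subspace_wf smooth_infinity := SigSub (mem_set x0).
exists 0%N, (fun _ => 0), (set_val (slope_map x')); split; last first.
  by apply/eqP; rewrite -leqn0 rank_leq_row.
exists smooth_infinity, punctured_line; split=> //.
- exact: smooth_infinity_open.
- exact: punctured_line_open.
rewrite (_ : _ `&` _ = punctured_line); last first.
  by apply/seteqP; split=> [u []|u hu] //; split=> // p [[]].
exists slope_map; split; first exact: slope_map_iso.
by move=> u eu; congr (set_val (slope_map _)); apply: set_val_inj; rewrite eu set_valE.
Qed.

Lemma infinity_node_unique (x : SD) : node_at x -> x = infinity_node.
Proof.
move=> nx; apply: contrapT => /not_node_smooth x0.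
apply: (node_not_line SD_ringed smooth_infinity_open x0 _ nx).
by exists slope_map; exact: slope_map_iso.
Qed.

End CubicGeometry.

Section CubicSmoothness.
Variables (K : numClosedFieldType) (C : cubic K).
Hypotheses (c0 : cc C != 0) (a0 : ca C != 0).
Local Notation X := (proj_cubic C).
Local Notation D := (@infinity_section K C).
Local Notation SD := (subspace_wf (@infinity_section K C)).
Local Notation node0 := (@infinity_node K C c0).

Lemma peval0 n (v : 'rV[K]_n) : peval 0 v = 0. Proof. exact: meval0. Qed.
Lemma peval_bool n (b : bool) (v : 'rV[K]_n) : peval (b%:R : mpoly n K) v = b%:R.
Proof. by case: b; [exact: peval1|exact: peval0]. Qed.

Lemma mderiv_cubic_z (v : 'rV[K]_4) : v 0 I3 = 0 ->
  peval (mderiv I2 (cubic_poly C)) v = - (v 0 I0 * v 0 I1).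
Proof.
move=> w0; rewrite /cubic_poly !exprS !expr0 !mulr1.
rewrite !(mderivD, mderivB, mderivN, mderivM, mderivC, mderiv_var) !(peval0, peval_bool, pevalB, pevalN, pevalE) /= w0; ring.
Qed.

Lemma mderiv_cubic_w (v : 'rV[K]_4) : v 0 I0 = 0 -> v 0 I1 = 0 -> v 0 I3 = 0 ->
  peval (mderiv I3 (cubic_poly C)) v = v 0 I2 ^+ 2.
Proof.
move=> x0 y0 w0; rewrite /cubic_poly !exprS !expr0 !mulr1.
rewrite !(mderivD, mderivB, mderivN, mderivM, mderivC, mderiv_var) !(peval0, peval_bool, pevalB, pevalN, pevalE) /= x0 y0 w0; ring.
Qed.

(** The equations v_i = 1 and the cubic cut out the chart in affine 4-space;
    their differentials are independent as soon as that of the cubic is not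
    proportional to dv_i. *)
Lemma smooth_chart i j (x : X) : chart i x -> i != j ->
  peval (mderiv j (cubic_poly C)) (to_affine i x) != 0 -> smooth_at 2 x.
Proof.
move=> xi ij dj; pose x' : subspace_wf (chart i) := SigSub (mem_set xi).
pose f (k : 'I_2) : mpoly (2 + 2) K :=
  if k == J0 then @mpolyX 4 K (mnm1 i) - 1 else cubic_poly C.
exists 2%N, f, (to_affine i x); split; last first.
  apply/eqP; rewrite -[_ == _]/(row_free _); apply/row_freeP.
  pose d := peval (mderiv j (cubic_poly C)) (to_affine i x).
  pose e := peval (mderiv i (cubic_poly C)) (to_affine i x).
  exists (\matrix_(l, k) if k == J0 then (l == i)%:R - (l == j)%:R * (e / d)
                         else (l == j)%:R / d).
  have df0 l : peval (mderiv l (f J0)) (to_affine i x) = (l == i)%:R.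
    by rewrite /f /= mderivB -(mpolyC1 4 K) mderivC subr0 mderiv_var peval_bool.
  have sum1 (F : 'I_4 -> K) (l0 : 'I_4) : \sum_l F l * (l == l0)%:R = F l0.
    rewrite (bigD1 l0) //= eqxx mulr1 big1 ?addr0 // => l /negPf ->.
    by rewrite mulr0.
  have ji : (j == i) = false by rewrite eq_sym (negPf ij).
  apply/matrixP => k k'; rewrite !mxE.
  under eq_bigr => l _ do rewrite !mxE.
  move: k'; apply: ord2P; move: k; apply: ord2P => /=.
  - rewrite (eq_bigr (fun l => ((l == i)%:R - (l == j)%:R * (e / d)) * (l == i)%:R)).
      by rewrite sum1 eqxx eq_sym ji mul0r subr0.
    by move=> l _; rewrite df0 mulrC.
  - rewrite (eq_bigr (fun l => peval (mderiv l (cubic_poly C)) (to_affine i x) * (l == i)%:R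
      - peval (mderiv l (cubic_poly C)) (to_affine i x) * (e / d) * (l == j)%:R)).
      rewrite sumrB !sum1 -/d -/e; field; exact: dj.
    by move=> l _; rewrite mulrBr; congr (_ - _); rewrite -mulrA (mulrC (e / d)).
  - rewrite (eq_bigr (fun l => (l == j)%:R / d * (l == i)%:R)).
      by rewrite sum1 eq_sym ji mul0r.
    by move=> l _; rewrite df0 mulrC.
  - rewrite (eq_bigr (fun l => peval (mderiv l (cubic_poly C)) (to_affine i x) / d * (l == j)%:R)).
      by rewrite sum1 mulfV.
    by move=> l _; rewrite -mulrA (mulrC _ (_ == _)%:R).
exists (chart i), setT; split=> //; [exact: chart_open|exact: zopenT (affine_axioms K 4)|].
rewrite (_ : _ `&` _ = affine_chart C i); last first.
  apply/seteqP; split=> [v [hv _]|v [vi hv]].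
    split; last by apply: (hv (cubic_poly C)); exists J1.
    have := hv (f J0) (ex_intro2 _ _ J0 I erefl).
    by rewrite /f /= pevalB pevalX peval1 => /eqP; rewrite subr_eq0 => /eqP.
  split=> // _ [k _ <-]; move: k; apply: ord2P; last exact: hv.
  by rewrite /f /= pevalB pevalX peval1 vi subrr.
exists (@chart_map K C i); split; first exact: chart_iso.
by move=> u eu; rewrite chart_mapE eu.
Qed.

(** On the plane w = 0 the partial derivative along z is - x y, which vanishes
    only at the node of the section, where the one along w does not. *)
Lemma cubic_smooth_at_infinity (x : X) : D x -> smooth_at 2 x.
Proof.
move=> Dx; pose x' : SD := SigSub (mem_set Dx).
have ex : set_val x' = x by rewrite set_valE.
have x3 : hc x 0 I3 = 0 by [].
have [/eqP x0|x0] := boolP (hc x 0 I0 == 0).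
  have x1 : hc x 0 I1 = 0.
    by apply/eqP; have := infinity_y0 c0 a0 x'; rewrite ex x0 eqxx => <-.
  have x2 : hc x 0 I2 != 0.
    have := hc_neq0 x; apply: contraNneq => x2; apply/eqP/rowP => i.
    by rewrite mxE; move: i; apply: ord4P.
  apply: (@smooth_chart I2 I3) => //.
  by rewrite mderiv_cubic_w !mxE ?x0 ?x1 ?x3 ?mulr0 // mulVf // expr1n oner_eq0.
have x1 : hc x 0 I1 != 0 by have := infinity_y0 c0 a0 x'; rewrite ex => <-.
apply: (@smooth_chart I0 I2) => //.
rewrite mderiv_cubic_z !mxE ?x3 ?mulr0 // oppr_eq0.
by rewrite !mulf_neq0 ?invr_eq0.
Qed.

Definition node_poly : mpoly 2 K :=
  mpolyC 2 (cc C) * @mpolyX 2 K (mnm1 J0) ^+ 3 + mpolyC 2 (ca C) * @mpolyX 2 K (mnm1 J1) ^+ 3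
  - @mpolyX 2 K (mnm1 J0) * @mpolyX 2 K (mnm1 J1).

Lemma peval_node (v : 'rV[K]_2) : peval node_poly v =
  cc C * v 0 J0 ^+ 3 + ca C * v 0 J1 ^+ 3 - v 0 J0 * v 0 J1.
Proof. by rewrite /node_poly !(pevalB, pevalE). Qed.

Definition node_curve : set (affine_space K 2) := [set v : 'rV[K]_2 | peval node_poly v = 0].
Definition node_chart : set SD := [set x | hc (set_val x) 0 I2 != 0].

Definition node_coord (x : X) : 'rV[K]_2 :=
  \row_i (if i == J0 then ratio I0 I2 x else ratio I1 I2 x).

Lemma node_coord_curve (x : subspace_wf node_chart) :
  node_curve (node_coord (set_val (set_val x))).
Proof.
have x2 : hc (set_val (set_val x)) 0 I2 != 0 by exact: (set_valP x).
have := infinity_equation (set_val x); cbv zeta; set v := hc _ in x2 * => e.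
rewrite /node_curve /mkset peval_node !mxE /= /ratio -/v.
have -> : cc C * (v 0 I0 / v 0 I2) ^+ 3 + ca C * (v 0 I1 / v 0 I2) ^+ 3
  - v 0 I0 / v 0 I2 * (v 0 I1 / v 0 I2) =
  (cc C * v 0 I0 ^+ 3 + ca C * v 0 I1 ^+ 3 - v 0 I0 * v 0 I1 * v 0 I2) / v 0 I2 ^+ 3 by field.
by rewrite e subrr mul0r.
Qed.

Definition node_map : subspace_wf node_chart -> @subspace_wf K (affine_space K 2) node_curve :=
  fun x => SigSub (mem_set (node_coord_curve x)).

Lemma node_mapE x : set_val (node_map x) = node_coord (set_val (set_val x)).
Proof. by rewrite set_valE. Qed.

Lemma node_map_iso : isomorphism node_map.
Proof.
have rS := subspace_ringed node_chart (SD_ringed C).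
have rN := subspace_ringed node_curve (affine_ringed K 2).
split.
  have m1 := morphism_comp (@set_val_morphism _ SD node_chart)
    (@set_val_morphism _ X D).
  have h1 (x : subspace_wf node_chart) :
      chart I2 (((set_val : SD -> X) \o (set_val : subspace_wf node_chart -> SD)) x).
    exact: (set_valP x).
  have m2 := corestr_morphism h1 (ringed_axioms rS) m1.
  have aC := ringed_axioms (subspace_ringed (chart I2) (proj_cubic_ringed C)).
  have r j : greg (fun x : subspace_wf node_chart => ratio j I2 (set_val (set_val x))).
    apply: (greg_eq (morphism_greg aC m2 (@ratio_greg K C j I2 _ (@subset_refl _ (chart I2))))).
    by move=> x; congr ratio; exact: (corestrK h1).
  apply: into_zero_locus_morphism => //; apply: ord2P.
    by apply: (greg_eq (r I0)) => x; rewrite node_mapE mxE.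
  by apply: (greg_eq (r I1)) => x; rewrite node_mapE mxE.
pose w (v : @subspace_wf K (affine_space K 2) node_curve) : 'rV[K]_4 :=
  vec4 ((set_val v : 'rV[K]_2) 0 J0) ((set_val v : 'rV[K]_2) 0 J1) 1 0.
have hw v : cone C (w v).
  split; first by apply/eqP => /rowP/(_ I2); rewrite vec4E mxE => /eqP; rewrite oner_eq0.
  have := set_valP v; rewrite /node_curve /mkset peval_node => e.
  by rewrite peval_cubic !vec4E /cubic_form -[RHS]e set_valE; ring.
have hD v : D (pt (hw v)) by apply: pt_infinity; rewrite vec4E.
have hN v : node_chart (corestr hD v).
  rewrite /node_chart /mkset corestrK.
  have [k k0 ->] := hc_pt (hw v); rewrite mxE vec4E mulr1; exact: k0.
exists (corestr hN); split.
- apply: corestr_morphism; first exact: (ringed_axioms rN).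
  apply: corestr_morphism; first exact: (ringed_axioms rN).
  apply: pt_morphism => //; apply: ord4P.
  + by apply: (greg_eq (@coord_greg K 2 node_curve J0)) => v; rewrite vec4E.
  + by apply: (greg_eq (@coord_greg K 2 node_curve J1)) => v; rewrite vec4E.
  + by apply: (greg_eq (gregC rN 1)) => v; rewrite vec4E.
  + by apply: (greg_eq (gregC rN 0)) => v; rewrite vec4E.
- move=> x; apply: set_val_inj; apply: set_val_inj; rewrite (corestrK hN) (corestrK hD).
  have x2 : hc (set_val (set_val x)) 0 I2 != 0 by exact: (set_valP x).
  have x3 : hc (set_val (set_val x)) 0 I3 = 0 by exact: (set_valP (set_val x)).
  apply: (@pt_eq _ _ _ _ _ (hc (set_val (set_val x)) 0 I2)).
  rewrite [LHS]vec4_eta x3 /w node_mapE !mxE /= vec4Z mulr0 mulr1 /ratio.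
  by congr vec4; rewrite mulrC divfK.
- move=> v; apply: set_val_inj; rewrite node_mapE (corestrK hN) (corestrK hD).
  apply/rowP; apply: ord2P; rewrite mxE /=.
    by rewrite ratio_pr set_valE /= !mxE /= divr1.
  by rewrite ratio_pr set_valE /= !mxE /= divr1.
Qed.

Lemma infinity_node_at : node_at node0.
Proof.
have n0 : node_chart node0.
  rewrite /node_chart /mkset nodal_ptE.
  have [k k0 ->] := hc_pt (nodal_param_cone c0 0).
  by rewrite mxE vec4E expr0n /= mulr0 addr0 mulf_neq0.
have nz : node_coord (set_val node0) = 0.
  apply/rowP; apply: ord2P; rewrite !mxE /= nodal_ptE ratio_pr set_valE /=.
    by rewrite !mxE /= mul0r.
  by rewrite !mxE /= expr0n mul0r.
exists node_poly, 0; split.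
- exists node_chart, setT; split=> //.
  + by exists (chart I2); split; first exact: chart_open.
  + exact: zopenT (affine_axioms K 2).
  rewrite (_ : _ `&` _ = node_curve); last first.
    apply/seteqP; split=> [v [hv _]|v hv]; first exact: hv.
    by split=> // _ ->.
  exists node_map; split; first exact: node_map_iso.
  by move=> u eu; rewrite node_mapE eu.
- move=> j; rewrite /node_poly !exprS !expr0 !mulr1.
  rewrite !(mderivD, mderivB, mderivN, mderivM, mderivC, mderiv_var).
  by rewrite !(peval0, peval_bool, pevalB, pevalN, pevalE) !mxE; ring.
rewrite det2 !mxE /node_poly !exprS !expr0 !mulr1.
have mb i (b : bool) : mderiv i (b%:R : mpoly 2 K) = 0.
  by case: b; rewrite ?raddf0 // -(mpolyC1 2 K) mderivC.
rewrite !(mderivD, mderivB, mderivN, mderivM, mderivC, mderiv_var, mb).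
rewrite !(peval0, peval_bool, pevalB, pevalN, pevalE) !mxE /=.
rewrite !(mul0r, mulr0, addr0, add0r, sub0r, oppr0, mulr1, mul1r).
by rewrite mulrNN mul1r oppr_eq0 oner_eq0.
Qed.

Lemma infinity_type_I1 : type_I1 SD.
Proof.
split; [exact: infinity_irreducible|exact: infinity_rational|].
exists node0; split; first exact: infinity_node_at.
by move=> x; exact: infinity_smooth.
Qed.

End CubicSmoothness.

(** * Pairs of 3 x 3 matrices *)

Section Matrices3.
Variable R : comPzRingType.

Definition L0 : 'I_3 := Ordinal (isT : 0 < 3)%N.
Definition L1 : 'I_3 := Ordinal (isT : 1 < 3)%N.
Definition L2 : 'I_3 := Ordinal (isT : 2 < 3)%N.

Lemma ord3P (P : 'I_3 -> Prop) : P L0 -> P L1 -> P L2 -> forall i, P i.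
Proof.
move=> h0 h1 h2 [[|[|[|//]]] hi].
- by rewrite (_ : Ordinal hi = L0) //; apply: val_inj.
- by rewrite (_ : Ordinal hi = L1) //; apply: val_inj.
- by rewrite (_ : Ordinal hi = L2) //; apply: val_inj.
Qed.

Lemma sum3 (V : nmodType) (F : 'I_3 -> V) : \sum_i F i = F L0 + F L1 + F L2.
Proof.
pose f k := F (inord k); have E i : F i = f (val i) by rewrite /f inord_val.
by rewrite (eq_bigr _ (fun i _ => E i)) !big_ord_recl big_ord0 addr0 addrA !E.
Qed.

Lemma prod3 (F : 'I_3 -> R) : \prod_i F i = F L0 * F L1 * F L2.
Proof.
pose f k := F (inord k); have E i : F i = f (val i) by rewrite /f inord_val.
by rewrite (eq_bigr _ (fun i _ => E i)) !big_ord_recl big_ord0 mulr1 mulrA !E.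
Qed.

Definition mx3 a00 a01 a02 a10 a11 a12 a20 a21 a22 : 'M[R]_3 :=
  \matrix_(i, j) nth 0 (nth [::] [:: [:: a00; a01; a02]; [:: a10; a11; a12];
                                      [:: a20; a21; a22]] i) j.

Lemma mx3_eta (M : 'M[R]_3) : M = mx3 (M L0 L0) (M L0 L1) (M L0 L2)
  (M L1 L0) (M L1 L1) (M L1 L2) (M L2 L0) (M L2 L1) (M L2 L2).
Proof. by apply/matrixP; do 2!apply: ord3P; rewrite mxE. Qed.

Lemma mx3_mul a00 a01 a02 a10 a11 a12 a20 a21 a22 b00 b01 b02 b10 b11 b12 b20 b21 b22 :
  mx3 a00 a01 a02 a10 a11 a12 a20 a21 a22 *m mx3 b00 b01 b02 b10 b11 b12 b20 b21 b22 =
  mx3 (a00 * b00 + a01 * b10 + a02 * b20) (a00 * b01 + a01 * b11 + a02 * b21)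
      (a00 * b02 + a01 * b12 + a02 * b22) (a10 * b00 + a11 * b10 + a12 * b20)
      (a10 * b01 + a11 * b11 + a12 * b21) (a10 * b02 + a11 * b12 + a12 * b22)
      (a20 * b00 + a21 * b10 + a22 * b20) (a20 * b01 + a21 * b11 + a22 * b21)
      (a20 * b02 + a21 * b12 + a22 * b22).
Proof. by apply/matrixP; do 2!apply: ord3P; rewrite !mxE sum3 !mxE. Qed.

Lemma det3 (M : 'M[R]_3) :
  \det M = M L0 L0 * (M L1 L1 * M L2 L2 - M L1 L2 * M L2 L1)
         - M L0 L1 * (M L1 L0 * M L2 L2 - M L1 L2 * M L2 L0)
         + M L0 L2 * (M L1 L0 * M L2 L1 - M L1 L1 * M L2 L0).
Proof.
pose m a b := M (inord a) (inord b).
have E i j : M i j = m (val i) (val j) by rewrite /m !inord_val.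
rewrite (expand_det_row _ L0) !big_ord_recl big_ord0 /cofactor !det2 !mxE !E /=.
rewrite /bump /= addr0; ring.
Qed.

Lemma adj3 a00 a01 a02 a10 a11 a12 a20 a21 a22 :
  \adj (mx3 a00 a01 a02 a10 a11 a12 a20 a21 a22) =
  mx3 (a11 * a22 - a12 * a21) (a02 * a21 - a01 * a22) (a01 * a12 - a02 * a11)
      (a12 * a20 - a10 * a22) (a00 * a22 - a02 * a20) (a02 * a10 - a00 * a12)
      (a10 * a21 - a11 * a20) (a01 * a20 - a00 * a21) (a00 * a11 - a01 * a10).
Proof.
by apply/matrixP; do 2!apply: ord3P; rewrite !mxE /cofactor det2 !mxE /=; ring.
Qed.

Definition minor2 (M : 'M[R]_3) := M L0 L0 * M L1 L1 - M L0 L1 * M L1 L0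
  + (M L0 L0 * M L2 L2 - M L0 L2 * M L2 L0) + (M L1 L1 * M L2 L2 - M L1 L2 * M L2 L1).

Definition e1 (f : 'I_3 -> R) := f L0 + f L1 + f L2.
Definition e2 (f : 'I_3 -> R) := f L0 * f L1 + f L0 * f L2 + f L1 * f L2.
Definition e3 (f : 'I_3 -> R) := f L0 * f L1 * f L2.

End Matrices3.

Section Eigenvalues3.
Variable K : fieldType.

Lemma char_poly3 (M : 'M[K]_3) : char_poly M =
  'X^3 - (\tr M)%:P * 'X^2 + (minor2 M)%:P * 'X - (\det M)%:P.
Proof.
rewrite /char_poly !det3 /mxtrace sum3 /minor2 /char_poly_mx !mxE /= !mulr1n !mulr0n.
rewrite !(polyCD, polyCN, polyCM, polyCB) !sub0r; ring.
Qed.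

Lemma prod_XsubC3 (f : 'I_3 -> K) : \prod_i ('X - (f i)%:P) =
  'X^3 - (e1 f)%:P * 'X^2 + (e2 f)%:P * 'X - (e3 f)%:P.
Proof.
rewrite prod3 /e1 /e2 /e3 !(polyCD, polyCM); ring.
Qed.

Lemma has_eigenvalues3 (M : 'M[K]_3) f : has_eigenvalues M f <->
  [/\ \tr M = e1 f, minor2 M = e2 f & \det M = e3 f].
Proof.
rewrite /has_eigenvalues char_poly3 prod_XsubC3; split=> [e|[-> -> ->] //].
have co (a b c : K) : [/\ ('X^3 - a%:P * 'X^2 + b%:P * 'X - c%:P)`_2 = - a,
    ('X^3 - a%:P * 'X^2 + b%:P * 'X - c%:P)`_1 = b &
    ('X^3 - a%:P * 'X^2 + b%:P * 'X - c%:P)`_0 = - c].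
  split; rewrite !(coefD, coefN, coefCM, coefXn, coefX, coefC) /=;
    by rewrite ?(mulr0, mulr1, subr0, addr0, oppr0, add0r, sub0r).
have [a2 a1 a0] := co (\tr M) (minor2 M) (\det M).
have [b2 b1 b0] := co (e1 f) (e2 f) (e3 f).
rewrite e in a2 a1 a0.
by split; [apply: oppr_inj; rewrite -a2 b2|rewrite -a1 b1|apply: oppr_inj; rewrite -a0 b0].
Qed.

Lemma charpoly_conj n (g A : 'M[K]_n) : g \in unitmx ->
  char_poly (g *m A *m invmx g) = char_poly A.
Proof.
move=> gu; rewrite /char_poly /char_poly_mx.
pose G : 'M[{poly K}]_n := map_mx polyC g; pose G' : 'M[{poly K}]_n := map_mx polyC (invmx g).
have GG : G *m G' = 1%:M by rewrite -map_mxM mulmxV // map_mx1.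
have -> : 'X%:M - map_mx polyC (g *m A *m invmx g) = G *m ('X%:M - map_mx polyC A) *m G'.
  rewrite !map_mxM mulmxBr mulmxBl; congr (_ - _).
  by rewrite scalar_mxC -mulmxA GG mulmx1.
by rewrite !det_mulmx mulrAC -det_mulmx GG det1 mul1r.
Qed.

(** The row i of the base change is an eigenvector for l_i. *)
Lemma diagonalize3 (A : 'M[K]_3) (l : 'I_3 -> K) : injective l ->
  has_eigenvalues A l -> exists2 g, g \in unitmx &
    g *m A *m invmx g = mx3 (l L0) 0 0 0 (l L1) 0 0 0 (l L2).
Proof.
move=> linj hA; pose D := mx3 (l L0) 0 0 0 (l L1) 0 0 0 (l L2).
have /choice[v hv] : forall i, exists v : 'rV[K]_3, v *m A = l i *: v /\ v != 0.
  move=> i; have : eigenvalue A (l i).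
    rewrite eigenvalue_root_char hA; apply/rootP; rewrite horner_prod.
    by apply/eqP/prodf_eq0; exists i => //; rewrite hornerXsubC subrr.
  by move/eigenvalueP => [w e w0]; exists w.
pose g : 'M[K]_3 := \matrix_i v i.
have rg i : row i g = v i by rewrite rowK.
have gA : g *m A = D *m g.
  apply/row_matrixP => i; rewrite row_mul rg (hv i).1.
  rewrite row_mul; apply/rowP => j; rewrite !mxE sum3 !mxE; move: i.
  by apply: ord3P; rewrite /= !(mul0r, addr0, add0r).
suff gu : g \in unitmx by exists g => //; rewrite gA mulmxK.
rewrite -row_free_unit -kermx_eq0; apply/negPn/negP => /rowV0Pn[w /sub_kermxP wg w0].
have step (w' : 'rV[K]_3) : w' *m g = 0 -> (w' *m D) *m g = 0.
  by move=> e; rewrite -mulmxA -gA mulmxA e mul0mx.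
have w1 := step _ wg; have w2 := step _ w1.
have lij i j : i != j -> l i - l j != 0.
  by move=> ij; rewrite subr_eq0 (inj_eq linj).
have wE (w' : 'rV[K]_3) : w' *m g = w' 0 L0 *: v L0 + w' 0 L1 *: v L1 + w' 0 L2 *: v L2.
  by rewrite mulmx_sum_row sum3 !rg.
have wD (w' : 'rV[K]_3) : [/\ (w' *m D) 0 L0 = w' 0 L0 * l L0,
   (w' *m D) 0 L1 = w' 0 L1 * l L1 & (w' *m D) 0 L2 = w' 0 L2 * l L2].
  by split; rewrite mxE sum3 !mxE /= !(mulr0, addr0, add0r).
have kill i : v i != 0 -> forall k : K, k *: v i = 0 -> k = 0.
  by move=> vi k /eqP; rewrite scaler_eq0 (negPf vi) orbF => /eqP.
have comb i j k : i != j -> i != k -> (w *m g = w 0 i *: v i + w 0 j *: v j + w 0 k *: v k) ->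
   (w *m D *m g = (w 0 i * l i) *: v i + (w 0 j * l j) *: v j + (w 0 k * l k) *: v k) ->
   (w *m D *m D *m g = (w 0 i * l i * l i) *: v i + (w 0 j * l j * l j) *: v j
     + (w 0 k * l k * l k) *: v k) -> w 0 i = 0.
  move=> ij ik h0 h1 h2.
  have e : (w 0 i * (l i - l j) * (l i - l k)) *: v i = 0.
    transitivity (w *m D *m D *m g - (l j + l k) *: (w *m D *m g) + (l j * l k) *: (w *m g)).
      rewrite h0 h1 h2; apply/rowP => c; rewrite !mxE; ring.
    by rewrite wg w1 w2 !scaler0 subr0 addr0.
  have := kill i (hv i).2 _ e => /eqP.
  by rewrite !mulf_eq0 (negPf (lij _ _ ij)) (negPf (lij _ _ ik)) !orbF => /eqP.
have [d0 d1 d2] := wD w; have [d0' d1' d2'] := wD (w *m D).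
have h0 := wE w; have h1 := wE (w *m D); have h2 := wE (w *m D *m D).
rewrite d0' d1' d2' in h2; rewrite d0 d1 d2 in h1 h2.
case/negP: w0; apply/eqP/rowP; apply: ord3P; rewrite [RHS]mxE.
- exact: (comb L0 L1 L2).
- by apply: (comb L1 L0 L2) => //; rewrite ?h0 ?h1 ?h2 (addrC (_ *: v L0)).
- apply: (comb L2 L1 L0) => //; rewrite ?h0 ?h1 ?h2;
  by rewrite -[RHS]addrA [RHS]addrC (addrC (_ *: v L1)).
Qed.

End Eigenvalues3.

Section FrickeCubic.
Variable K : closedFieldType.

(** The relation between the traces of adj A B, A adj B and A B adj A adj B,
    where a_i and c_i are the elementary symmetric functions of the eigenvalues
    of A and B, and s, t those of degree 1 and 2 of the eigenvalues of A B. *)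
Definition fricke (a1 a2 a3 c1 c2 c3 s t : K) : cubic K := Cubic
    (- (a1 * c2))
    (- (a2 * c1))
    (s * t + a3 * c1 * c2 + a1 * a2 * c3 + a1 * a2 * c1 * c2 - 3%:R * a3 *
    c3 - a2 * c2 * s - a1 * c1 * t)
    (c3)
    (a3)
    (c2 * t + a1 * c3 * s - 2%:R * a2 * c1 * c3)
    (s * t + a3 * c1 * c2 + a1 * a2 * c3 - 6%:R * a3 * c3)
    (a3 * c1 * s + a2 * t - 2%:R * a1 * a3 * c2)
    (c1 * t ^+ 2 + a3 * c2 ^+ 2 * s + a2 * c3 * s ^+ 2 + a2 ^+ 2 * c2 * c3 +
    a2 ^+ 2 * c1 ^+ 2 * c3 + 3%:R * a1 * a3 * c2 * c3 + a1 * a3 * c1 ^+ 2 * c3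
    + a1 ^+ 2 * c3 * t - 3%:R * a3 * c1 * c3 * s - 3%:R * a2 * c3 * t - a2 *
    c1 * c2 * t - a1 * a3 * c1 * c2 ^+ 2 - a1 * a2 * c1 * c3 * s - a1 ^+ 2 *
    a2 * c2 * c3)
    (a3 * c2 * s ^+ 2 + a3 * c1 ^+ 2 * t + a2 * a3 * c2 ^+ 2 + 3%:R * a2 *
    a3 * c1 * c3 + a2 ^+ 2 * c3 * s + a1 * t ^+ 2 + a1 ^+ 2 * a3 * c2 ^+ 2 +
    a1 ^+ 2 * a3 * c1 * c3 - 3%:R * a3 * c2 * t - a2 * a3 * c1 ^+ 2 * c2 -
    3%:R * a1 * a3 * c3 * s - a1 * a3 * c1 * c2 * s - a1 * a2 * c2 * t - a1 *
    a2 ^+ 2 * c1 * c3)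
    (t ^+ 3 + a3 * c3 * s ^+ 3 + a3 * c1 * c2 * s * t + 9%:R * a3 ^+ 2 * c3
    ^+ 2 + a3 ^+ 2 * c2 ^+ 3 + a3 ^+ 2 * c1 ^+ 3 * c3 + 3%:R * a2 * a3 * c2 *
    c3 * s + a2 * a3 * c1 ^+ 2 * c3 * s + a2 ^+ 2 * c2 ^+ 2 * t + a2 ^+ 2 * c1
    * c3 * t + a2 ^+ 3 * c3 ^+ 2 + a1 * a3 * c2 ^+ 2 * t + 3%:R * a1 * a3 * c1
    * c3 * t + a1 * a2 * c3 * s * t + a1 * a2 * a3 * c1 * c2 * c3 + a1 * a2 *
    a3 * c1 ^+ 2 * c2 ^+ 2 + a1 ^+ 2 * a3 * c2 * c3 * s + a1 ^+ 2 * a3 * c1 ^+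
    2 * c3 * s + a1 ^+ 2 * a2 ^+ 2 * c1 * c2 * c3 + a1 ^+ 3 * a3 * c3 ^+ 2 -
    6%:R * a3 * c3 * s * t - 6%:R * a3 ^+ 2 * c1 * c2 * c3 - 2%:R * a2 * c2 *
    t ^+ 2 - a2 * a3 * c1 * c2 ^+ 2 * s - a2 ^+ 3 * c1 * c2 * c3 - 2%:R * a1 *
    a3 * c1 * c3 * s ^+ 2 - a1 * a3 * c1 ^+ 2 * c2 * t - 6%:R * a1 * a2 * a3 *
    c3 ^+ 2 - a1 * a2 * a3 * c2 ^+ 3 - a1 * a2 * a3 * c1 ^+ 3 * c3 - a1 * a2
    ^+ 2 * c2 * c3 * s - a1 ^+ 2 * a2 * c1 * c3 * t - a1 ^+ 3 * a3 * c1 * c2 *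
    c3).

(** Let A be the diagonal matrix with entries l_i and B have the diagonal b_i,
    the products p_ij of opposite entries and the two 3-cycles q and r: the
    torus invariants of B, subject to q r = p01 p02 p12, which the equation of
    the cubic restates. The m_i are the principal 2 x 2 minors of B. *)
Lemma fricke_identity (l0 l1 l2 b0 b1 b2 m0 m1 m2 q r : K) :
  let p01 := b0 * b1 - m2 in let p02 := b0 * b2 - m1 in let p12 := b1 * b2 - m0 in
  let a3 := l0 * l1 * l2 in
  let c3 := b0 * b1 * b2 + q + r - b0 * p12 - b1 * p02 - b2 * p01 in
  let s := l0 * b0 + l1 * b1 + l2 * b2 in
  let t := l1 * l2 * m0 + l0 * l2 * m1 + l0 * l1 * m2 in
  let x := l1 * l2 * b0 + l0 * l2 * b1 + l0 * l1 * b2 in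
  let y := l0 * m0 + l1 * m1 + l2 * m2 in
  let al := l0 ^+ 2 * l2 + l1 ^+ 2 * l0 + l2 ^+ 2 * l1 in
  let al' := l0 ^+ 2 * l1 + l1 ^+ 2 * l2 + l2 ^+ 2 * l0 in
  let z := a3 * (b0 * m0 + b1 * m1 + b2 * m2) - l2 * (l0 ^+ 2 + l1 ^+ 2) * p01 * b2
    - l1 * (l0 ^+ 2 + l2 ^+ 2) * p02 * b1 - l0 * (l1 ^+ 2 + l2 ^+ 2) * p12 * b0
    + al * q + al' * r in
  let C := fricke (l0 + l1 + l2) (l0 * l1 + l0 * l2 + l1 * l2) a3 (b0 + b1 + b2)
    (m0 + m1 + m2) c3 s t in
  z ^+ 2 - Plin C x y * z + Qcub C x y = (al - al') ^+ 2 * (p01 * p02 * p12 - q * r).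
Proof. by cbv zeta; rewrite /Plin /Qcub /fricke /=; ring. Qed.

End FrickeCubic.

(** * The character variety is an open subset of the affine cubic *)

Section Conjugation.
Variable K : fieldType.
Implicit Types A B g : 'M[K]_3.

Lemma irreducible_conj A B g : g \in unitmx -> irreducible_rep A B ->
  irreducible_rep (g *m A *m invmx g) (g *m B *m invmx g).
Proof.
move=> gu irr U sA sB; pose h := invmx g^T.
have gtu : g^T \in unitmx by rewrite unitmx_tr.
have hu : h \in unitmx by rewrite unitmx_inv.
have tr M : (g *m M *m invmx g)^T = h *m M^T *m g^T.
  by rewrite !trmx_mul trmx_inv mulmxA.
have st M : stablemx U (g *m M *m invmx g)^T -> stablemx (U *m h) M^T.
  rewrite tr !mulmxA => hM.
  have := submxMr h hM; rewrite -[X in (X <= _)%MS]mulmxA -/h mulmxV //.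
  by rewrite mulmx1.
have [U0|Uf] := irr _ (st _ sA) (st _ sB).
  by left; rewrite -(mulmxK hu U) U0 mul0mx.
right; have /row_fullP[W eW] := Uf.
apply/row_fullP; exists (h *m W); rewrite -mulmxA.
have -> : W *m U = invmx h by rewrite -[LHS](mulmxK hu) -[W *m U *m h]mulmxA eW mul1mx.
by rewrite mulmxV.
Qed.

Lemma adj_conj A g : A \in unitmx -> g \in unitmx ->
  \adj (g *m A *m invmx g) = g *m \adj A *m invmx g.
Proof.
move=> Au gu; have adjE M : M \in unitmx -> \adj M = \det M *: invmx M.
  move=> Mu; rewrite -[LHS]mulmx1 -(mulmxV Mu) mulmxA mul_adj_mx.
  by rewrite mul_scalar_mx.
have gAu : g *m A *m invmx g \in unitmx by rewrite !unitmx_mul gu Au unitmx_inv.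
rewrite !adjE // !det_mulmx mulrAC -det_mulmx mulmxV // det1 mul1r.
rewrite -scalemxAr -scalemxAl; congr (_ *: _).
apply: (can_inj (mulKmx gAu)); rewrite mulmxV // !mulmxA mulmxKV // mulmxK //.
by rewrite mulmxV.
Qed.

Lemma trace_conj A g : g \in unitmx -> \tr (g *m A *m invmx g) = \tr A.
Proof. by move=> gu; rewrite mxtrace_mulC mulKmx. Qed.

Definition inv_x A B := \tr (\adj A *m B).
Definition inv_y A B := \tr (A *m \adj B).
Definition inv_z A B := \tr (A *m B *m (\adj A *m \adj B)).

Lemma inv_conj A B g : A \in unitmx -> B \in unitmx -> g \in unitmx ->
  let A' := g *m A *m invmx g in let B' := g *m B *m invmx g in
  [/\ inv_x A' B' = inv_x A B, inv_y A' B' = inv_y A B & inv_z A' B' = inv_z A B].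
Proof.
move=> Au Bu gu A' B'; rewrite /inv_x /inv_y /inv_z !adj_conj //.
have mulJ M N : g *m M *m invmx g *m (g *m N *m invmx g) = g *m (M *m N) *m invmx g.
  by rewrite !mulmxA mulmxKV.
by rewrite !mulJ !trace_conj.
Qed.

End Conjugation.

Section DiagonalReps.
Variables (K : fieldType) (l : 'I_3 -> K).
Hypothesis linj : injective l.
Local Notation Lam := (mx3 (l L0) 0 0 0 (l L1) 0 0 0 (l L2)).

Lemma row_diag (w : 'rV[K]_3) i : (w *m Lam^T) 0 i = w 0 i * l i.
Proof.
by rewrite mxE sum3 !mxE; move: i; apply: ord3P; rewrite /= !(mulr0, addr0, add0r).
Qed.

(** Projecting a vector of the subspace on an eigenline of the diagonal matrix. *)
Lemma stable_unit (U : 'M[K]_3) (w : 'rV[K]_3) i : stablemx U Lam^T -> (w <= U)%MS ->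
  w 0 i != 0 -> ((delta_mx 0 i : 'rV[K]_3) <= U)%MS.
Proof.
move=> sU wU wi.
have st (v : 'rV[K]_3) : (v <= U)%MS -> (v *m Lam^T <= U)%MS.
  by move=> vU; apply: submx_trans (submxMr _ vU) sU.
have step (v : 'rV[K]_3) j : (v <= U)%MS -> (v *m Lam^T - l j *: v <= U)%MS.
  by move=> vU; rewrite addmx_sub ?st // -scaleNr scalemx_sub.
have stepE (v : 'rV[K]_3) j k : (v *m Lam^T - l j *: v) 0 k = v 0 k * (l k - l j).
  by rewrite mxE row_diag !mxE; ring.
have lij j k : j != k -> l j - l k != 0 by move=> jk; rewrite subr_eq0 (inj_eq linj).
suff fin j k : i != j -> i != k -> (forall h, [\/ h = i, h = j | h = k]) ->
    ((delta_mx 0 i : 'rV[K]_3) <= U)%MS.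
  by move: i wi fin; apply: ord3P => wi fin;
    [apply: (fin L1 L2)|apply: (fin L0 L2)|apply: (fin L0 L1)] => //; apply: ord3P;
    by [constructor 1|constructor 2|constructor 3].
move=> ij ik cov; pose v := (w *m Lam^T - l j *: w) *m Lam^T - l k *: (w *m Lam^T - l j *: w).
have vU : (v <= U)%MS by do 2!apply: (step).
pose c := w 0 i * (l i - l j) * (l i - l k).
have c0 : c != 0 by rewrite !mulf_neq0 ?lij.
suff -> : delta_mx 0 i = c^-1 *: v by exact: scalemx_sub.
apply/rowP => h; rewrite mxE [RHS]mxE [v _ _]stepE stepE eqxx /=.
have [->|->|->] := cov h.
- by rewrite eqxx -/c mulVf.
- by rewrite eq_sym (negPf ij) subrr mulr0 mul0r mulr0.
- by rewrite eq_sym (negPf ik) subrr !mulr0.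
Qed.

(** No set of one or two coordinates is stable under B. *)
Definition connected3 (B : 'M[K]_3) : bool :=
  [&& (B L1 L0 != 0) || (B L2 L0 != 0), (B L0 L1 != 0) || (B L2 L1 != 0),
      (B L0 L2 != 0) || (B L1 L2 != 0), (B L2 L0 != 0) || (B L2 L1 != 0),
      (B L1 L0 != 0) || (B L1 L2 != 0) & (B L0 L1 != 0) || (B L0 L2 != 0)].

(** A nonzero subrepresentation contains a coordinate vector, and B leads from
    it to all others. *)
Lemma connected_irreducible B : connected3 B -> irreducible_rep Lam B.
Proof.
move=> hB U sU sB; have [->|U0] := eqVneq U 0; first by left.
right; pose u i := ((delta_mx 0 i : 'rV[K]_3) <= U)%MS.
have su i j : u i -> B j i != 0 -> u j.
  move=> iU bji; apply: (stable_unit (w := row i B^T)) => //; last by rewrite !mxE.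
  by rewrite rowE; apply: submx_trans (submxMr _ iU) sB.
have [i ui] : exists i, u i.
  have /rowV0Pn[w wU w0] := U0.
  have [i wi] : exists i, w 0 i != 0.
    apply: contrapT => /forallNP no; case/negP: w0; apply/eqP/rowP => i.
    by rewrite mxE; apply/eqP/negPn/negP; exact: no.
  by exists i; exact: (stable_unit (w := w)).
have all3 : [&& u L0, u L1 & u L2].
  have s01 := @su L0 L1; have s02 := @su L0 L2; have s10 := @su L1 L0.
  have s12 := @su L1 L2; have s20 := @su L2 L0; have s21 := @su L2 L1.
  have : [|| u L0, u L1 | u L2] by move: i ui; apply: ord3P => ->; rewrite ?orbT.
  move: hB s01 s02 s10 s12 s20 s21; rewrite /connected3.
  move: (u L0) (u L1) (u L2) (B L1 L0 != 0) (B L2 L0 != 0) (B L0 L1 != 0)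
    (B L2 L1 != 0) (B L0 L2 != 0) (B L1 L2 != 0).
  by do 9!case=> //=; intuition.
rewrite -sub1mx; apply/row_subP => k; rewrite row1.
by move/and3P: all3 => [? ? ?]; move: k; apply: ord3P.
Qed.

(** A set of coordinates that the entries of B do not leave spans a
    subrepresentation. *)
Lemma irreducible_leaves B (I : pred 'I_3) i0 j0 : I i0 -> ~~ I j0 ->
  irreducible_rep Lam B -> exists i j, [/\ I i, ~~ I j & B j i != 0].
Proof.
move=> Ii0 Ij0 irr; apply: contrapT => no.
pose U : 'M[K]_3 := diag_mx (\row_i (I i)%:R).
have UE (M : 'M[K]_3) i j : (U *m M) i j = (I i)%:R * M i j by rewrite mul_diag_mx !mxE.
have st (M : 'M[K]_3) : (forall i j, I i -> ~~ I j -> M j i = 0) -> stablemx U M^T.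
  move=> hM; suff -> : U *m M^T = (U *m M^T) *m U by exact: submxMl.
  apply/matrixP => i j; rewrite mul_mx_diag [RHS]mxE !UE !mxE.
  case: (boolP (I i)) => Ii; last by rewrite !mul0r.
  by case: (boolP (I j)) => Ij; rewrite ?mulr1 // hM // !mulr0 ?mul0r.
have sL : stablemx U Lam^T.
  apply: st => i j Ii Ij; have ij : j != i by apply: contraNneq Ij => ->.
  by move: j i ij {Ii Ij}; do 2!apply: ord3P => //; rewrite mxE.
have sB : stablemx U B^T.
  apply: st => i j Ii Ij; apply/eqP/negPn/negP => bji.
  by apply: no; exists i, j.
have [U0|/row_fullP[W]] := irr U sL sB.
  have := congr1 (fun M : 'M[K]_3 => M i0 i0) U0; rewrite !mxE eqxx Ii0 mulr1n => /eqP.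
  by rewrite oner_eq0.
move/(congr1 (fun M : 'M[K]_3 => M j0 j0)); rewrite mul_mx_diag !mxE eqxx (negPf Ij0) mulr0.
by move/esym/eqP; rewrite oner_eq0.
Qed.

Lemma irreducible_connected B : irreducible_rep Lam B -> connected3 B.
Proof.
move=> irr; have other (k : 'I_3) : exists j, j != k.
  by move: k; apply: ord3P; [exists L1|exists L0|exists L0].
have col k : exists j, j != k /\ B j k != 0.
  have [j jk] := other k.
  have [|//|i [j' [/= /eqP -> jk' b]]] := @irreducible_leaves B (pred1 k) k j _ _ irr.
    exact: eqxx.
  by exists j'.
have row k : exists j, j != k /\ B k j != 0.
  have [j jk] := other k.
  have [//||i [j' [/= ik /negPn/eqP -> b]]] := @irreducible_leaves B (predC1 k) j k _ _ irr.
    by rewrite /= eqxx.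
  by exists i.
have [c0 h0] := col L0; have [c1 h1] := col L1; have [c2 h2] := col L2.
have [r0 k0] := row L0; have [r1 k1] := row L1; have [r2 k2] := row L2.
rewrite /connected3; apply/and5P; split; last (apply/andP; split).
- by move: c0 h0; apply: ord3P => -[// _ ->]; rewrite ?orbT.
- by move: c1 h1; apply: ord3P => -[// _ ->]; rewrite ?orbT.
- by move: c2 h2; apply: ord3P => -[// _ ->]; rewrite ?orbT.
- by move: r2 k2; apply: ord3P => -[// _ ->]; rewrite ?orbT.
- by move: r1 k1; apply: ord3P => -[// _ ->]; rewrite ?orbT.
- by move: r0 k0; apply: ord3P => -[// _ ->]; rewrite ?orbT.
Qed.

(** In terms of the monomials in the entries that the torus fixes. *)
Definition in_charts (p01 p02 p12 q r : K) : bool :=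
  [|| q != 0, r != 0, p01 * p12 != 0, p02 * p12 != 0 | p01 * p02 != 0].

Lemma connected_charts B : connected3 B =
  in_charts (B L0 L1 * B L1 L0) (B L0 L2 * B L2 L0) (B L1 L2 * B L2 L1)
            (B L0 L1 * B L1 L2 * B L2 L0) (B L0 L2 * B L2 L1 * B L1 L0).
Proof.
rewrite /connected3 /in_charts !mulf_eq0.
move: (B L1 L0 == 0) (B L2 L0 == 0) (B L0 L1 == 0) (B L2 L1 == 0) (B L0 L2 == 0)
  (B L1 L2 == 0).
by do 6!case.
Qed.

End DiagonalReps.

Section TorusData.
Variable K : numClosedFieldType.
Variables (lambda mu nu : 'I_3 -> K).
Hypotheses (lam0 : forall i, lambda i != 0) (mu0 : forall i, mu i != 0).
Hypothesis linj : injective lambda.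
Hypothesis det_rel : e3 nu = e3 lambda * e3 mu.
Local Notation l0 := (lambda L0).
Local Notation l1 := (lambda L1).
Local Notation l2 := (lambda L2).
Local Notation Lam := (mx3 l0 0 0 0 l1 0 0 0 l2).

Definition rep_cubic : cubic K := fricke (e1 lambda) (e2 lambda) (e3 lambda)
  (e1 mu) (e2 mu) (e3 mu) (e1 nu) (e2 nu).

(** The solution of sum d_i = c, sum l_i d_i = s, sum l_j l_k d_i = x. *)
Definition solve (c s x : K) (i : 'I_3) : K :=
  (x + lambda i * s - lambda i * (e1 lambda - lambda i) * c) /
  (3%:R * lambda i ^+ 2 - 2%:R * e1 lambda * lambda i + e2 lambda).

Lemma l01 : l0 - l1 != 0. Proof. by rewrite subr_eq0 (inj_eq linj). Qed.
Lemma l02 : l0 - l2 != 0. Proof. by rewrite subr_eq0 (inj_eq linj). Qed.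
Lemma l12 : l1 - l2 != 0. Proof. by rewrite subr_eq0 (inj_eq linj). Qed.

Lemma solve_denominator : [/\
  3%:R * l0 ^+ 2 - 2%:R * e1 lambda * l0 + e2 lambda = (l0 - l1) * (l0 - l2),
  3%:R * l1 ^+ 2 - 2%:R * e1 lambda * l1 + e2 lambda = - ((l0 - l1) * (l1 - l2)) &
  3%:R * l2 ^+ 2 - 2%:R * e1 lambda * l2 + e2 lambda = (l0 - l2) * (l1 - l2)].
Proof. by split; rewrite /e1 /e2; ring. Qed.

Lemma solveP c s x : let d := solve c s x in [/\ d L0 + d L1 + d L2 = c,
  l0 * d L0 + l1 * d L1 + l2 * d L2 = s &
  l1 * l2 * d L0 + l0 * l2 * d L1 + l0 * l1 * d L2 = x].
Proof.
have [h0 h1 h2] := solve_denominator.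
have n01 := l01; have n02 := l02; have n12 := l12.
rewrite /solve h0 h1 h2 /e1; split; field; by rewrite n01 n02 n12.
Qed.

Lemma solve_unique c s x d0 d1 d2 : d0 + d1 + d2 = c -> l0 * d0 + l1 * d1 + l2 * d2 = s ->
  l1 * l2 * d0 + l0 * l2 * d1 + l0 * l1 * d2 = x ->
  [/\ solve c s x L0 = d0, solve c s x L1 = d1 & solve c s x L2 = d2].
Proof.
move=> <- <- <-; have [h0 h1 h2] := solve_denominator.
have n01 := l01; have n02 := l02; have n12 := l12.
by rewrite /solve h0 h1 h2 /e1; split; field; rewrite ?n01 ?n02 ?n12.
Qed.

Section Coordinates.
Variables x y z : K.

(** The diagonal entries of B and its complementary principal minors are linear
    in x, resp. y, when A is diagonal. *)
Definition bd := solve (e1 mu) (e1 nu) x.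
Definition md := solve (e2 mu) y (e2 nu).
Definition p01 := bd L0 * bd L1 - md L2.
Definition p02 := bd L0 * bd L2 - md L1.
Definition p12 := bd L1 * bd L2 - md L0.
Definition qr_sum := e3 mu - bd L0 * bd L1 * bd L2 + bd L0 * p12 + bd L1 * p02 + bd L2 * p01.
Definition al := l0 ^+ 2 * l2 + l1 ^+ 2 * l0 + l2 ^+ 2 * l1.
Definition al' := l0 ^+ 2 * l1 + l1 ^+ 2 * l2 + l2 ^+ 2 * l0.
Definition zsym := e3 lambda * (bd L0 * md L0 + bd L1 * md L1 + bd L2 * md L2)
  - l2 * (l0 ^+ 2 + l1 ^+ 2) * p01 * bd L2 - l1 * (l0 ^+ 2 + l2 ^+ 2) * p02 * bd L1
  - l0 * (l1 ^+ 2 + l2 ^+ 2) * p12 * bd L0.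
Definition qd := (z - zsym - al' * qr_sum) / (al - al').
Definition rd := qr_sum - qd.

Lemma al_neq : al - al' != 0.
Proof.
have -> : al - al' = - ((l0 - l1) * (l0 - l2) * (l1 - l2)).
  by rewrite /al /al'; ring.
by rewrite oppr_eq0 !mulf_neq0 ?l01 ?l02 ?l12.
Qed.

Lemma zE : z = zsym + al * qd + al' * rd.
Proof. by rewrite /rd /qd; field; exact: al_neq. Qed.

Lemma on_cubic_qr : on_cubic rep_cubic x y z <-> qd * rd = p01 * p02 * p12.
Proof.
have [hb1 hb2 hb3] := solveP (e1 mu) (e1 nu) x; rewrite -/bd in hb1 hb2 hb3.
have [hm1 hm2 hm3] := solveP (e2 mu) y (e2 nu); rewrite -/md in hm1 hm2 hm3.
have c3E : bd L0 * bd L1 * bd L2 + qd + rd - bd L0 * p12 - bd L1 * p02 - bd L2 * p01 = e3 mu.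
  by rewrite /rd /qr_sum; ring.
have zz := zE; have := fricke_identity l0 l1 l2 (bd L0) (bd L1) (bd L2)
  (md L0) (md L1) (md L2) qd rd.
cbv zeta; rewrite -/p01 -/p02 -/p12 c3E hb1 hb2 hb3 hm1 hm2 hm3 -/al -/al' -/(e3 lambda).
rewrite -/zsym -zz -/(e1 lambda) -/(e2 lambda) -/rep_cubic /on_cubic => ->.
split=> [/eqP|->]; last by rewrite subrr mulr0.
by rewrite mulf_eq0 expf_eq0 (negPf al_neq) /= subr_eq0 => /eqP.
Qed.

Definition has_data (B : 'M[K]_3) :=
  [/\ [/\ B L0 L0 = bd L0, B L1 L1 = bd L1 & B L2 L2 = bd L2],
      [/\ B L0 L1 * B L1 L0 = p01, B L0 L2 * B L2 L0 = p02 & B L1 L2 * B L2 L1 = p12],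
      B L0 L1 * B L1 L2 * B L2 L0 = qd & B L0 L2 * B L2 L1 * B L1 L0 = rd].

End Coordinates.

Definition generic_pt x y z := in_charts (p01 x y) (p02 x y) (p12 x y) (qd x y z) (rd x y z).

Lemma det_data (B : 'M[K]_3) : \det B = B L0 L0 * B L1 L1 * B L2 L2
  + B L0 L1 * B L1 L2 * B L2 L0 + B L0 L2 * B L2 L1 * B L1 L0
  - B L0 L0 * (B L1 L2 * B L2 L1) - B L1 L1 * (B L0 L2 * B L2 L0)
  - B L2 L2 * (B L0 L1 * B L1 L0).
Proof. rewrite det3; ring. Qed.

Lemma Lam_mul (B : 'M[K]_3) : Lam *m B = mx3 (l0 * B L0 L0) (l0 * B L0 L1) (l0 * B L0 L2)
  (l1 * B L1 L0) (l1 * B L1 L1) (l1 * B L1 L2) (l2 * B L2 L0) (l2 * B L2 L1) (l2 * B L2 L2).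
Proof. by rewrite {1}[B]mx3_eta mx3_mul; congr mx3; rewrite !mul0r ?add0r ?addr0. Qed.

Lemma inv_diag (B : 'M[K]_3) : [/\
  inv_x Lam B = l1 * l2 * B L0 L0 + l0 * l2 * B L1 L1 + l0 * l1 * B L2 L2,
  inv_y Lam B = l0 * (B L1 L1 * B L2 L2 - B L1 L2 * B L2 L1)
    + l1 * (B L0 L0 * B L2 L2 - B L0 L2 * B L2 L0)
    + l2 * (B L0 L0 * B L1 L1 - B L0 L1 * B L1 L0) &
  inv_z Lam B = l0 * l1 * l2 * (B L0 L0 * (B L1 L1 * B L2 L2 - B L1 L2 * B L2 L1)
     + B L1 L1 * (B L0 L0 * B L2 L2 - B L0 L2 * B L2 L0)
     + B L2 L2 * (B L0 L0 * B L1 L1 - B L0 L1 * B L1 L0))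
   - l2 * (l0 ^+ 2 + l1 ^+ 2) * (B L0 L1 * B L1 L0) * B L2 L2
   - l1 * (l0 ^+ 2 + l2 ^+ 2) * (B L0 L2 * B L2 L0) * B L1 L1
   - l0 * (l1 ^+ 2 + l2 ^+ 2) * (B L1 L2 * B L2 L1) * B L0 L0
   + al * (B L0 L1 * B L1 L2 * B L2 L0) + al' * (B L0 L2 * B L2 L1 * B L1 L0)].
Proof.
move: (mx3_eta B); move: (B L0 L0) (B L0 L1) (B L0 L2) (B L1 L0) (B L1 L1) (B L1 L2)
  (B L2 L0) (B L2 L1) (B L2 L2) => b00 b01 b02 b10 b11 b12 b20 b21 b22 ->.
rewrite /inv_x /inv_y /inv_z !adj3 !mx3_mul /mxtrace !sum3 !mxE /= /al /al'.
by split; ring.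
Qed.

Lemma data_eigenvalues x y z (B : 'M[K]_3) : has_data x y z B ->
  has_eigenvalues B mu /\ has_eigenvalues (Lam *m B) nu.
Proof.
move=> [[b0 b1 b2] [h01 h02 h12] hq hr].
have [hb1 hb2 _] := solveP (e1 mu) (e1 nu) x; rewrite -/(bd x) in hb1 hb2.
have [hm1 _ hm3] := solveP (e2 mu) y (e2 nu); rewrite -/(md y) in hm1 hm3.
have hd : \det B = e3 mu.
  by rewrite det_data b0 b1 b2 h01 h02 h12 hq hr /rd /qr_sum; ring.
split; apply/has_eigenvalues3; split.
- by rewrite /mxtrace sum3 b0 b1 b2.
- by rewrite /minor2 b0 b1 b2 h01 h02 h12 -hm1 /p01 /p02 /p12; ring.
- exact: hd.
- by rewrite Lam_mul /mxtrace sum3 !mxE /= b0 b1 b2.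
- rewrite Lam_mul /minor2 !mxE /=.
  transitivity (l0 * l1 * (B L0 L0 * B L1 L1 - B L0 L1 * B L1 L0)
    + l0 * l2 * (B L0 L0 * B L2 L2 - B L0 L2 * B L2 L0)
    + l1 * l2 * (B L1 L1 * B L2 L2 - B L1 L2 * B L2 L1)); first by ring.
  by rewrite b0 b1 b2 h01 h02 h12 -hm3 /p01 /p02 /p12; ring.
- by rewrite det_mulmx hd det_rel det3 !mxE /= /e3; congr (_ * _); ring.
Qed.

Lemma data_invariants x y z (B : 'M[K]_3) : has_data x y z B ->
  [/\ inv_x Lam B = x, inv_y Lam B = y & inv_z Lam B = z].
Proof.
move=> [[b0 b1 b2] [h01 h02 h12] hq hr]; have [-> -> ->] := inv_diag B.
have [_ _ hb] := solveP (e1 mu) (e1 nu) x; rewrite -/(bd x) in hb.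
have [_ hm _] := solveP (e2 mu) y (e2 nu); rewrite -/(md y) in hm.
rewrite b0 b1 b2 h01 h02 h12 hq hr; split; first exact: hb.
  by rewrite -[RHS]hm /p01 /p02 /p12; ring.
by rewrite [RHS](zE x y z) /zsym /e3 /p01 /p02 /p12; ring.
Qed.

Lemma data_of_rep (B : 'M[K]_3) : has_eigenvalues B mu -> has_eigenvalues (Lam *m B) nu ->
  has_data (inv_x Lam B) (inv_y Lam B) (inv_z Lam B) B.
Proof.
move=> /has_eigenvalues3[t1 t2 t3] /has_eigenvalues3[s1 s2 s3].
have [ex ey ez] := inv_diag B.
rewrite /mxtrace sum3 in t1; rewrite Lam_mul /mxtrace sum3 !mxE /= in s1.
rewrite Lam_mul /minor2 !mxE /= in s2.
have [b0 b1 b2] := solve_unique t1 s1 (esym ex).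
pose m0 := B L1 L1 * B L2 L2 - B L1 L2 * B L2 L1.
pose m1 := B L0 L0 * B L2 L2 - B L0 L2 * B L2 L0.
pose m2 := B L0 L0 * B L1 L1 - B L0 L1 * B L1 L0.
have [d0 d1 d2] : [/\ solve (e2 mu) (inv_y Lam B) (e2 nu) L0 = m0,
    solve (e2 mu) (inv_y Lam B) (e2 nu) L1 = m1 & solve (e2 mu) (inv_y Lam B) (e2 nu) L2 = m2].
  apply: solve_unique; rewrite /m0 /m1 /m2.
  - by rewrite -t2 /minor2; ring.
  - by rewrite ey.
  - by rewrite -s2; ring.
rewrite -/(bd _) in b0 b1 b2; rewrite -/(md _) in d0 d1 d2.
have h01 : B L0 L1 * B L1 L0 = p01 (inv_x Lam B) (inv_y Lam B).
  by rewrite /p01 b0 b1 d2 /m2; ring.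
have h02 : B L0 L2 * B L2 L0 = p02 (inv_x Lam B) (inv_y Lam B).
  by rewrite /p02 b0 b2 d1 /m1; ring.
have h12 : B L1 L2 * B L2 L1 = p12 (inv_x Lam B) (inv_y Lam B).
  by rewrite /p12 b1 b2 d0 /m0; ring.
have hqr : B L0 L1 * B L1 L2 * B L2 L0 + B L0 L2 * B L2 L1 * B L1 L0 =
    qr_sum (inv_x Lam B) (inv_y Lam B).
  by rewrite /qr_sum b0 b1 b2 -h01 -h02 -h12 -t3 det_data; ring.
have hq : B L0 L1 * B L1 L2 * B L2 L0 = qd (inv_x Lam B) (inv_y Lam B) (inv_z Lam B).
  apply: (mulfI al_neq); rewrite /qd [RHS]mulrC divfK ?al_neq // ez -hqr.
  by rewrite /zsym b0 b1 b2 d0 d1 d2 -h01 -h02 -h12 /m0 /m1 /m2 /e3; ring.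
split=> //; by rewrite /rd -hq -hqr addrC addKr.
Qed.

Definition mk_rep (A B : 'M[K]_3) : 'rV[K]_(3 * (3 + 3)) := mxvec (row_mx A B).

Lemma rep_a_mk A B : rep_a (mk_rep A B) = A.
Proof. by rewrite /rep_a /mk_rep mxvecK row_mxKl. Qed.
Lemma rep_b_mk A B : rep_b (mk_rep A B) = B.
Proof. by rewrite /rep_b /mk_rep mxvecK row_mxKr. Qed.

Definition rep_conj (v w : 'rV[K]_(3 * (3 + 3))) := exists2 g : 'M[K]_3, g \in unitmx &
  rep_a w = g *m rep_a v *m invmx g /\ rep_b w = g *m rep_b v *m invmx g.

Lemma rep_conj_refl v : rep_conj v v.
Proof. by exists 1%:M; rewrite ?unitmx1 // invmx1 !mulmx1 !mul1mx. Qed.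
Lemma rep_conj_sym v w : rep_conj v w -> rep_conj w v.
Proof.
move=> [g gu [ea eb]]; exists (invmx g); first by rewrite unitmx_inv.
by rewrite ea eb invmxK !mulmxA mulVmx // !mul1mx !mulmxKV.
Qed.
Lemma rep_conj_trans u v w : rep_conj u v -> rep_conj v w -> rep_conj u w.
Proof.
move=> [g gu [ea eb]] [h hu [ha hb]]; exists (h *m g); first by rewrite unitmx_mul hu.
have e : invmx (h *m g) = invmx g *m invmx h.
  have hgu : h *m g \in unitmx by rewrite unitmx_mul hu.
  by apply: (can_inj (mulKmx hgu)); rewrite mulmxV // !mulmxA mulmxK // mulmxV.
by rewrite ha hb ea eb e !mulmxA.
Qed.

Definition rep_x (v : 'rV[K]_(3 * (3 + 3))) := inv_x (rep_a v) (rep_b v).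
Definition rep_y (v : 'rV[K]_(3 * (3 + 3))) := inv_y (rep_a v) (rep_b v).
Definition rep_z (v : 'rV[K]_(3 * (3 + 3))) := inv_z (rep_a v) (rep_b v).

Lemma rep_conj_inv v w : rep_a v \in unitmx -> rep_b v \in unitmx -> rep_conj v w ->
  [/\ rep_x w = rep_x v, rep_y w = rep_y v & rep_z w = rep_z v].
Proof.
move=> Au Bu [g gu [ea eb]]; rewrite /rep_x /rep_y /rep_z ea eb.
exact: inv_conj.
Qed.

Lemma det_neq0_unit n (M : 'M[K]_n) : (M \in unitmx) = (\det M != 0).
Proof. by rewrite unitmxE unitfE. Qed.

Lemma e3_neq0 (f : 'I_3 -> K) : (forall i, f i != 0) -> e3 f != 0.
Proof. by move=> f0; rewrite /e3 !mulf_neq0. Qed.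

Lemma Lam_unit : Lam \in unitmx.
Proof.
rewrite det_neq0_unit (_ : \det _ = e3 lambda) ?e3_neq0 //.
by rewrite det3 !mxE /= /e3; ring.
Qed.

Lemma Lam_eigenvalues : has_eigenvalues Lam lambda.
Proof.
apply/has_eigenvalues3; rewrite /mxtrace sum3 /minor2 det3 !mxE /= /e1 /e2 /e3.
by split; ring.
Qed.

Lemma data_connected x y z (B : 'M[K]_3) : has_data x y z B ->
  connected3 B = generic_pt x y z.
Proof. by move=> [_ [h01 h02 h12] hq hr]; rewrite connected_charts h01 h02 h12 hq hr. Qed.

Lemma data_rep_set x y z (B : 'M[K]_3) : has_data x y z B -> generic_pt x y z ->
  rep_set lambda mu nu (mk_rep Lam B).
Proof.
move=> hB gen; rewrite /rep_set /mkset rep_a_mk rep_b_mk.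
have [eB eAB] := data_eigenvalues hB; split=> //; last exact: Lam_eigenvalues.
- split; first exact: Lam_unit.
  by have /has_eigenvalues3[_ _ d] := eB; rewrite det_neq0_unit d e3_neq0.
- by apply: connected_irreducible => //; rewrite (data_connected hB).
Qed.

Lemma rep_diagonal v : rep_set lambda mu nu v -> exists B : 'M[K]_3,
  [/\ rep_conj v (mk_rep Lam B), has_data (rep_x v) (rep_y v) (rep_z v) B & connected3 B].
Proof.
move=> [[Au Bu] irr hA hB hAB].
have [g gu eL] := diagonalize3 linj hA; pose B := g *m rep_b v *m invmx g.
have cj : rep_conj v (mk_rep Lam B) by exists g; rewrite ?rep_a_mk ?rep_b_mk ?eL.
have [ex ey ez] := rep_conj_inv Au Bu cj.
have eAB : Lam *m B = g *m (rep_a v *m rep_b v) *m invmx g.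
  by rewrite -eL /B !mulmxA mulmxKV.
exists B; split=> //.
  rewrite -ex -ey -ez /rep_x /rep_y /rep_z rep_a_mk rep_b_mk.
  apply: data_of_rep; rewrite /has_eigenvalues ?eAB charpoly_conj //.
by apply: (@irreducible_connected _ lambda); rewrite -eL; exact: irreducible_conj.
Qed.

Lemma rep_on_cubic v : rep_set lambda mu nu v ->
  on_cubic rep_cubic (rep_x v) (rep_y v) (rep_z v) /\
  generic_pt (rep_x v) (rep_y v) (rep_z v).
Proof.
move=> /rep_diagonal[B [_ hB conn]]; split; last by rewrite -(data_connected hB).
by apply/on_cubic_qr; have [_ [<- <- <-] <- <-] := hB; ring.
Qed.

(** Normal forms for the torus action, one for each chart: two entries along a
    path of length two in the graph of B are made equal to 1. *)
Definition chart_fun (k : nat) x y z : K :=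
  match k with
  | 0 => qd x y z | 1 => rd x y z | 2 => p01 x y * p12 x y
  | 3 => p02 x y * p12 x y | _ => p01 x y * p02 x y end.

Definition normal_form_mx (k : nat) x y z : 'M[K]_3 :=
  let b := bd x in let p := p01 x y in let p' := p02 x y in let p'' := p12 x y in
  let q := qd x y z in let r := rd x y z in
  match k with
  | 0 => mx3 (b L0) 1 (p' / q) p (b L1) 1 q p'' (b L2)
  | 1 => mx3 (b L0) (p / r) 1 r (b L1) p'' p' 1 (b L2)
  | 2 => mx3 (b L0) 1 (r / (p * p'')) p (b L1) 1 q p'' (b L2)
  | 3 => mx3 (b L0) (q / (p' * p'')) 1 r (b L1) p'' p' 1 (b L2)
  | _ => mx3 (b L0) p 1 1 (b L1) (q / (p * p')) p' r (b L2) end.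

Lemma generic_chart x y z : generic_pt x y z <->
  exists k : 'I_5, chart_fun k x y z != 0.
Proof.
split=> [|[[[|[|[|[|[|//]]]]] ? /= h]]]; rewrite /generic_pt /in_charts ?h ?orbT //.
case/or4P => [h|h|h|/orP[h|h]].
- by exists (Ordinal (isT : 0 < 5)%N).
- by exists (Ordinal (isT : 1 < 5)%N).
- by exists (Ordinal (isT : 2 < 5)%N).
- by exists (Ordinal (isT : 3 < 5)%N).
- by exists (Ordinal (isT : 4 < 5)%N).
Qed.

Lemma normal_form_data k x y z : on_cubic rep_cubic x y z -> chart_fun k x y z != 0 ->
  has_data x y z (normal_form_mx k x y z).
Proof.
move=> /on_cubic_qr; rewrite /has_data /chart_fun /normal_form_mx.
move: (bd x) (p01 x y) (p02 x y) (p12 x y) (qd x y z) (rd x y z) => b p p' p'' q r e.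
case: k => [|[|[|[|k]]]]; rewrite ?mulf_eq0 ?negb_or => h; rewrite !mxE /=;
  split=> //; try (split; by rewrite ?(mul1r, mulr1)); rewrite ?(mul1r, mulr1) //.
- by rewrite divfK.
- by apply: (mulfI h); rewrite e; field.
- by rewrite divfK.
- by apply: (mulfI h); rewrite (mulrC r q) e; field.
- by case/andP: h => u v; split=> //; rewrite mulrAC (mulrC r) e; field; rewrite u v.
- by case/andP: h => u v; field; rewrite u v.
- by case/andP: h => u v; split=> //; rewrite mulrAC e; field; rewrite u v.
- by case/andP: h => u v; field; rewrite u v.
- by case/andP: h => u v; split=> //; rewrite mulrAC e; field; rewrite u v.
- by case/andP: h => u v; field; rewrite u v.
Qed.

(** The diagonal matrix that conjugates B to its normal form: its entries are
    the products of the entries of B along the path. *)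
Lemma normal_form_conj k x y z (B : 'M[K]_3) : has_data x y z B ->
  chart_fun k x y z != 0 -> rep_conj (mk_rep Lam B) (mk_rep Lam (normal_form_mx k x y z)).
Proof.
move=> [[b0 b1 b2] [h01 h02 h12] hq hr] h.
suff [d0 [d1 [d2 [dn e]]]] : exists d0 d1 d2, d0 * d1 * d2 != 0 /\
    normal_form_mx k x y z *m mx3 d0 0 0 0 d1 0 0 0 d2 = mx3 d0 0 0 0 d1 0 0 0 d2 *m B.
  pose g : 'M[K]_3 := mx3 d0 0 0 0 d1 0 0 0 d2.
  have gu : g \in unitmx.
    by rewrite det_neq0_unit det3 !mxE /= !(mulr0, subr0, addr0, mul0r) mulrA.
  exists g => //; rewrite !rep_a_mk !rep_b_mk; split; last by rewrite -e mulmxK.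
  suff -> : g *m Lam = Lam *m g by rewrite mulmxK.
  by rewrite !mx3_mul !(mulr0, mul0r, addr0, add0r) (mulrC d0) (mulrC d1) (mulrC d2).
have nz : [/\ chart_fun 0 x y z = B L0 L1 * B L1 L2 * B L2 L0,
  chart_fun 1 x y z = B L0 L2 * B L2 L1 * B L1 L0,
  chart_fun 2 x y z = B L0 L1 * B L1 L0 * (B L1 L2 * B L2 L1),
  chart_fun 3 x y z = B L0 L2 * B L2 L0 * (B L1 L2 * B L2 L1) &
  forall k, chart_fun k.+4 x y z = B L0 L1 * B L1 L0 * (B L0 L2 * B L2 L0)].
  by split=> [||||k']; rewrite /= ?hq ?hr ?h01 ?h02 ?h12.
have [n0 n1 n2 n3 n4] := nz.
rewrite /normal_form_mx -b0 -b1 -b2 -h01 -h02 -h12 -hq -hr.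
move: (mx3_eta B) h; rewrite /normal_form_mx.
move: k => [|[|[|[|k]]]]; rewrite ?n0 ?n1 ?n2 ?n3 ?n4;
  move: (B L0 L0) (B L0 L1) (B L0 L2) (B L1 L0) (B L1 L1) (B L1 L2)
  (B L2 L0) (B L2 L1) (B L2 L2) => b00 b01 b02 b10 b11 b12 b20 b21 b22 ->;
  rewrite !mulf_eq0 !negb_or.
- move=> /andP[/andP[u01 u12] u20]; exists 1, b01, (b01 * b12); split; first by rewrite !mulf_neq0 ?oner_neq0.
  by rewrite !mx3_mul; congr mx3; field; rewrite ?u01 ?u12 ?u20.
- move=> /andP[/andP[u02 u21] u10]; exists 1, (b02 * b21), b02; split; first by rewrite !mulf_neq0 ?oner_neq0.
  by rewrite !mx3_mul; congr mx3; field; rewrite ?u02 ?u21 ?u10.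
- move=> /andP[/andP[u01 u10] /andP[u12 u21]]; exists 1, b01, (b01 * b12); split; first by rewrite !mulf_neq0 ?oner_neq0.
  by rewrite !mx3_mul; congr mx3; field; rewrite ?u01 ?u12 ?u10 ?u21.
- move=> /andP[/andP[u02 u20] /andP[u12 u21]]; exists 1, (b02 * b21), b02; split; first by rewrite !mulf_neq0 ?oner_neq0.
  by rewrite !mx3_mul; congr mx3; field; rewrite ?u02 ?u12 ?u20 ?u21.
- move=> /andP[/andP[u01 u10] /andP[u02 u20]]; exists b10, 1, (b10 * b02); split; first by rewrite !mulf_neq0 ?oner_neq0.
  by rewrite !mx3_mul; congr mx3; field; rewrite ?u01 ?u02 ?u10 ?u20.
Qed.

End TorusData.

Section RegularMatrices.
Variables (K : fieldType) (X : space_with_functions K).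
Hypothesis rX : ringed X.

Definition gregmx m n (M : X -> 'M[K]_(m, n)) := forall i j, greg (fun x => M x i j).

Lemma gregmx_mul m n p (M : X -> 'M[K]_(m, n)) (N : X -> 'M[K]_(n, p)) :
  gregmx M -> gregmx N -> gregmx (fun x => M x *m N x).
Proof.
move=> rM rN i j.
apply: (greg_eq (greg_sum rX (index_enum _) predT (F := fun k x => M x i k * N x k j) _)).
  by move=> k; apply: (gregM rX).
by move=> x; rewrite mxE.
Qed.

Lemma greg_trace n (M : X -> 'M[K]_n) : gregmx M -> greg (fun x => \tr (M x)).
Proof. by move=> rM; apply: (greg_sum rX). Qed.

Lemma greg_det n (M : X -> 'M[K]_n) : gregmx M -> greg (fun x => \det (M x)).
Proof.
move=> rM; apply: (greg_sum rX) => s; apply: (gregM rX); first exact: gregC.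
exact: (greg_prod rX).
Qed.

Lemma gregmx_adj n (M : X -> 'M[K]_n) : gregmx M -> gregmx (fun x => \adj (M x)).
Proof.
move=> rM i j.
apply: (greg_eq (f := fun x => (-1) ^+ (j + i) * \det (row' j (col' i (M x))))).
  apply: (gregM rX); first exact: gregC.
  by apply: greg_det => k l; apply: (greg_eq (rM (lift j k) (lift i l))) => x; rewrite !mxE.
by move=> x; rewrite !mxE.
Qed.

Lemma gregmx_mx3 (a00 a01 a02 a10 a11 a12 a20 a21 a22 : X -> K) :
  greg a00 -> greg a01 -> greg a02 -> greg a10 -> greg a11 -> greg a12 ->
  greg a20 -> greg a21 -> greg a22 ->
  gregmx (fun x => mx3 (a00 x) (a01 x) (a02 x) (a10 x) (a11 x) (a12 x)
                       (a20 x) (a21 x) (a22 x)).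
Proof.
move=> h00 h01 h02 h10 h11 h12 h20 h21 h22.
by do 2!apply: ord3P; [apply: (greg_eq h00)|apply: (greg_eq h01)|apply: (greg_eq h02)|
  apply: (greg_eq h10)|apply: (greg_eq h11)|apply: (greg_eq h12)|
  apply: (greg_eq h20)|apply: (greg_eq h21)|apply: (greg_eq h22)] => x; rewrite mxE.
Qed.

End RegularMatrices.

Section CharacterVariety.
Variable K : numClosedFieldType.
Variables (lambda mu nu : 'I_3 -> K).
Hypotheses (lam0 : forall i, lambda i != 0) (mu0 : forall i, mu i != 0).
Hypothesis linj : injective lambda.
Hypothesis det_rel : e3 nu = e3 lambda * e3 mu.
Local Notation C := (rep_cubic lambda mu nu).
Local Notation MB := (character_variety lambda mu nu).
Local Notation RS := (rep_space lambda mu nu).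
Local Notation conj := (@conjugate K lambda mu nu).
Local Notation Lam := (mx3 (lambda L0) 0 0 0 (lambda L1) 0 0 0 (lambda L2)).

(** The points of the affine cubic that come from irreducible pairs. *)
Definition generic_locus : set (affine_space K 4) :=
  [set v : 'rV[K]_4 | [/\ v 0 I3 = 1, peval (cubic_poly C) v = 0 &
    generic_pt lambda mu nu (v 0 I0) (v 0 I1) (v 0 I2)]].
Local Notation U := (@subspace_wf K (affine_space K 4) generic_locus).

Lemma RS_ringed : ringed RS.
Proof. exact: subspace_ringed (affine_ringed K _). Qed.

Lemma MB_ringed : ringed MB.
Proof. exact: quotient_ringed RS_ringed. Qed.

Lemma U_ringed : ringed U.
Proof. exact: subspace_ringed (affine_ringed K 4). Qed.

Lemma conj_refl (v : RS) : conj v v. Proof. exact: rep_conj_refl. Qed.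
Lemma conj_sym (v w : RS) : conj v w -> conj w v. Proof. exact: rep_conj_sym. Qed.
Lemma conj_trans (u v w : RS) : conj u v -> conj v w -> conj u w.
Proof. exact: rep_conj_trans. Qed.

Lemma rep_a_greg : gregmx (fun v : RS => rep_a (set_val v)).
Proof.
move=> i j; apply: (greg_eq (@coord_greg K _ (rep_set lambda mu nu)
  (mxvec_index i (lshift 3 j)))) => v.
by rewrite /rep_a !mxE.
Qed.

Lemma rep_b_greg : gregmx (fun v : RS => rep_b (set_val v)).
Proof.
move=> i j; apply: (greg_eq (@coord_greg K _ (rep_set lambda mu nu)
  (mxvec_index i (rshift 3 j)))) => v.
by rewrite /rep_b !mxE.
Qed.

Lemma rep_x_greg : greg (fun v : RS => rep_x (set_val v)).
Proof.
apply: (greg_trace RS_ringed); apply: (gregmx_mul RS_ringed); last exact: rep_b_greg.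
by apply: (gregmx_adj RS_ringed); exact: rep_a_greg.
Qed.

Lemma rep_y_greg : greg (fun v : RS => rep_y (set_val v)).
Proof.
apply: (greg_trace RS_ringed); apply: (gregmx_mul RS_ringed); first exact: rep_a_greg.
by apply: (gregmx_adj RS_ringed); exact: rep_b_greg.
Qed.

Lemma rep_z_greg : greg (fun v : RS => rep_z (set_val v)).
Proof.
apply: (greg_trace RS_ringed); apply: (gregmx_mul RS_ringed).
  by apply: (gregmx_mul RS_ringed); [exact: rep_a_greg|exact: rep_b_greg].
by apply: (gregmx_mul RS_ringed); apply: (gregmx_adj RS_ringed);
  [exact: rep_a_greg|exact: rep_b_greg].
Qed.

Definition coord_vec (v : 'rV[K]_(3 * (3 + 3))) : 'rV[K]_4 :=
  vec4 (rep_x v) (rep_y v) (rep_z v) 1.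

Definition class_coord (c : MB) : 'rV[K]_4 := coord_vec (set_val (class_repr c)).

Lemma conj_coord (v w : RS) : conj v w -> coord_vec (set_val w) = coord_vec (set_val v).
Proof.
have [[Au Bu] _ _ _ _] := set_valP v; rewrite -set_valE in Au Bu.
by move=> /(rep_conj_inv Au Bu) [ex ey ez]; rewrite /coord_vec ex ey ez.
Qed.

Lemma class_coord_pr (v : RS) : class_coord (quotient_proj conj v) = coord_vec (set_val v).
Proof. by apply: conj_coord; apply: class_repr_proj; [exact: conj_refl|exact: conj_sym|exact: conj_trans]. Qed.

Lemma class_coord_generic (c : MB) : generic_locus (class_coord c).
Proof.
have hv := set_valP (class_repr c); rewrite -set_valE in hv.
have [S G] := rep_on_cubic linj hv.
by rewrite /generic_locus /mkset /class_coord /coord_vec !vec4E; split=> //; exact/on_cubicP.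
Qed.

Definition character_map : MB -> U := fun c => SigSub (mem_set (class_coord_generic c)).

Lemma character_mapE c : set_val (character_map c) = class_coord c.
Proof. by rewrite set_valE. Qed.

Lemma character_map_morphism : morphism character_map.
Proof.
apply: into_zero_locus_morphism; first exact: MB_ringed.
have descend (f : RS -> K) (g : MB -> K) : greg f ->
    (forall v, g (quotient_proj conj v) = f v) -> greg g.
  move=> rf gf; change (@regular K RS setT (g \o quotient_proj conj)).
  by rewrite (_ : g \o _ = f) //; apply/funext => v; exact: gf.
apply: ord4P.
- by apply: (descend _ _ rep_x_greg) => v; rewrite character_mapE class_coord_pr vec4E.
- by apply: (descend _ _ rep_y_greg) => v; rewrite character_mapE class_coord_pr vec4E.
- by apply: (descend _ _ rep_z_greg) => v; rewrite character_mapE class_coord_pr vec4E.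
- by apply: (descend _ _ (gregC RS_ringed 1)) => v; rewrite character_mapE class_coord_pr vec4E.
Qed.

(** The pair in normal form attached to a point of a chart; it is a regular
    local section of the quotient. *)
Definition section_rep (k : nat) (v : 'rV[K]_4) : 'rV[K]_(3 * (3 + 3)) :=
  mk_rep Lam (normal_form_mx lambda mu nu k (v 0 I0) (v 0 I1) (v 0 I2)).

Definition chart_at k (v : 'rV[K]_4) := chart_fun lambda mu nu k (v 0 I0) (v 0 I1) (v 0 I2).

Lemma generic_on_cubic v : generic_locus v ->
  on_cubic C (v 0 I0) (v 0 I1) (v 0 I2) /\ v = vec4 (v 0 I0) (v 0 I1) (v 0 I2) 1.
Proof. by move=> [v3 hv _]; exact: affine_chart_on_cubic. Qed.

Lemma section_rep_set k v : generic_locus v -> chart_at k v != 0 ->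
  rep_set lambda mu nu (section_rep k v).
Proof.
move=> gv ck; have [S _] := generic_on_cubic gv; have [_ _ gen] := gv.
by apply: data_rep_set => //; first exact: (normal_form_data linj S ck).
Qed.

Lemma section_coord k v : generic_locus v -> chart_at k v != 0 ->
  coord_vec (section_rep k v) = v.
Proof.
move=> gv ck; have [S e] := generic_on_cubic gv; rewrite [RHS]e.
have [ex ey ez] := data_invariants linj (normal_form_data linj S ck).
by rewrite /coord_vec /rep_x /rep_y /rep_z !rep_a_mk !rep_b_mk ex ey ez.
Qed.

Lemma section_conj k v (w : 'rV[K]_(3 * (3 + 3))) : rep_set lambda mu nu w ->
  coord_vec w = v -> chart_at k v != 0 -> rep_conj w (section_rep k v).
Proof.
move=> hw <-; rewrite /chart_at /section_rep !vec4E => ck.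
have [B [cj hB _]] := rep_diagonal linj hw.
exact: (rep_conj_trans cj (normal_form_conj hB ck)).
Qed.

Section SectionRegular.
Variable (k : nat).
Definition chart_locus : set U := [set u | chart_at k (set_val u) != 0].
Local Notation W := (subspace_wf chart_locus).
Lemma W_ringed : ringed W. Proof. exact: subspace_ringed U_ringed. Qed.

Lemma coord_U_greg i : greg (fun u : U => (set_val u : 'rV[K]_4) 0 i).
Proof. exact: coord_greg. Qed.

Lemma coord_W_greg i : greg (fun u : W => (set_val (set_val u) : 'rV[K]_4) 0 i).
Proof. by have h := greg_restrict (A := chart_locus) U_ringed (coord_U_greg i); apply: (greg_eq h). Qed.

Section Coefficients.
Variables (Y : space_with_functions K) (x y z : Y -> K).
Hypotheses (rY : ringed Y) (rx : greg x) (ry : greg y) (rz : greg z).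
Local Notation gC := (gregC rY _).

Lemma greg_solve c s w i : greg c -> greg s -> greg w ->
  greg (fun u : Y => solve lambda (c u) (s u) (w u) i).
Proof.
move=> rc rs rw; apply: (gregM rY); last exact: gC.
apply: (gregB rY); last by apply: (gregM rY); [exact: gC|].
by apply: (gregD rY) => //; apply: (gregM rY); [exact: gC|].
Qed.

Lemma greg_bd i : greg (fun u => bd lambda mu nu (x u) i).
Proof. by apply: greg_solve => //; exact: gC. Qed.
Lemma greg_md i : greg (fun u => md lambda mu nu (y u) i).
Proof. by apply: greg_solve => //; exact: gC. Qed.
Lemma greg_p01 : greg (fun u => p01 lambda mu nu (x u) (y u)).
Proof. by apply: (gregB rY); [apply: (gregM rY); exact: greg_bd|exact: greg_md]. Qed.
Lemma greg_p02 : greg (fun u => p02 lambda mu nu (x u) (y u)).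
Proof. by apply: (gregB rY); [apply: (gregM rY); exact: greg_bd|exact: greg_md]. Qed.
Lemma greg_p12 : greg (fun u => p12 lambda mu nu (x u) (y u)).
Proof. by apply: (gregB rY); [apply: (gregM rY); exact: greg_bd|exact: greg_md]. Qed.

Lemma greg_qr_sum : greg (fun u => qr_sum lambda mu nu (x u) (y u)).
Proof.
have b := greg_bd; have h1 := greg_p01; have h2 := greg_p02; have h3 := greg_p12.
apply: (gregD rY); last exact: (gregM rY).
apply: (gregD rY); last exact: (gregM rY).
apply: (gregD rY); last exact: (gregM rY).
apply: (gregB rY); first exact: gC.
by do 2!apply: (gregM rY) => //.
Qed.

Lemma greg_zsym : greg (fun u => zsym lambda mu nu (x u) (y u)).
Proof.
have b := greg_bd; have m := greg_md.
have h1 := greg_p01; have h2 := greg_p02; have h3 := greg_p12.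
have three (f g : Y -> K) c d : greg f -> greg g -> greg (fun u => c * d * f u * g u).
  by move=> rf rg; do 2!apply: (gregM rY) => //; exact: gC.
do 3!(apply: (gregB rY); last exact: three).
apply: (gregM rY); first exact: gC.
by do 2?apply: (gregD rY) => //; apply: (gregM rY).
Qed.

Lemma greg_qd : greg (fun u => qd lambda mu nu (x u) (y u) (z u)).
Proof.
apply: (gregM rY); last exact: gC.
apply: (gregB rY); first by apply: (gregB rY) => //; exact: greg_zsym.
by apply: (gregM rY); [exact: gC|exact: greg_qr_sum].
Qed.

Lemma greg_rd : greg (fun u => rd lambda mu nu (x u) (y u) (z u)).
Proof. by apply: (gregB rY); [exact: greg_qr_sum|exact: greg_qd]. Qed.

Lemma greg_chart_fun j : greg (fun u => chart_fun lambda mu nu j (x u) (y u) (z u)).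
Proof.
have h1 := greg_p01; have h2 := greg_p02; have h3 := greg_p12.
case: j => [|[|[|[|j]]]]; [exact: greg_qd|exact: greg_rd| | |]; exact: (gregM rY).
Qed.

Lemma gregmx_normal_form j :
  (forall u, chart_fun lambda mu nu j (x u) (y u) (z u) != 0) ->
  gregmx (fun u => normal_form_mx lambda mu nu j (x u) (y u) (z u)).
Proof.
move=> nz; have rc := gregV rY (greg_chart_fun j) nz.
have b := greg_bd; have h1 := greg_p01; have h2 := greg_p02; have h3 := greg_p12.
have q := greg_qd; have r := greg_rd; have one := gregC rY 1.
by move: rc; case: j {nz} => [|[|[|[|j]]]] rc; apply: gregmx_mx3 => //; exact: (gregM rY).
Qed.

End Coefficients.

Lemma chart_locus_open : zopen chart_locus.
Proof.
by apply: (greg_open U_ringed); apply: greg_chart_fun; [exact: U_ringed|exact: coord_U_greg..].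
Qed.

Lemma section_W (u : W) : rep_set lambda mu nu (section_rep k (set_val (set_val u))).
Proof.
by apply: section_rep_set; [exact: (set_valP (set_val u))|exact: (set_valP u)].
Qed.

Definition section_map : W -> RS := fun u => SigSub (mem_set (section_W u)).

Lemma section_mapE u : set_val (section_map u) = section_rep k (set_val (set_val u)).
Proof. by rewrite set_valE. Qed.

Lemma section_map_morphism : morphism section_map.
Proof.
have rW := W_ringed; apply: into_zero_locus_morphism => // i.
have nz (u : W) : chart_fun lambda mu nu k ((set_val (set_val u) : 'rV[K]_4) 0 I0)
   ((set_val (set_val u) : 'rV[K]_4) 0 I1) ((set_val (set_val u) : 'rV[K]_4) 0 I2) != 0.
  exact: (set_valP u).
have rN := gregmx_normal_form rW (coord_W_greg I0) (coord_W_greg I1) (coord_W_greg I2) nz.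
case/mxvec_indexP: i => i j.
have e (u : W) : (set_val (section_map u) : 'rV[K]_(3 * (3 + 3))) 0 (mxvec_index i j) =
    row_mx Lam (normal_form_mx lambda mu nu k ((set_val (set_val u) : 'rV[K]_4) 0 I0)
   ((set_val (set_val u) : 'rV[K]_4) 0 I1) ((set_val (set_val u) : 'rV[K]_4) 0 I2)) i j.
  by rewrite section_mapE /section_rep /mk_rep mxvecE.
case: (split_ordP j) => j' ej.
  by apply: (greg_eq (gregC rW (Lam i j'))) => u; rewrite e ej row_mxEl.
by apply: (greg_eq (rN i j')) => u; rewrite e ej row_mxEr.
Qed.

End SectionRegular.

(** Pairs with the same invariants are conjugate because both are conjugate to
    the same normal form, and the normal forms are regular on the charts. *)
Lemma character_iso : isomorphic MB U.
Proof.
exists character_map; split; first exact: character_map_morphism.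
have /choice[kf hk] : forall u : U, exists k : nat, chart_at k (set_val u) != 0.
  move=> u; have [_ _ gen] := set_valP u.
  by have [k hk] := (generic_chart lambda mu nu _ _ _).1 gen; exists k.
have gu (u : U) : generic_locus (set_val u) by exact: (set_valP u).
pose s u : RS := SigSub (mem_set (section_rep_set (gu u) (hk u))).
have sE u : set_val (s u) = section_rep (kf u) (set_val u) by rewrite set_valE.
exists (fun u => quotient_proj conj (s u)); split.
- apply: morphism_local; first exact: (ringed_axioms U_ringed).
  move=> u0; exists (chart_locus (kf u0)); split.
  + exact: chart_locus_open.
  + exact: hk.
  have -> : (fun u => quotient_proj conj (s u)) \o set_val =
      quotient_proj conj \o (@section_map (kf u0)).
    apply/funext => u /=.
    apply/(quotient_projP conj_refl conj_sym conj_trans).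
    change (rep_conj (set_val (s (set_val u))) (set_val (section_map u))).
    rewrite section_mapE; apply: section_conj; first exact: (set_valP (s (set_val u))).
      by rewrite sE section_coord.
    exact: (set_valP u).
  exact: (morphism_comp (@section_map_morphism _) (@quotient_proj_morphism K RS conj)).
- move=> c; rewrite -[RHS]class_reprK.
  apply/(quotient_projP conj_refl conj_sym conj_trans); apply: conj_sym.
  change (rep_conj (set_val (class_repr c)) (set_val (s (character_map c)))).
  rewrite sE; apply: section_conj; first exact: (set_valP (class_repr c)).
    by rewrite character_mapE.
  exact: hk.
- move=> u; apply: set_val_inj; rewrite character_mapE class_coord_pr sE.
  exact: section_coord.
Qed.

End CharacterVariety.

(** * An affine open subset of the affine cubic misses no isolated point *)

Section CofiniteAffine.
Variables (K : numClosedFieldType) (C : cubic K).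
Hypothesis c0 : cc C != 0.
Local Notation P2 := {poly {poly K}}.

Variables (G : set (affine_space K 4)) (l : seq (K * K)).
Hypothesis G_cubic : G `<=` affine_chart C I3.
Hypothesis G_cofinite : forall x y z, (x, y) \notin l -> on_cubic C x y z ->
  G (vec4 x y z 1).
Local Notation U := (@subspace_wf K (affine_space K 4) G).

Definition mval (al be : P2) (v : 'rV[K]_4) : K :=
  ev (v 0 I0) (v 0 I1) al + ev (v 0 I0) (v 0 I1) be * v 0 I2.

Lemma mval4 al be x y z w : mval al be (vec4 x y z w) = ev x y al + ev x y be * z.
Proof. by rewrite /mval !vec4E. Qed.

Lemma cofinite_on_cubic (u : U) : let v : 'rV[K]_4 := set_val u in
  on_cubic C (v 0 I0) (v 0 I1) (v 0 I2) /\ v = vec4 (v 0 I0) (v 0 I1) (v 0 I2) 1.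
Proof. by apply: affine_chart_on_cubic; apply: G_cubic; exact: set_valP. Qed.

Lemma cofinite_point x y z : (x, y) \notin l -> on_cubic C x y z ->
  exists u : U, set_val u = vec4 x y z 1.
Proof.
by move=> xyl S; exists (SigSub (mem_set (G_cofinite xyl S))); rewrite set_valE.
Qed.

Lemma module_form_eq0 f x y z : module_form C f ->
  (forall x y z, (x, y) \notin l -> on_cubic C x y z -> f x y z = 0) ->
  on_cubic C x y z -> f x y z = 0.
Proof.
move=> [al [be h]] f0 S; have [a0 b0] : al = 0 /\ be = 0.
  by apply: (normal_form_eq0 c0 (l := l)) => x' y' z' xyl S'; rewrite -h // f0.
by rewrite h // a0 b0 !ev0 mul0r addr0.
Qed.

Lemma module_form_pair al be : module_form C (fun x y z => ev x y al + ev x y be * z).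
Proof. by exists al, be. Qed.

Section RegularFunctions.
Variable f : U -> K.
Hypothesis rf : greg f.

Lemma local_fraction (u0 : U) : exists bl be al al',
  mval bl be (set_val u0) != 0 /\
  forall u : U, mval bl be (set_val u) * f u = mval al al' (set_val u).
Proof.
have [p [q [q0 hpq]]] := regular_sub_affine rf (I : setT u0).
have [al [al' ha]] := normal_form C (p * q).
have [bl [be hb]] := normal_form C (q * q).
have ea (u : U) : mval al al' (set_val u) = peval (p * q) (set_val u).
  by have [S e] := cofinite_on_cubic u; rewrite {1}e mval4 -ha // -e.
have eb (u : U) : mval bl be (set_val u) = peval (q * q) (set_val u).
  by have [S e] := cofinite_on_cubic u; rewrite {1}e mval4 -hb // -e.
exists bl, be, al, al'; split=> [|u]; rewrite eb ?ea !pevalM; first exact: mulf_neq0.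
have [->|qu] := eqVneq (peval q (set_val u)) 0; first by rewrite mulr0 mul0r mulr0.
by rewrite hpq // mulrAC mulrA divfK // mulrC.
Qed.

Lemma avoid_two (p q r s : K) : p != 0 -> s != 0 ->
  exists c, p + c * q != 0 /\ r + c * s != 0.
Proof.
move=> p0 s0; have [r0|r0] := eqVneq r 0; last first.
  by exists 0; rewrite !mul0r !addr0.
have [e|pq] := eqVneq (p + q) 0; last by exists 1; rewrite !mul1r r0 add0r.
exists 2%:R; rewrite r0 add0r mulf_neq0 ?pnatr_eq0 //.
have -> : p + 2%:R * q = 2%:R * (p + q) - p by ring.
by rewrite e mulr0 sub0r oppr_eq0.
Qed.

(** Over a point (x, y) outside l, a combination of local denominators is
    nonzero at both points of the cubic, so its norm, which no longer involves
    z, is a denominator that does not vanish at (x, y). *)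
Lemma plane_denominator x y : (x, y) \notin l -> exists n al be,
  ev x y n != 0 /\ forall u : U,
    let v : 'rV[K]_4 := set_val u in ev (v 0 I0) (v 0 I1) n * f u = mval al be v.
Proof.
move=> xyl; have [z S] := on_cubic_ex C x y; have S' := on_cubic_conj S.
have [u1 e1] := cofinite_point xyl S; have [u2 e2] := cofinite_point xyl S'.
have [b1 [b1' [a1 [a1' [n1 h1]]]]] := local_fraction u1.
have [b2 [b2' [a2 [a2' [n2 h2]]]]] := local_fraction u2.
have [c [m1 m2]] := avoid_two (mval b2 b2' (set_val u1)) (mval b1 b1' (set_val u2)) n1 n2.
pose comb a b : P2 := a + c%:P%:P * b.
have ecomb s s' t t' v : mval (comb s t) (comb s' t') v = mval s s' v + c * mval t t' v.
  by rewrite /mval /comb !(evD, evM, evC) hornerC; ring.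
pose bl := comb b1 b2; pose be := comb b1' b2'.
have [al [al' ha]] : module_form C (fun x y z =>
    (ev x y (bl + be * Ppoly C) + ev x y (- be) * z) *
    (ev x y (comb a1 a2) + ev x y (comb a1' a2') * z)).
  by apply: module_formM; exact: module_form_pair.
exists (norm C bl be), al, al'; split.
  rewrite (norm_factor _ _ S) mulf_neq0 //.
    by rewrite -(mval4 _ _ _ _ _ 1) -e1 ecomb.
  by rewrite -(mval4 _ _ _ _ _ 1) -e2 ecomb.
move=> u v; have [Sv _] := cofinite_on_cubic u; rewrite -/v in Sv.
rewrite (norm_factor _ _ Sv) /mval -ha // (evN _ _ be) (evD _ _ bl) (evM _ _ be) ev_Ppoly.
have := ecomb a1 a1' a2 a2' v; rewrite -(h1 u) -(h2 u) {1}/mval => ->.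
have := ecomb b1 b1' b2 b2' v; rewrite -/v -/bl -/be {1}/mval => e.
transitivity ((ev (v 0 I0) (v 0 I1) bl + ev (v 0 I0) (v 0 I1) be * (Plin C (v 0 I0) (v 0 I1) - v 0 I2))
   * ((ev (v 0 I0) (v 0 I1) bl + ev (v 0 I0) (v 0 I1) be * v 0 I2) * f u)); first by ring.
by rewrite e; ring.
Qed.

(** With one denominator n and the numerators of f, the quotients of the latter
    by n are regular outside l, hence polynomials. *)
Lemma regular_module_form : exists al be, forall u : U, f u = mval al be (set_val u).
Proof.
have [x0 [y0 xyl]] : exists x y, (x, y) \notin l.
  apply: contrapT => no; suff /eqP : (1 : P2) = 0 by rewrite oner_eq0.
  by apply: (ev_eq0 (l := l)) => x y xyl; case: no; exists x, y.
have [n [al [be [n_xy hn]]]] := plane_denominator xyl.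
have n0 : n != 0 by apply: contraNneq n_xy => ->; rewrite ev0.
have cross n' al' be' : (forall u : U, let v : 'rV[K]_4 := set_val u in
    ev (v 0 I0) (v 0 I1) n' * f u = mval al' be' v) ->
    al * n' = al' * n /\ be * n' = be' * n.
  move=> hn'; suff [/eqP e1 /eqP e2] : al * n' - al' * n = 0 /\ be * n' - be' * n = 0.
    by move: e1 e2; rewrite !subr_eq0 => /eqP -> /eqP ->.
  apply: (normal_form_eq0 c0 (l := l)) => x y z xyl' S.
  have [u eu] := cofinite_point xyl' S.
  have := hn u; have := hn' u; rewrite eu; cbv zeta; rewrite !mval4 !vec4E => h' h.
  rewrite !(evD, evN, evM).
  have -> : ev x y al * ev x y n' - ev x y al' * ev x y n +
     (ev x y be * ev x y n' - ev x y be' * ev x y n) * z =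
     (ev x y al + ev x y be * z) * ev x y n' - (ev x y al' + ev x y be' * z) * ev x y n by ring.
  by rewrite -h -h'; ring.
have [k ek] : exists k, al = k * n.
  apply: (plane_hartogs (l := l) n0) => x y xyl'.
  have [n' [al' [be' [n'0 hn']]]] := plane_denominator xyl'.
  by exists al', n'; split=> //; have [] := cross _ _ _ hn'.
have [k' ek'] : exists k, be = k * n.
  apply: (plane_hartogs (l := l) n0) => x y xyl'.
  have [n' [al' [be' [n'0 hn']]]] := plane_denominator xyl'.
  by exists be', n'; split=> //; have [] := cross _ _ _ hn'.
exists k, k' => u0; have [bl [bl' [a [a' [b0 hb]]]]] := local_fraction u0.
have [ga [de h]] : module_form C (fun x y z =>
    (ev x y bl + ev x y bl' * z) * (ev x y k + ev x y k' * z)).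
  by apply: module_formM; exact: module_form_pair.
have [/eqP g0 /eqP d0] : n * (ga - a) = 0 /\ n * (de - a') = 0.
  apply: (normal_form_eq0 c0 (l := l)) => x y z xyl' S.
  have [u eu] := cofinite_point xyl' S.
  have := hn u; have := hb u; rewrite eu; cbv zeta; rewrite !mval4 !vec4E ek ek' !evM => h1 h2.
  have := h x y z S; rewrite !(evM, evD, evN) => h3.
  have -> : ev x y n * (ev x y ga - ev x y a) + ev x y n * (ev x y de - ev x y a') * z =
    ev x y n * (ev x y ga + ev x y de * z) - ev x y n * (ev x y a + ev x y a' * z) by ring.
  rewrite -h3 -h1.
  transitivity ((ev x y bl + ev x y bl' * z) *
    ((ev x y k * ev x y n + ev x y k' * ev x y n * z) - ev x y n * f u)); first by ring.
  by rewrite -h2 subrr mulr0.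
move: g0 d0; rewrite !mulf_eq0 (negPf n0) /= !subr_eq0 => /eqP g0 /eqP d0.
have [S e] := cofinite_on_cubic u0; set v : 'rV[K]_4 := set_val u0 in S e b0.
apply: (mulfI b0); rewrite hb -/v -g0 -d0 e !mval4.
by rewrite -h.
Qed.

End RegularFunctions.

(** The coordinates of an affine model of U and those of its inverse extend over
    the missing points, so each of these is the image of a point of the model
    under the inverse, which has values in U. *)
Lemma cofinite_affine : affine_variety U -> affine_chart C I3 `<=` G.
Proof.
move=> [n [T [h [mh [g [mg gh hg]]]]]] v /affine_chart_on_cubic.
set x := v 0 I0; set y := v 0 I1; set z := v 0 I2 => -[S ve].
have rT : ringed (@subspace_wf K (affine_space K n) (zero_set T)).
  exact: subspace_ringed (affine_ringed K n).
have /choice[al /choice[be hab]] : forall i, exists al be, forall u : U,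
    (set_val (h u) : 'rV[K]_n) 0 i = mval al be (set_val u).
  move=> i; apply: regular_module_form.
  exact: (morphism_greg (ringed_axioms rT) mh (@coord_greg K n (zero_set T) i)).
pose H i x y z := ev x y (al i) + ev x y (be i) * z.
have mH i : module_form C (H i) by exists (al i), (be i).
have HE (u : U) x' y' z' : set_val u = vec4 x' y' z' 1 -> \row_i H i x' y' z' = set_val (h u).
  by move=> e; apply/rowP => i; rewrite mxE hab e mval4.
pose w : 'rV[K]_n := \row_i H i x y z.
have wT : zero_set T w.
  move=> p Tp; apply: (module_form_eq0 (module_form_subst p mH) _ S) => x' y' z' xyl S'.
  have [u eu] := cofinite_point xyl S'; rewrite (HE u) //.
  by have := set_valP (h u); rewrite -set_valE; apply.
pose t : @subspace_wf K (affine_space K n) (zero_set T) := SigSub (mem_set wT).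
have et : set_val t = w by rewrite set_valE.
suff -> : v = set_val (g t) by exact: set_valP.
apply/rowP => k.
have rk := morphism_greg (ringed_axioms (subspace_ringed G (affine_ringed K 4))) mg
  (@coord_greg K 4 G k).
have [p [q [q0 hpq]]] := regular_sub_affine rk (I : setT t).
have := hpq t I q0; rewrite et /= => ->; rewrite et in q0.
have mk : module_form C (fun x y z => vec4 x y z 1 0 k).
  have [a [b e]] := normal_form C (@mpolyX 4 K (mnm1 k)); exists a, b => x' y' z' S'.
  by rewrite -e // pevalX.
have mq := module_form_subst q mH; have mp := module_form_subst p mH.
have mneg := module_formM (module_form_cst C (-1)) mp.
have := module_form_eq0 (module_formM mq (module_formD (module_formM mq mk) mneg)) _ S.
rewrite -/w -ve mulN1r => e; apply: (mulfI q0).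
have {}e : peval q w * (peval q w * v 0 k - peval p w) = 0.
  apply: e => x' y' z' xyl S'.
  have [u eu] := cofinite_point xyl S'; rewrite (HE u) //.
  have [->|qu] := eqVneq (peval q (set_val (h u))) 0; first by rewrite mul0r.
  have := hpq (h u) I qu; rewrite /= gh eu => ->.
  by rewrite mulrCA divff // mulr1 mulN1r subrr mulr0.
by move/eqP: e; rewrite mulf_eq0 (negPf q0) subr_eq0 => /eqP ->; rewrite mulrCA divff // mulr1.
Qed.

End CofiniteAffine.

Section GenericCofinite.
Variable K : numClosedFieldType.
Variables (lambda mu nu : 'I_3 -> K).
Hypotheses (lam0 : forall i, lambda i != 0) (mu0 : forall i, mu i != 0).
Hypothesis linj : injective lambda.
Hypothesis det_rel : e3 nu = e3 lambda * e3 mu.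
Local Notation C := (rep_cubic lambda mu nu).

Definition solve_den i := 3%:R * lambda i ^+ 2 - 2%:R * e1 lambda * lambda i + e2 lambda.

Lemma solve_den_neq0 i : solve_den i != 0.
Proof.
have [h0 h1 h2] := solve_denominator lambda.
have n01 := l01 linj; have n02 := l02 linj; have n12 := l12 linj.
by move: i; apply: ord3P; rewrite /solve_den ?h0 ?h1 ?h2 ?oppr_eq0 mulf_neq0.
Qed.

Definition x_of_bd i b := solve_den i * b - lambda i * e1 nu
  + lambda i * (e1 lambda - lambda i) * e1 mu.
Definition y_of_md i m := (solve_den i * m - e2 nu
  + lambda i * (e1 lambda - lambda i) * e2 mu) / lambda i.

Lemma x_of_bdK x i : x_of_bd i (bd lambda mu nu x i) = x.
Proof.
rewrite /x_of_bd /bd /solve -/(solve_den i).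
move: (solve_den_neq0 i); move: (solve_den i) => d d0; by field.
Qed.

Lemma y_of_mdK y i : y_of_md i (md lambda mu nu y i) = y.
Proof.
rewrite /y_of_md /md /solve -/(solve_den i).
move: (solve_den_neq0 i) (lam0 i); move: (solve_den i) (lambda i) => d k d0 k0.
by field; rewrite k0 d0.
Qed.

(** Where q, r and two of the p_ij vanish, the index that these share is isolated
    in the graph of B, so the diagonal entry there is an eigenvalue of B, which
    determines x; either vanishing p_ij then determines y. *)
Definition nongeneric_xy : seq (K * K) :=
  let pt i j := fun a b k => let x := x_of_bd i (mu j) in
    (x, y_of_md k (bd lambda mu nu x a * bd lambda mu nu x b)) in
  [seq pt i j L0 L1 L2 | i <- enum 'I_3, j <- enum 'I_3] ++
  [seq pt i j L0 L2 L1 | i <- enum 'I_3, j <- enum 'I_3].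

Lemma nongeneric_finite x y z : (x, y) \notin nongeneric_xy ->
  on_cubic C x y z -> generic_pt lambda mu nu x y z.
Proof.
move=> xyl S; apply/negPn/negP; rewrite /generic_pt /in_charts !negb_or !negbK.
move=> /and5P[/eqP q0 /eqP r0 h1 h2 h3]; case/negP: xyl.
have qr0 : qr_sum lambda mu nu x y = 0.
  by have := r0; rewrite /rd q0 subr0.
have [hb _ _] := solveP linj (e1 mu) (e1 nu) x; rewrite -/(bd lambda mu nu x) in hb.
have [hm _ _] := solveP linj (e2 mu) y (e2 nu); rewrite -/(md lambda mu nu y) in hm.
have eigen i : (bd lambda mu nu x i - mu L0) * (bd lambda mu nu x i - mu L1)
    * (bd lambda mu nu x i - mu L2) = 0 -> exists j, x = x_of_bd i (mu j).
  move/eqP; rewrite !mulf_eq0 !subr_eq0 => /orP[/orP[]|] /eqP e.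
  - by exists L0; rewrite -e x_of_bdK.
  - by exists L1; rewrite -e x_of_bdK.
  - by exists L2; rewrite -e x_of_bdK.
have chi t : (t - mu L0) * (t - mu L1) * (t - mu L2) =
    t ^+ 3 - e1 mu * t ^+ 2 + e2 mu * t - e3 mu by rewrite /e1 /e2 /e3; ring.
have e3E : e3 mu = bd lambda mu nu x L0 * bd lambda mu nu x L1 * bd lambda mu nu x L2
  - bd lambda mu nu x L0 * p12 lambda mu nu x y - bd lambda mu nu x L1 * p02 lambda mu nu x y
  - bd lambda mu nu x L2 * p01 lambda mu nu x y.
  by apply/eqP; rewrite -subr_eq0 -[X in _ == X]qr0 /qr_sum; apply/eqP; ring.
have e01 : md lambda mu nu y L2 =
  bd lambda mu nu x L0 * bd lambda mu nu x L1 - p01 lambda mu nu x y by rewrite /p01; ring.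
have e02 : md lambda mu nu y L1 =
  bd lambda mu nu x L0 * bd lambda mu nu x L2 - p02 lambda mu nu x y by rewrite /p02; ring.
have e12 : md lambda mu nu y L0 =
  bd lambda mu nu x L1 * bd lambda mu nu x L2 - p12 lambda mu nu x y by rewrite /p12; ring.
have mem01 i j : x = x_of_bd i (mu j) -> p01 lambda mu nu x y = 0 -> (x, y) \in nongeneric_xy.
  move=> ex p0; rewrite mem_cat; apply/orP; left; apply/allpairsP.
  exists (i, j); rewrite !mem_enum; split=> //=; rewrite -ex; congr (_, _).
  by rewrite -[LHS](y_of_mdK y L2) e01 p0 subr0.
have mem02 i j : x = x_of_bd i (mu j) -> p02 lambda mu nu x y = 0 -> (x, y) \in nongeneric_xy.
  move=> ex p0; rewrite mem_cat; apply/orP; right; apply/allpairsP.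
  exists (i, j); rewrite !mem_enum; split=> //=; rewrite -ex; congr (_, _).
  by rewrite -[LHS](y_of_mdK y L1) e02 p0 subr0.
have hchi i : bd lambda mu nu x i ^+ 3 - e1 mu * bd lambda mu nu x i ^+ 2
    + e2 mu * bd lambda mu nu x i - e3 mu = 0 -> exists j, x = x_of_bd i (mu j).
  by move=> e; apply: eigen; rewrite chi.
move: h1 h2 h3 hchi; rewrite !mulf_eq0 -hb -hm e01 e02 e12 e3E.
have [h01|_] := eqVneq (p01 lambda mu nu x y) 0; have [h02|_] := eqVneq (p02 lambda mu nu x y) 0;
  have [h12|_] := eqVneq (p12 lambda mu nu x y) 0 => //= _ _ _ hchi.
- by have [|j ex] := hchi L0; [rewrite h01 h02 h12; ring|exact: mem01 ex h01].
- by have [|j ex] := hchi L0; [rewrite h01 h02; ring|exact: mem01 ex h01].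
- by have [|j ex] := hchi L1; [rewrite h01 h12; ring|exact: mem01 ex h01].
- by have [|j ex] := hchi L2; [rewrite h02 h12; ring|exact: mem02 ex h02].
Qed.

Lemma generic_locus_affine : affine_variety (character_variety lambda mu nu) ->
  generic_locus lambda mu nu = affine_chart C I3.
Proof.
move=> [n [T iT]]; apply/seteqP; split=> [v [v3 hv _] //|].
apply: (@cofinite_affine K C _ (generic_locus lambda mu nu) nongeneric_xy).
- exact: e3_neq0.
- by move=> v [].
- move=> x y z xyl S; split; rewrite ?vec4E //; first exact/on_cubicP.
  exact: nongeneric_finite.
exists n, T; apply: isomorphic_trans iT; apply: isomorphic_sym.
exact: character_iso.
Qed.

End GenericCofinite.

(** * The loop graph is a circle *)

Section Loop.
Variable R : realType.

(** The square of w + i v normalised, for w = 2 t - 1 and v = t (1 - t): since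
    w / v increases from minus to plus infinity, it runs once round the circle. *)
Definition loop_w (t : R) := 2%:R * t - 1.
Definition loop_v (t : R) := t * (1 - t).
Definition loop_d t := loop_w t ^+ 2 + loop_v t ^+ 2.
Definition loop (t : R) : R * R :=
  ((loop_w t ^+ 2 - loop_v t ^+ 2) / loop_d t, 2%:R * (loop_w t * loop_v t) / loop_d t).

Lemma loop_d_gt0 t : 0 < loop_d t.
Proof.
have : 0 <= loop_d t by rewrite addr_ge0 ?sqr_ge0.
rewrite le_eqVlt => /orP[/eqP e|//]; exfalso.
have : loop_w t ^+ 2 + loop_v t ^+ 2 == 0 by rewrite -/(loop_d t) -e.
rewrite paddr_eq0 ?sqr_ge0 // !sqrf_eq0 => /andP[/eqP w0 /eqP v0].
have e1 : (1 : R) = 4%:R * loop_v t + loop_w t ^+ 2 by rewrite /loop_v /loop_w; ring.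
by have := oner_eq0 R; rewrite e1 w0 v0 mulr0 add0r expr0n eqxx.
Qed.

Lemma loop_d_neq0 t : loop_d t != 0.
Proof. by rewrite gt_eqF // loop_d_gt0. Qed.

Lemma loop_circle t : (loop t).1 ^+ 2 + (loop t).2 ^+ 2 = 1.
Proof.
have := loop_d_neq0 t; rewrite /loop /loop_d /=.
by move: (loop_w t) (loop_v t) => w v d0; field.
Qed.

Lemma loop_continuous : continuous loop.
Proof.
have cw : continuous loop_w.
  by move=> t; apply: cvgB; [apply: cvgM; [exact: cvg_cst|exact: cvg_id]|exact: cvg_cst].
have cv : continuous loop_v.
  by move=> t; apply: cvgM; [exact: cvg_id|apply: cvgB; [exact: cvg_cst|exact: cvg_id]].
have sq (f : R -> R) : continuous f -> continuous (fun t => f t ^+ 2).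
  by move=> cf t; apply: cvgM; exact: cf.
have cd : continuous loop_d by move=> t; apply: cvgD; exact: sq.
have ci : continuous (fun t => (loop_d t)^-1).
  by move=> t; apply: cvgV; [exact: loop_d_neq0|exact: cd].
have c1 : continuous (fun t => (loop t).1).
  by move=> t; apply: cvgM; [apply: cvgB; exact: sq|exact: ci].
have c2 : continuous (fun t => (loop t).2).
  move=> t; apply: cvgM; last exact: ci.
  by apply: cvgM; [exact: cvg_cst|apply: cvgM; [exact: cw|exact: cv]].
by move=> t; exact: (cvg_pair (c1 t) (c2 t)).
Qed.

Lemma loop_ends t : t = 0 \/ t = 1 -> loop t = (1, 0).
Proof.
move=> ht; have w1 : loop_w t ^+ 2 = 1 by case: ht => ->; rewrite /loop_w; ring.
have v0 : loop_v t = 0 by case: ht => ->; rewrite /loop_v; ring.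
by rewrite /loop /loop_d w1 v0 expr0n subr0 addr0 !mulr0 mul0r divr1.
Qed.

Lemma loop_inner t : 0 < t < 1 ->
  (loop t).1 != 1 /\ loop_w t = (loop t).2 / (1 - (loop t).1) * loop_v t.
Proof.
move=> /andP[t0 t1]; have v0 : loop_v t != 0.
  by rewrite mulf_neq0 ?gt_eqF // subr_gt0.
have := loop_d_neq0 t; rewrite /loop /loop_d /=.
move: (loop_w t) (loop_v t) v0 => w v v0 d0.
have e : 1 - (w ^+ 2 - v ^+ 2) / (w ^+ 2 + v ^+ 2) = 2%:R * v ^+ 2 / (w ^+ 2 + v ^+ 2).
  by field.
split.
  rewrite eq_sym -subr_eq0 e !mulf_neq0 ?invr_eq0 ?expf_neq0 ?pnatr_eq0 //.
by rewrite e; field; rewrite v0 d0.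
Qed.

Lemma loop_inj t s : 0 < t < 1 -> 0 < s < 1 -> loop t = loop s -> t = s.
Proof.
move=> ht hs e; have [_ et] := loop_inner ht; have [_ es] := loop_inner hs.
have cross : loop_w t * loop_v s = loop_w s * loop_v t.
  by rewrite et es e; ring.
move: ht hs => /andP[t0 t1] /andP[s0 s1].
have : (t - s) * ((1 - t) * (1 - s) + t * s) = 0.
  transitivity (loop_w t * loop_v s - loop_w s * loop_v t); last by rewrite cross subrr.
  by rewrite /loop_w /loop_v; ring.
have pos : 0 < (1 - t) * (1 - s) + t * s by rewrite addr_gt0 ?mulr_gt0 ?subr_gt0.
by move/eqP; rewrite mulf_eq0 (gt_eqF pos) orbF subr_eq0 => /eqP.
Qed.

Lemma loop_onto (x : R * R) : x.1 ^+ 2 + x.2 ^+ 2 = 1 -> x.1 != 1 ->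
  exists t, 0 < t < 1 /\ loop t = x.
Proof.
case: x => c s /= cs c1; have c1' : 1 - c != 0 by rewrite subr_eq0 eq_sym.
pose r := s / (1 - c); pose D := Num.sqrt (4%:R + r ^+ 2).
have DD : D ^+ 2 = 4%:R + r ^+ 2 by rewrite sqr_sqrtr // addr_ge0 ?sqr_ge0.
have D0 : 0 <= D by exact: sqrtr_ge0.
have Dr : r < D.
  have [r0|r0] := ltP r 0; first exact: lt_le_trans r0 D0.
  by rewrite -(ltr_pXn2r (n := 2)) ?nnegrE // DD ltrDr.
(* the positive solution of w = r v *)
pose q := 2%:R - r + D; pose t := 2%:R / q.
have q2 : 2%:R < q by rewrite /q; lra.
have q0 : 0 < q by apply: lt_trans q2.
have qn : q != 0 by rewrite gt_eqF.
have tt : 0 < t < 1 by rewrite divr_gt0 //= ltr_pdivrMr // mul1r.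
have wv : loop_w t = r * loop_v t.
  have eq : q * (4%:R - q) = 2%:R * r * (q - 2%:R).
    apply/eqP; rewrite -subr_eq0; apply/eqP.
    transitivity (4%:R + r ^+ 2 - D ^+ 2); first by rewrite /q; ring.
    by rewrite DD subrr.
  rewrite /loop_w /loop_v /t.
  transitivity ((q * (4%:R - q)) / q ^+ 2); first by field.
  by rewrite eq; field.
exists t; split=> //.
have v0 : loop_v t != 0.
  by move/andP: tt => [t0 t1]; rewrite mulf_neq0 ?gt_eqF // subr_gt0.
have := loop_d_neq0 t; rewrite /loop /loop_d wv.
move: (loop_v t) v0 => v v0.
have -> : (r * v) ^+ 2 + v ^+ 2 = 2%:R / (1 - c) * v ^+ 2.
  transitivity ((c ^+ 2 + s ^+ 2 + 1 - 2%:R * c) / (1 - c) ^+ 2 * v ^+ 2).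
    by rewrite /r; field.
  by rewrite cs; field.
move=> d0; congr (_, _).
  have -> : (r * v) ^+ 2 - v ^+ 2 = 2%:R * c / (1 - c) * v ^+ 2.
    transitivity ((c ^+ 2 + s ^+ 2 - 1 + 2%:R * c * (1 - c)) / (1 - c) ^+ 2 * v ^+ 2).
      by rewrite /r; field.
    by rewrite cs; field.
  by field; rewrite v0 c1'.
by rewrite /r; field; rewrite v0 c1'.
Qed.

End Loop.

Section LoopGraph.
Variables (R : realType) (V E : Type) (e : E -> V * V) (v0 : V) (a0 : E).
Hypotheses (Vsub : forall v : V, v = v0) (Esub : forall a : E, a = a0).
Local Notation G := (graph_body R e).
Local Notation S1 := (circle R).
Local Notation I01 := (unit_interval R).

Lemma loop_on_circle (t : R) : [set x : R * R | x.1 ^+ 2 + x.2 ^+ 2 = 1] (loop t).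
Proof. exact: loop_circle. Qed.

Definition loop_pt (t : R) : S1 := exist _ (loop t) (mem_set (loop_on_circle t)).

Lemma loop_ptE t : set_val (loop_pt t) = loop t.
Proof. by rewrite set_valE. Qed.

Definition graph_to_circle (x : G) : S1 :=
  match x with VertexCell _ => loop_pt 0 | EdgeCell _ t => loop_pt (sval t) end.

Lemma circle_eq (x y : S1) : set_val x = set_val y -> x = y.
Proof. by rewrite set_valE; exact: val_inj. Qed.

Lemma graph_to_circle_edge a (t : I01) :
  graph_to_circle (edge_map e a t) = loop_pt (set_val t).
Proof.
rewrite /edge_map; case: pselect => [//|nt]; apply: circle_eq; rewrite /= !loop_ptE.
rewrite !loop_ends //; last by left.
have [/= /andP[t0 t1]] : [set t : R | 0 <= t <= 1] (set_val t) by exact: set_valP.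
move: t0 t1 nt; rewrite !le_eqVlt => /orP[/eqP <-|->]; first by left.
by move=> /orP[/eqP ->|->]; [right|case].
Qed.

Lemma edge_map_onto (x : G) : exists t, x = edge_map e a0 t.
Proof.
case: x => [v|a [t ht]].
  have h0 : [set t : R | 0 <= t <= 1] 0 by rewrite /= lexx ler01.
  exists (exist _ 0 (mem_set h0)); rewrite /edge_map set_valE /=.
  case: pselect => [h|_]; first by exfalso; move: h; rewrite ltxx.
  by rewrite eqxx (Vsub v) -(Vsub (e a0).1).
have h : [set t : R | 0 <= t <= 1] t by case/andP: (ht) => /ltW /= -> /ltW ->.
exists (exist _ t (mem_set h)); rewrite /edge_map set_valE /=.
case: pselect => [h'|[]//]; rewrite (Esub a); congr EdgeCell; exact: eq_exist.
Qed.

Lemma graph_to_circle_inj : injective graph_to_circle.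
Proof.
have vertex_edge t : 0 < t < 1 -> loop_pt 0 <> loop_pt t.
  move=> /loop_inner[t1 _] /(congr1 set_val); rewrite !loop_ptE => h.
  by move: t1; rewrite -h loop_ends ?eqxx //; left.
move=> [v|a [t ht]] [v'|a' [t' ht']] /=.
- by rewrite (Vsub v) (Vsub v').
- by move/vertex_edge => /(_ ht').
- by move/esym/vertex_edge => /(_ ht).
move=> /(congr1 set_val); rewrite !loop_ptE => /(loop_inj ht ht') tt.
by rewrite (Esub a) (Esub a'); congr EdgeCell; exact: eq_exist.
Qed.

Lemma graph_to_circle_onto (x : S1) : exists y, graph_to_circle y = x.
Proof.
have hx : (set_val x).1 ^+ 2 + (set_val x).2 ^+ 2 = 1 by exact: (set_valP x).
have [x1|x1] := eqVneq (set_val x).1 1; last first.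
  have [t [ht et]] := loop_onto hx x1.
  exists (EdgeCell V a0 (exist _ t ht)); apply: circle_eq.
  by rewrite /= loop_ptE.
exists (VertexCell R E v0); apply: circle_eq; rewrite /= loop_ptE loop_ends; last by left.
move: hx x1; case: (set_val x) => c s /= cs c1; congr (_, _); first by [].
move: cs; rewrite c1 expr1n => /eqP; rewrite -subr_eq0 addrAC subrr add0r.
by rewrite sqrf_eq0 => /eqP.
Qed.

Lemma loop_pt_continuous : continuous (fun t : I01 => loop_pt (set_val t)).
Proof.
apply/continuousP => _ [B oB <-].
have c : continuous (fun t : I01 => loop (set_val t)).
  move=> t; apply: continuous_comp; first exact: initial_continuous.
  exact: loop_continuous.
by move/continuousP: c => /(_ B oB); congr open.
Qed.

Lemma graph_to_circle_continuous : continuous graph_to_circle.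
Proof.
apply/continuousP => W oW; suff h : graph_open (graph_to_circle @^-1` W) by exact: h.
move=> a; move/continuousP: loop_pt_continuous => /(_ W oW).
congr open; apply/seteqP.
by split=> t; rewrite /preimage /mkset graph_to_circle_edge.
Qed.

(** A continuous bijection from a compact space to a Hausdorff one is closed. *)
Lemma circle_to_graph_continuous (g : S1 -> G) :
  cancel graph_to_circle g -> cancel g graph_to_circle -> continuous g.
Proof.
move=> fK gK; apply/continuous_closedP => F cF.
have : open (edge_map e a0 @^-1` (~` F)) by move/closed_openC: cF; exact.
move=> [O oO eO]; pose B := ~` O `&` `[0, 1].
have cB : compact B.
  apply: (subclosed_compact _ (@segment_compact R 0 1)); last by move=> ? [].
  by apply: closedI; [exact: open_closedC|exact: interval_closed].
have cl : closed (@loop R @` B).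
  apply: compact_closed; first exact: norm_hausdorff.
  apply: continuous_compact => //; apply: continuous_subspaceT; exact: loop_continuous.
suff -> : g @^-1` F = set_val @^-1` (@loop R @` B).
  rewrite -[X in closed X]setCK; apply: open_closedC.
  by exists (~` (@loop R @` B)) => //; exact: closed_openC.
have memO t : O (set_val t) <-> ~ F (edge_map e a0 t).
  by change ((set_val @^-1` O) t <-> (edge_map e a0 @^-1` (~` F)) t); rewrite eO.
apply/seteqP; split=> x.
  rewrite /preimage /mkset => Fx; have [t et] := edge_map_onto (g x).
  exists (set_val t).
    split; first by move/memO; rewrite -et.
    by have := set_valP t; rewrite -set_valE /= in_itv.
  by rewrite -loop_ptE -(graph_to_circle_edge a0) -et gK.
move=> [t [nO]]; rewrite /= in_itv /= => ht ex.
pose t' : I01 := exist _ t (mem_set ht).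
have et : set_val t' = t by rewrite set_valE.
have -> : x = graph_to_circle (edge_map e a0 t').
  by apply: circle_eq; rewrite graph_to_circle_edge loop_ptE et.
rewrite /preimage /mkset fK; apply: contrapT => nF; apply: nO.
by rewrite -et; apply/memO.
Qed.

Lemma homotopic_refl (S T : topologicalType) (f : S -> T) :
  continuous f -> homotopic R f f.
Proof.
move=> cf; exists (f \o fst) => // -[x t]; apply: continuous_comp; last exact: cf.
exact: cvg_fst.
Qed.

Lemma loop_graph_circle : homotopy_equivalent R G S1.
Proof.
have /choice[g gK] := graph_to_circle_onto.
have fK : cancel graph_to_circle g by move=> x; apply: graph_to_circle_inj; rewrite gK.
exists graph_to_circle, g; split.
- exact: graph_to_circle_continuous.
- exact: circle_to_graph_continuous.
- have -> : g \o graph_to_circle = id by apply/funext => x; exact: fK.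
  by apply: homotopic_refl => x; exact: cvg_id.
- have -> : graph_to_circle \o g = id by apply/funext => x; exact: gK.
  by apply: homotopic_refl => x; exact: cvg_id.
Qed.

End LoopGraph.

(** * The compactification *)

Section Compactification.
Variable K : numClosedFieldType.
Variables (lambda mu nu : 'I_3 -> K).
Hypotheses (lam0 : forall i, lambda i != 0) (mu0 : forall i, mu i != 0).
Hypothesis linj : injective lambda.
Local Notation MB := (character_variety lambda mu nu).
Local Notation C := (rep_cubic lambda mu nu).
Local Notation X := (proj_cubic C).
Local Notation D := (@infinity_section K C).

Lemma det_relation : [set: MB] !=set0 -> e3 nu = e3 lambda * e3 mu.
Proof.
move=> [c _]; have [_ _ /has_eigenvalues3[_ _ <-] /has_eigenvalues3[_ _ <-]] :=
  set_valP (class_repr c).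
by move=> /has_eigenvalues3[_ _ <-]; rewrite det_mulmx.
Qed.

Hypotheses (MB_nonempty : [set: MB] !=set0) (MB_affine : affine_variety MB).

(** The affineness of the character variety is what excludes reducible pairs
    with the given eigenvalues. *)
Lemma complement_iso : isomorphic MB (subspace_wf (~` D)).
Proof.
have det_rel := det_relation MB_nonempty.
apply: (isomorphic_trans (character_iso lam0 mu0 linj det_rel)).
rewrite generic_locus_affine // compl_infinity; apply: isomorphic_sym.
by exists (@chart_map _ C I3); exact: chart_iso.
Qed.

Lemma compactification_smooth : smooth 2 MB -> smooth 2 X.
Proof.
move=> sM x; have [Dx|] := pselect (D x).
  by apply: cubic_smooth_at_infinity => //; exact: e3_neq0.
move=> nDx; change ((~` D) x) in nDx.
have [h [mh [k [mk hk kh]]]] := complement_iso.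
pose x' : subspace_wf (~` D) := SigSub (mem_set nDx).
have -> : x = set_val (h (k x')) by rewrite kh set_valE.
apply: (smooth_at_embed (proj_cubic_ringed C) (infinity_closed C)) => //.
by split=> //; exists k.
Qed.

Lemma component_unique (c c' : component (subspace_wf D)) : c = c'.
Proof.
case: c c' => [S iS] [S' iS']; apply: eq_exist.
by move: iS iS'; rewrite !infinity_component ?e3_neq0 // => -> ->.
Qed.

Lemma nodes_unique (p q : node (subspace_wf D)) : p = q.
Proof.
case: p q => [p hp] [q hq]; apply: eq_exist.
have c0 : cc C != 0 by exact: e3_neq0.
have a0 : ca C != 0 by exact: e3_neq0.
by rewrite (infinity_node_unique c0 a0 hp) (infinity_node_unique c0 a0 hq).
Qed.

End Compactification.

Theorem theorem1p2 (R : realType) (lambda mu nu : 'I_3 -> R[i])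
    (lambda_neq0 : forall i, lambda i != 0)
    (mu_neq0 : forall i, mu i != 0)
    (nu_neq0 : forall i, nu i != 0)
    (lambda_inj : injective lambda)
    (mu_inj : injective mu)
    (nu_inj : injective nu)
    (MB_nonempty : [set: character_variety lambda mu nu] !=set0)
    (MB_affine : affine_variety (character_variety lambda mu nu))
    (MB_smooth : smooth 2 (character_variety lambda mu nu)) :
  exists (X : space_with_functions R[i]) (D : set X),
    [/\ [/\ variety X, complete X, irreducible_space X & smooth 2 X],
        zclosed D,
        isomorphic (character_variety lambda mu nu) (subspace_wf (~` D)),
        type_I1 (subspace_wf D)
      & (exists e, @nerve_edges _ (subspace_wf D) e) /\
        (forall e, @nerve_edges _ (subspace_wf D) e ->
           homotopy_equivalent R (graph_body R e) (circle R))].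
Proof.
have c0 : cc (rep_cubic lambda mu nu) != 0 by exact: e3_neq0.
have a0 : ca (rep_cubic lambda mu nu) != 0 by exact: e3_neq0.
exists (proj_cubic (rep_cubic lambda mu nu)), (@infinity_section _ _).
pose comp : component (subspace_wf (@infinity_section _ (rep_cubic lambda mu nu))) :=
  exist _ setT ((infinity_component c0 a0 setT).2 erefl).
pose p : node (subspace_wf (@infinity_section _ (rep_cubic lambda mu nu))) :=
  exist _ (infinity_node c0) (infinity_node_at c0).
have uc c : c = comp by exact: component_unique.
split.
- split; [exact: proj_cubic_variety|exact: proj_cubic_complete|exact: proj_cubic_irreducible|].
  exact: compactification_smooth.
- exact: infinity_closed.
- exact: complement_iso.
- exact: infinity_type_I1.
split.
  exists (fun _ => (comp, comp)) => q c; rewrite (uc c).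
  by split=> // _; left.
move=> e _; apply: (@loop_graph_circle R _ _ e comp p) => // q.
exact: nodes_unique.
Qed.
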